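(* Let $b$ be a connected graph over $X$, let $q:X\to\mathbb{R}$ be a potential such that $h\ge0$ on $C_c(X)$, and suppose that $h$ is subcritical in $X$. Let $G$ be the positive minimal Green function of $h$ in $X$, and let $o\in X$ be fixed. (a) We have $$G(x,y)=\lim_{\lambda\nearrow0}(H^{(1)}-\lambda)^{-1}1_{\{x\}}(y)$$ for all $x,y\in X$, and the convergence is monotone increasing. In particular, $G(x,y)=G(y,x)$ for all $x,y\in X$, and $G(x,\cdot)$ and $G(\cdot,x)$ are $H$-superharmonic with $$HG(x,\cdot)=HG(\cdot,x)=1_{\{x\}},\qquad x\in X.$$ (b) We have $$G(x,y)=\lim_{n\to\infty}H_{K_n}^{-1}1_{\{x\}}(y)$$ for all $x,y\in X$ and all exhaustions $(K_n)$ of $X$, and the convergence is both pointwise monotone increasing and with respect to $\|\cdot\|_{h,o}$; i.e., for any $x\in X$ we have $G(x,\cdot)\in D_{h,o}$. Moreover, $G(x,\cdot)$ can be characterized in $D_{h,o}$ as follows. Let $g\in D_{h,o}$ and $x\in X$. Then the following statements are equivalent: (i) $g=G(x,\cdot)$. (ii) $\overline h(g/g(x))=\inf\{h(f)\mid f\in C_c(X),\ f(x)=1\}$. (iii) $Hg=1_{\{x\}}$. (iv) $\overline h(g,f)=f(x)$ for all $f\in D_{h,o}$. (c) For every $x\in X$, $G(x,\cdot)$ is the smallest positive solution $g$ to the inequality $Hg\ge1_{\{x\}}$.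
   Context: $X$ is an infinite set with the discrete topology. A graph over $X$ is a symmetric function $b:X\times X\to[0,\infty)$ with zero diagonal such that $\sum_{y\in X}b(x,y)<\infty$ for all $x\in X$; it is connected if any two vertices are joined by a finite path $x_0,\dots,x_n$ with $b(x_i,x_{i+1})>0$. $C(X)$ is the space of real valued functions on $X$ and $C_c(X)$ the subspace of finitely supported functions. Let $F(X)=\{f\in C(X)\mid \sum_{y}b(x,y)|f(y)|<\infty \text{ for all } x\in X\}$, and for $f\in F(X)$ let $Hf(x)=\sum_{y}b(x,y)(f(x)-f(y))+q(x)f(x)$. The form $h$ on $C_c(X)\times C_c(X)$ is $h(\varphi,\psi)=\frac12\sum_{x,y}b(x,y)(\varphi(x)-\varphi(y))(\psi(x)-\psi(y))+\sum_x q(x)\varphi(x)\psi(x)$, $h(\varphi)=h(\varphi,\varphi)$; $h\ge0$ on $C_c(X)$ means $h(\varphi)\ge0$ for all $\varphi\in C_c(X)$. A function is positive if it is $\ge0$ and $\ne0$. A function $u\in F(X)$ is $H$-superharmonic in $X$ if $Hu\ge0$ on $X$; solutions of $Hg\ge 1_{\{x\}}$ are understood to be in $F(X)$. If $h\ge0$ on $C_c(X)$, then $h$ is closable in $\ell^2(X)$ (counting measure), and $H^{(1)}$ denotes the nonnegative selfadjoint operator in $\ell^2(X)$ associated with its closure. The form $h\ge0$ is subcritical in $X$ if there is a positive $w\in C(X)$ with $h(\varphi)\ge\sum_x w(x)\varphi(x)^2$ for all $\varphi\in C_c(X)$. The positive minimal Green function of a subcritical $h$ is $G(x,y)=\int_0^\infty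 e^{-tH^{(1)}}1_{\{x\}}(y)\,\mathrm{d}t$, which is finite for all $x,y\in X$ when $h$ is subcritical. For finite $K\subseteq X$, $H_K$ is the operator on $C_c(K)=\ell^2(K)$ associated with the restriction of $h$ to $C_c(K)$, i.e. $H_K\varphi(x)=H\varphi(x)$ for $x\in K$ and $\varphi\in C_c(K)$ (extended by zero); it is invertible. $H_{K}^{-1}1_{\{x\}}$ (for $x\in K$) is extended by zero to $X$. An exhaustion of $X$ is a sequence of finite subsets $K_n\subseteq K_{n+1}$ with $\bigcup_nK_n=X$. For $o\in X$ let $\|\varphi\|_{h,o}=\sqrt{h(\varphi)+\varphi(o)^2}$, a norm on $C_c(X)$; different choices of $o$ give equivalent norms, and convergence in it implies pointwise convergence. $D_{h,o}\subset C(X)$ is the completion of $C_c(X)$ with respect to $\|\cdot\|_{h,o}$, realized as the space of pointwise limits of $\|\cdot\|_{h,o}$-Cauchy sequences in $C_c(X)$. For $f\in D_{h,o}$ the limit of such a sequence $(\varphi_n)$, $\overline h(f)=\lim_n h(\varphi_n)$; by polarization $\overline h$ is a bilinear form on $D_{h,o}$, and $\|f\|_{h,o}=\sqrt{\overline h(f)+f(o)^2}$ on $D_{h,o}$.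
   Formalization: As printed, (ii) is unchanged when g is multiplied by a nonzero constant, so g=2G(x,·) satisfies (ii) but not (i); the formal (ii) adds the normalization g(x)=G(x,x), and (ii) alone is shown equivalent to g=cG(x,·) for some c≠0. *)

(* Defs.v *)
From HB Require Import structures.
From mathcomp Require Import all_boot all_order all_algebra.
From mathcomp Require Import all_classical all_reals all_analysis.
Set Implicit Arguments.
Unset Strict Implicit.
Unset Printing Implicit Defensive.
Import Order.TTheory GRing.Theory Num.Theory.
Import numFieldNormedType.Exports.
Local Open Scope classical_set_scope.
Local Open Scope ring_scope.

(* Sum of an absolutely summable real family over a type; it is only meaningful
   for such families. *)
Definition sumR (R : realType) (T : choiceType) (f : T -> R) : R :=
  fine (\esum_(x in [set: T]) (f^\+ x)%:E)
  - fine (\esum_(x in [set: T]) (f^\- x)%:E).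

Definition positive (R : realType) (X : choiceType) (f : X -> R) : Prop :=
  (forall x, 0 <= f x) /\ exists x, f x != 0.

Record is_graph (R : realType) (X : choiceType) (b : X -> X -> R) : Prop := {
  graph_ge0 : forall x y, 0 <= b x y ;
  graph_sym : forall x y, b x y = b y x ;
  graph_diag : forall x, b x x = 0 ;
  graph_sum : forall x, (\esum_(y in [set: X]) (b x y)%:E < +oo)%E }.

Definition connected_graph (R : realType) (X : choiceType) (b : X -> X -> R) :
    Prop :=
  forall x y, exists2 p : seq X, path (fun u v => 0 < b u v) x p & last x p = y.

Definition Cc (R : realType) (X : choiceType) (f : X -> R) : Prop :=
  finite_set [set x | f x != 0].

Definition Fdom (R : realType) (X : choiceType) (b : X -> X -> R)
    (f : X -> R) : Prop :=
  forall x, (\esum_(y in [set: X]) (b x y * `|f y|)%:E < +oo)%E.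

Definition Hop (R : realType) (X : choiceType) (b : X -> X -> R) (q : X -> R)
    (f : X -> R) (x : X) : R :=
  sumR (fun y => b x y * (f x - f y)) + q x * f x.

Definition superharmonic (R : realType) (X : choiceType) (b : X -> X -> R)
    (q : X -> R) (u : X -> R) : Prop :=
  Fdom b u /\ forall x, 0 <= Hop b q u x.

Definition hform (R : realType) (X : choiceType) (b : X -> X -> R)
    (q : X -> R) (phi psi : X -> R) : R :=
  2^-1 * sumR (fun p : X * X =>
    b p.1 p.2 * (phi p.1 - phi p.2) * (psi p.1 - psi p.2))
  + sumR (fun x => q x * phi x * psi x).

Definition hquad (R : realType) (X : choiceType) (b : X -> X -> R)
    (q : X -> R) (phi : X -> R) : R := hform b q phi phi.

Definition form_ge0 (R : realType) (X : choiceType) (b : X -> X -> R)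
    (q : X -> R) : Prop := forall phi, Cc phi -> 0 <= hquad b q phi.

Definition subcritical (R : realType) (X : choiceType) (b : X -> X -> R)
    (q : X -> R) : Prop :=
  exists2 w : X -> R, positive w &
    forall phi, Cc phi -> sumR (fun x => w x * phi x ^+ 2) <= hquad b q phi.

(* Extensions of h from Cc to limits of Cauchy sequences. [N] is a norm or the
   square of a seminorm. *)
Definition cauchy_wrt (R : realType) (X : choiceType) (N : (X -> R) -> R)
    (phi : nat -> X -> R) : Prop :=
  forall e : R, 0 < e -> exists n0 : nat, forall m n : nat,
    (n0 <= m)%N -> (n0 <= n)%N -> N (phi m - phi n) < e.

(* [approx phi f] says that the sequence phi in Cc is an admissible
   approximation of f; the limit below does not depend on the sequence for the
   two notions of approximation used here. *)
Definition quad_ext (R : realType) (X : choiceType) (b : X -> X -> R)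
    (q : X -> R) (approx : (nat -> X -> R) -> (X -> R) -> Prop)
    (f : X -> R) : R :=
  lim (hquad b q (xget (fun=> 0) [set phi | approx phi f] n) @[n --> \oo]).

Definition polarize (R : realType) (X : choiceType) (Q : (X -> R) -> R)
    (f g : X -> R) : R := (Q (f + g) - Q (f - g)) / 4.

(* The Hilbert space l^2(X), counting measure *)
Definition l2 (R : realType) (X : choiceType) (f : X -> R) : Prop :=
  (\esum_(x in [set: X]) (f x ^+ 2)%:E < +oo)%E.

Definition l2inner (R : realType) (X : choiceType) (f g : X -> R) : R :=
  sumR (fun x => f x * g x).

Definition l2norm (R : realType) (X : choiceType) (f : X -> R) : R :=
  Num.sqrt (l2inner f f).

Definition l2_approx (R : realType) (X : choiceType) (b : X -> X -> R)
    (q : X -> R) (phi : nat -> X -> R) (f : X -> R) : Prop :=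
  [/\ l2 f, forall n, Cc (phi n), cauchy_wrt (hquad b q) phi
    & l2norm (phi n - f) @[n --> \oo] --> (0 : R)].

Definition closure_dom (R : realType) (X : choiceType) (b : X -> X -> R)
    (q : X -> R) (f : X -> R) : Prop := exists phi, l2_approx b q phi f.

Definition closure_form (R : realType) (X : choiceType) (b : X -> X -> R)
    (q : X -> R) : (X -> R) -> (X -> R) -> R :=
  polarize (quad_ext b q (l2_approx b q)).

(* Unbounded operators in l^2(X) are represented by their graphs:
   [A f g] means that f is in the domain of A and A f = g. *)
Definition H1 (R : realType) (X : choiceType) (b : X -> X -> R)
    (q : X -> R) (f g : X -> R) : Prop :=
  [/\ closure_dom b q f, l2 g & forall psi, closure_dom b q psi ->
    closure_form b q f psi = l2inner g psi].

(* (A - l)^{-1} f *)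
Definition resolvent (R : realType) (X : choiceType)
    (A : (X -> R) -> (X -> R) -> Prop) (l : R) (f : X -> R) : X -> R :=
  xget (fun=> 0) [set u | exists2 g, A u g & forall x, g x - l * u x = f x].

Record C0_semigroup (R : realType) (X : choiceType)
    (T : R -> (X -> R) -> (X -> R)) : Prop := {
  C0_l2 : forall t f, 0 <= t -> l2 f -> l2 (T t f) ;
  C0_linear : forall t (c : R) f g, 0 <= t -> l2 f -> l2 g ->
    T t (fun x => c * f x + g x) = (fun x => c * T t f x + T t g x) ;
  C0_bounded : forall t, 0 <= t ->
    exists M : R, forall f, l2 f -> l2norm (T t f) <= M * l2norm f ;
  C0_zero : forall f, l2 f -> T 0 f = f ;
  C0_add : forall s t f, 0 <= s -> 0 <= t -> l2 f ->
    T (s + t) f = T s (T t f) ;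
  C0_continuous : forall f, l2 f ->
    l2norm (T t f - f) @[t --> 0^'+] --> (0 : R) }.

Definition generator (R : realType) (X : choiceType)
    (T : R -> (X -> R) -> (X -> R)) (f g : X -> R) : Prop :=
  [/\ l2 f, l2 g &
    l2norm (fun x => (T t f x - f x) / t - g x) @[t --> 0^'+] --> (0 : R)].

(* e^{-tA}: the strongly continuous semigroup on l^2(X) with generator -A
   (unique on l^2(X) and t >= 0). *)
Definition exp_semigroup (R : realType) (X : choiceType)
    (A : (X -> R) -> (X -> R) -> Prop) : R -> (X -> R) -> (X -> R) :=
  xget ((fun _ f => f) : R -> (X -> R) -> (X -> R)) [set T |
    C0_semigroup T /\ forall f g, generator T f g <-> A f (- g)].

Definition Green (R : realType) (X : choiceType) (b : X -> X -> R)
    (q : X -> R) (x y : X) : R :=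
  \int[lebesgue_measure]_(t in `[0, +oo[%classic)
    exp_semigroup (H1 b q) t \1_[set x] y.

(* H_K^{-1} f, extended by zero *)
Definition HKinv (R : realType) (X : choiceType) (b : X -> X -> R)
    (q : X -> R) (K : set X) (f : X -> R) : X -> R :=
  xget (fun=> 0) [set phi | (forall y, ~ K y -> phi y = 0) /\
    (forall y, K y -> Hop b q phi y = f y)].

Definition exhaustion (X : choiceType) (K : nat -> set X) : Prop :=
  [/\ forall n, finite_set (K n), forall n, K n `<=` K n.+1
    & \bigcup_n K n = [set: X]].

Definition ho_norm (R : realType) (X : choiceType) (b : X -> X -> R)
    (q : X -> R) (o : X) (phi : X -> R) : R :=
  Num.sqrt (hquad b q phi + phi o ^+ 2).

Definition ho_approx (R : realType) (X : choiceType) (b : X -> X -> R)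
    (q : X -> R) (o : X) (phi : nat -> X -> R) (f : X -> R) : Prop :=
  [/\ forall n, Cc (phi n), cauchy_wrt (ho_norm b q o) phi
    & forall x, phi n x @[n --> \oo] --> f x].

Definition Dho (R : realType) (X : choiceType) (b : X -> X -> R)
    (q : X -> R) (o : X) (f : X -> R) : Prop :=
  exists phi, ho_approx b q o phi f.

Definition hbar_quad (R : realType) (X : choiceType) (b : X -> X -> R)
    (q : X -> R) (o : X) : (X -> R) -> R := quad_ext b q (ho_approx b q o).

Definition hbar (R : realType) (X : choiceType) (b : X -> X -> R)
    (q : X -> R) (o : X) : (X -> R) -> (X -> R) -> R :=
  polarize (hbar_quad b q o).

Definition Dho_norm (R : realType) (X : choiceType) (b : X -> X -> R)
    (q : X -> R) (o : X) (f : X -> R) : R :=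
  Num.sqrt (hbar_quad b q o f + f o ^+ 2).

(* Main.v *)
(** Testing against indicator functions gives a Harnack inequality for
    [sum_z b(x,z) |phi z|]; with connectedness and subcriticality,
      point evaluations
    are then bounded for the form norm.  So [h] is a closable inner product on
      its
    own completion, where a linear functional is represented as the limit of the
    solutions on an exhaustion [K_n] (if [u_n] represents it on [C_c(K_n)], then
    [h(u_m - u_n) = h(u_m) - h(u_n)] for [n <=
      m]).  Applied to the evaluation at [x],
    this gives a kernel [g_x] with [H g_x = 1_x];
      the maximum principle on finite
    sets gives monotonicity, symmetry comes from reproduction,
      and every positive
    [g] with [H g >= 1_x] dominates the approximations.

    The same construction for [q + al] gives [(H1 + al)^-1], which increases to
    [g_x] as [al] decreases to 0.  The semigroup of [H1] is the limit of
    [(1 + t/2^n H1)^(-2^n)]; it is the only C0-semigroup with that generator,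
      and it
    preserves positivity.  Since [g = (H1 + al)^-1 1_x] satisfies
    [d/dt (e^(-al t) T_t g) = - e^(-al t) T_t 1_x], the Laplace transform of
    [T_t 1_x (y)] at [al] is [g y], and monotone convergence for [al ->
      0] identifies
    the time integral of the semigroup with [g_x y]. *)

Require Import Defs.
From HB Require Import structures.
From mathcomp Require Import all_boot all_order all_algebra finmap ring lra.
From mathcomp Require Import all_classical all_reals all_analysis.
From mathcomp Require Import measurable_realfun.
Set Implicit Arguments.
Unset Strict Implicit.
Unset Printing Implicit Defensive.
Import Order.TTheory GRing.Theory Num.Theory.
Import numFieldNormedType.Exports.
Local Open Scope classical_set_scope.
Local Open Scope ring_scope.

(** * Sums of absolutely summable families *)

(** The definitions reach the Green function through objects picked by [xget]: approximating
    sequences, resolvents, the semigroup. Each becomes usable only after existence and uniqueness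
    are proved, and this shapes the development. For the semigroup there is a further obstacle:
    [C0_semigroup] gives continuity at time 0 only, and an operator bound at each single time with
    no uniformity in [t]. Left continuity of an orbit is therefore transported from a single point
    of continuity, and a right-continuous function has such points in every interval.

    One notion, [coercive], stands in for subcriticality: nonnegativity together with bounded point
    evaluations. If [h] is nonnegative, the potential [q + al] has it for every [al > 0], and the
    completed form of [q + al] is the l2 closure of [h] plus [al] times the inner product. Hence the
    completion and the kernel are built once, and the resolvents of [H1] at negative numbers are the
    kernels of shifted potentials. *)

Lemma ler_of_sqr (R : realDomainType) (u v : R) :
  0 <= u -> 0 <= v -> u ^+ 2 <= v ^+ 2 -> u <= v.
Proof. by move=> u0 v0; rewrite ler_sqr. Qed.

Section Sums.
Variables (R : realType) (T : choiceType).
Implicit Types (f g : T -> R) (K L : {fset T}).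

Definition abs_summable f := exists M : R, forall K, \sum_(x <- K) `|f x| <= M.

Lemma fsum_ge0 K f : (forall x, 0 <= f x) -> 0 <= \sum_(x <- K) f x.
Proof. by move=> f0; apply: sumr_ge0. Qed.

Lemma fsum_subset K L f : (forall x, 0 <= f x) -> (K `<=` L)%fset ->
  \sum_(x <- K) f x <= \sum_(x <- L) f x.
Proof.
move=> f0 KL; rewrite (big_fsetID _ (mem K) L) /=.
rewrite (_ : [fset x in L | x \in K]%fset = K); last first.
  by apply/fsetP => x; rewrite !inE /= andb_idl//; exact: (fsubsetP KL).
by rewrite lerDl; exact: fsum_ge0.
Qed.

Lemma fsum_supp_in K L f : (forall x, x \in L -> x \notin K -> f x = 0) ->
  (K `<=` L)%fset -> \sum_(x <- L) f x = \sum_(x <- K) f x.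
Proof.
move=> f0 KL; rewrite (big_fsetID _ (mem K) L) /=.
rewrite (_ : [fset x in L | x \in K]%fset = K); last first.
  by apply/fsetP => x; rewrite !inE /= andb_idl//; exact: (fsubsetP KL).
rewrite [X in _ + X]big1_seq ?addr0// => x /=.
by rewrite !inE /= => /andP[xL xK]; exact: f0.
Qed.

Lemma fsum_supp K L f : (forall x, x \notin K -> f x = 0) -> (K `<=` L)%fset ->
  \sum_(x <- L) f x = \sum_(x <- K) f x.
Proof. by move=> f0; apply: fsum_supp_in => x _; exact: f0. Qed.

Lemma esum_le_fsum f M : (forall x, 0 <= f x) ->
  (forall K, \sum_(x <- K) f x <= M) ->
  (\esum_(x in [set: T]) (f x)%:E <= M%:E)%E.
Proof.
move=> f0 fM; apply: ge_ereal_sup => _ [A [finA _] <-].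
by rewrite fsbig_finite//= sumEFin lee_fin.
Qed.

Lemma fsum_le_esum f K : (forall x, 0 <= f x) ->
  ((\sum_(x <- K) f x)%:E <= \esum_(x in [set: T]) (f x)%:E)%E.
Proof.
move=> f0; apply: ereal_sup_ubound => /=; exists [set` K].
  by split => //; exact: finite_fset.
by rewrite fsbig_finite/= ?set_fsetK ?sumEFin//; exact: finite_fset.
Qed.

Lemma esum_fin f : (forall x, 0 <= f x) ->
  (\esum_(x in [set: T]) (f x)%:E < +oo)%E <-> abs_summable f.
Proof.
move=> f0; split => [foo|[M fM]].
  exists (fine (\esum_(x in [set: T]) (f x)%:E)) => K.
  under eq_bigr do rewrite ger0_norm//.
  rewrite -lee_fin fineK; first exact: fsum_le_esum.
  by rewrite ge0_fin_numE//; apply: esum_ge0 => x _; rewrite lee_fin.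
apply: (@le_lt_trans _ _ M%:E); last by rewrite ltry.
apply: esum_le_fsum => // K.
by apply: le_trans (fM K); apply: ler_sum => x _; exact: ler_norm.
Qed.

Lemma abs_summable_le f g : (forall x, `|f x| <= `|g x|) ->
  abs_summable g -> abs_summable f.
Proof.
move=> fg [M gM]; exists M => K; apply: le_trans (gM K).
exact: ler_sum.
Qed.

Lemma abs_summableD f g : abs_summable f -> abs_summable g ->
  abs_summable (fun x => f x + g x).
Proof.
move=> [M fM] [N gN]; exists (M + N) => K.
apply: le_trans (lerD (fM K) (gN K)); rewrite -big_split/=.
by apply: ler_sum => x _; exact: ler_normD.
Qed.

Lemma abs_summableZ c f : abs_summable f -> abs_summable (fun x => c * f x).
Proof.
move=> [M fM]; exists (`|c| * M) => K.
under eq_bigr do rewrite normrM.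
by rewrite -mulr_sumr; exact: ler_wpM2l.
Qed.

Lemma abs_summableN f : abs_summable f -> abs_summable (fun x => - f x).
Proof. by apply: abs_summable_le => x; rewrite normrN. Qed.

Lemma abs_summableB f g : abs_summable f -> abs_summable g ->
  abs_summable (fun x => f x - g x).
Proof. by move=> fs /abs_summableN; exact: abs_summableD. Qed.

Lemma abs_summable_supp K f : (forall x, x \notin K -> f x = 0) ->
  abs_summable f.
Proof.
move=> f0; exists (\sum_(x <- K) `|f x|) => L.
rewrite -(@fsum_supp K (K `|` L)%fset (fun x => `|f x|)).
- exact/fsum_subset/fsubsetUr.
- by move=> x /f0 ->; rewrite normr0.
- exact: fsubsetUl.
Qed.

Lemma esum_approx f : (forall x, 0 <= f x) -> abs_summable f ->
  forall e, 0 < e ->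
  exists K0, forall K, (K0 `<=` K)%fset ->
    `|\sum_(x <- K) f x - fine (\esum_(x in [set: T]) (f x)%:E)| <= e.
Proof.
move=> f0 fs e e0; set s := fine _.
have sfin : (\esum_(x in [set: T]) (f x)%:E = s%:E)%E.
  rewrite fineK// ge0_fin_numE; first by apply/esum_fin.
  by apply: esum_ge0 => x _; rewrite lee_fin.
have [K0 sK0] : exists K0, s - e <= \sum_(x <- K0) f x.
  apply: contrapT => /forallNP nK.
  have : (s%:E <= (s - e)%:E)%E.
    rewrite -sfin; apply: esum_le_fsum => // K.
    by rewrite leNgt; apply/negP => /ltW; exact: nK.
  by rewrite lee_fin; lra.
exists K0 => K K0K; rewrite ler_norml.
have := fsum_le_esum K f0; rewrite sfin lee_fin.
have := fsum_subset f0 K0K; lra.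
Qed.

Lemma sumR_approx f : abs_summable f -> forall e, 0 < e ->
  exists K0, forall K, (K0 `<=` K)%fset ->
    `|\sum_(x <- K) f x - sumR f| <= e.
Proof.
move=> fs e e0; have e20 : 0 < e / 2 by lra.
have p0 x : 0 <= f^\+ x by exact: funrpos_ge0.
have n0 x : 0 <= f^\- x by exact: funrneg_ge0.
have fE x : f x = f^\+ x - f^\- x.
  by rewrite -{1}(funrposBneg f).
have fA x : `|f x| = f^\+ x + f^\- x.
  by rewrite -[RHS]/((f^\+ + f^\-) x) funrposDneg.
have ps : abs_summable f^\+.
  by apply: abs_summable_le fs => x; rewrite fA ger0_norm// lerDl.
have ns : abs_summable f^\-.
  by apply: abs_summable_le fs => x; rewrite fA ger0_norm// lerDr.
have [K1 H1] := esum_approx p0 ps e20.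
have [K2 H2] := esum_approx n0 ns e20.
exists (K1 `|` K2)%fset => K; rewrite fsubUset => /andP[/H1 + /H2].
under [X in _ -> _ -> `|X - _| <= _]eq_bigr do rewrite fE.
rewrite big_split/= sumrN /sumR !ler_norml; lra.
Qed.

(** Describes [sumR] as the limit along the directed set of finite subsets, so that linearity can be
    checked on finite sums instead of on positive and negative parts. *)
Lemma sumR_unique f s : abs_summable f -> (forall e, 0 < e ->
  exists K0, forall K, (K0 `<=` K)%fset -> `|\sum_(x <- K) f x - s| <= e) ->
  sumR f = s.
Proof.
move=> fs fsE; apply/eqP; rewrite -subr_eq0 -normr_le0.
apply/ler_addgt0Pr => e e0; have e20 : 0 < e / 2 by lra.
have [K1 H1] := fsE _ e20; have [K2 H2] := sumR_approx fs e20.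
have := H1 _ (fsubsetUl K1 K2); have := H2 _ (fsubsetUr K1 K2).
rewrite !ler_norml; lra.
Qed.

Lemma sumR_supp K f : (forall x, x \notin K -> f x = 0) ->
  sumR f = \sum_(x <- K) f x.
Proof.
move=> f0; apply: sumR_unique; first exact: abs_summable_supp f0.
move=> e e0; exists K => L KL.
by rewrite (fsum_supp f0 KL) subrr normr0 ltW.
Qed.

Lemma sumRD f g : abs_summable f -> abs_summable g ->
  sumR (fun x => f x + g x) = sumR f + sumR g.
Proof.
move=> fs gs; apply: sumR_unique; first exact: abs_summableD.
move=> e e0; have e20 : 0 < e / 2 by lra.
have [K1 H1] := sumR_approx fs e20; have [K2 H2] := sumR_approx gs e20.
exists (K1 `|` K2)%fset => K; rewrite fsubUset => /andP[/H1 + /H2].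
by rewrite big_split/= !ler_norml; lra.
Qed.

Lemma sumRZ c f : abs_summable f -> sumR (fun x => c * f x) = c * sumR f.
Proof.
move=> fs; apply: sumR_unique; first exact: abs_summableZ.
move=> e e0; have c0 : 0 < `|c| + 1 by rewrite ltr_wpDl.
have [K1 H1] := sumR_approx fs (divr_gt0 e0 c0).
exists K1 => K /H1 H; rewrite -mulr_sumr -mulrBr normrM.
apply: (@le_trans _ _ ((`|c| + 1) * (e / (`|c| + 1)))).
  by apply: ler_pM => //; rewrite lerDl.
by rewrite mulrC divfK// gt_eqF.
Qed.

Lemma sumRN f : abs_summable f -> sumR (fun x => - f x) = - sumR f.
Proof.
move=> fs; rewrite -mulN1r -sumRZ//; congr sumR; apply/funext => x.
by rewrite mulN1r.
Qed.

Lemma sumRB f g : abs_summable f -> abs_summable g ->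
  sumR (fun x => f x - g x) = sumR f - sumR g.
Proof. by move=> fs gs; rewrite sumRD ?sumRN//; exact: abs_summableN. Qed.

Lemma sumR_le_bound f M : abs_summable f ->
  (forall K, \sum_(x <- K) f x <= M) ->
  sumR f <= M.
Proof.
move=> fs fM; apply/ler_addgt0Pr => e e0.
have [K H] := sumR_approx fs e0.
have := H K (fsubset_refl K); have := fM K; rewrite ler_norml; lra.
Qed.

Lemma fsum_le_sumR f K : abs_summable f -> (forall x, 0 <= f x) ->
  \sum_(x <- K) f x <= sumR f.
Proof.
move=> fs f0; apply/ler_addgt0Pr => e e0.
have [L H] := sumR_approx fs e0.
have := H _ (fsubsetUr K L); have := fsum_subset f0 (fsubsetUl K L).
rewrite ler_norml; lra.
Qed.

Lemma sumR_ge0 f : abs_summable f -> (forall x, 0 <= f x) -> 0 <= sumR f.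
Proof.
by move=> fs f0; have := fsum_le_sumR fset0 fs f0; rewrite big_seq_fset0.
Qed.

Lemma ler_norm_sumR f M : (forall K, \sum_(x <- K) `|f x| <= M) ->
  `|sumR f| <= M.
Proof.
move=> fM; have fs : abs_summable f by exists M.
rewrite ler_norml; apply/andP; split; last first.
  apply: sumR_le_bound => // K; apply: le_trans (fM K).
  by apply: ler_sum => x _; exact: ler_norm.
rewrite lerNl -sumRN//; apply: sumR_le_bound; first exact: abs_summableN.
move=> K; apply: le_trans (fM K).
by apply: ler_sum => x _; rewrite -normrN; exact: ler_norm.
Qed.

Lemma sumR_big (I : eqType) (r : seq I) (F : I -> T -> R) :
  (forall i, abs_summable (F i)) ->
  abs_summable (fun x => \sum_(i <- r) F i x) /\
  sumR (fun x => \sum_(i <- r) F i x) = \sum_(i <- r) sumR (F i).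
Proof.
move=> Fs; elim: r => [|i r [IHs IH]].
  have E : (fun x : T => \sum_(i <- [::]) F i x) = fun=> 0.
    by apply/funext => x; rewrite big_nil.
  rewrite E big_nil; split; first exact: (@abs_summable_supp fset0).
  by rewrite (@sumR_supp fset0)// big_seq_fset0.
have E : (fun x : T => \sum_(j <- i :: r) F j x) =
    fun x => F i x + \sum_(j <- r) F j x.
  by apply/funext => x; rewrite big_cons.
by rewrite E big_cons sumRD// IH; split => //; exact: abs_summableD.
Qed.

End Sums.

(** Reindexing, needed for the embedding of one row into [X * X] and for the exchange of the two
    coordinates. *)
Lemma sumR_inj (R : realType) (T U : choiceType) (e : T -> U) (f : U -> R) :
  injective e -> (forall u, (forall t, u != e t) -> f u = 0) ->
  abs_summable (f \o e) -> abs_summable f /\ sumR f = sumR (f \o e).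
Proof.
move=> inj f0 fes.
pose pre (K : {fset U}) := fset_set (e @^-1` [set` K]).
have preE K t : (t \in pre K) = (e t \in K).
  rewrite /pre in_fset_set.
    by apply/idP/idP; rewrite inE.
  by apply: finite_preimage; [move=> ? ? _ _; exact: inj|exact: finite_fset].
have key g (K : {fset U}) : (forall u, (forall t, u != e t) -> g u = 0) ->
    \sum_(u <- K) g u = \sum_(t <- pre K) (g (e t) : R).
  move=> g0; transitivity (\sum_(u <- (e @` pre K)%fset) g u); last first.
    by rewrite big_imfset//=; exact: in2W.
  apply: fsum_supp_in.
    move=> u uK uL; apply: g0 => t; apply/eqP => ut; move/negP: uL; apply.
    by apply/imfsetP; exists t => //=; rewrite preE -ut.
  by apply/fsubsetP => u /imfsetP[t /=]; rewrite preE => tK ->.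
have fs : abs_summable f.
  case: fes => M fM; exists M => K; rewrite key; first exact: fM.
  by move=> u /f0 ->; rewrite normr0.
split => //; apply: sumR_unique => // d d0.
have [K1 H1] := sumR_approx fes d0.
exists (e @` K1)%fset => K /fsubsetP K1K; rewrite key//; apply: H1.
apply/fsubsetP => t tK; rewrite preE; apply: K1K.
by apply/imfsetP; exists t.
Qed.

(** * The form on finitely supported functions *)

(** The domain is a predicate, so that forms on different subspaces of the same function space ([h]
    on [Cc], its extension, the l2 inner product, the closure) share one Cauchy-Schwarz and triangle
    inequality. Definiteness is left out; it comes from coercivity. *)
Record semi_inner (R : realType) (V : lmodType R) (D : V -> Prop)
    (B : V -> V -> R) : Prop := {
  si0 : D 0 ;
  siL : forall c f g, D f -> D g -> D (c *: f + g) ;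
  siB : forall c f g k, D f -> D g -> D k ->
    B (c *: f + g) k = c * B f k + B g k ;
  siS : forall f g, D f -> D g -> B f g = B g f ;
  siP : forall f, D f -> 0 <= B f f }.

Section SemiInner.
Variables (R : realType) (V : lmodType R) (D : V -> Prop) (B : V -> V -> R).
Hypothesis I : semi_inner D B.

Lemma siDD f g : D f -> D g -> D (f + g).
Proof. by move=> Df Dg; rewrite -[f]scale1r; exact: (siL I). Qed.

Lemma siDZ c f : D f -> D (c *: f).
Proof. by move=> Df; rewrite -[_ *: _]addr0; exact: (siL I _ Df (si0 I)). Qed.

Lemma siDN f : D f -> D (- f).
Proof. by move=> Df; rewrite -scaleN1r; exact: siDZ. Qed.

Lemma siDB f g : D f -> D g -> D (f - g).
Proof. by move=> Df Dg; apply: siDD => //; exact: siDN. Qed.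

Lemma siBD f g k : D f -> D g -> D k -> B (f + g) k = B f k + B g k.
Proof. by move=> *; rewrite -{1}[f]scale1r (siB I)// mul1r. Qed.

Lemma siB0 k : D k -> B 0 k = 0.
Proof.
move=> Dk; have D0 := si0 I; have := siBD D0 D0 Dk; rewrite addr0.
by move/eqP; rewrite -subr_eq0 opprD addNKr oppr_eq0 => /eqP.
Qed.

Lemma siBZ c f k : D f -> D k -> B (c *: f) k = c * B f k.
Proof.
by move=> Df Dk; rewrite -[_ *: _]addr0 (siB I)// ?siB0// ?addr0//;
  exact: (si0 I).
Qed.

Lemma siBN f k : D f -> D k -> B (- f) k = - B f k.
Proof. by move=> *; rewrite -scaleN1r siBZ// mulN1r. Qed.

Lemma siBB f g k : D f -> D g -> D k -> B (f - g) k = B f k - B g k.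
Proof. by move=> Df Dg Dk; rewrite siBD ?siBN//; exact: siDN. Qed.

Lemma siBDr f g k : D f -> D g -> D k -> B k (f + g) = B k f + B k g.
Proof.
move=> Df Dg Dk; rewrite (siS I)//; last exact: siDD.
by rewrite siBD// (siS I Df)// (siS I Dg).
Qed.

Lemma siBZr c f k : D f -> D k -> B k (c *: f) = c * B k f.
Proof.
move=> Df Dk; rewrite (siS I)//; last exact: siDZ.
by rewrite siBZ// (siS I Df).
Qed.

Lemma siBBr f g k : D f -> D g -> D k -> B k (f - g) = B k f - B k g.
Proof.
move=> Df Dg Dk; rewrite (siS I)//; last exact: siDB.
by rewrite siBB// (siS I Df)// (siS I Dg).
Qed.

Lemma siQB f g : D f -> D g -> B (f - g) (f - g) = B f f - 2 * B f g + B g g.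
Proof.
move=> Df Dg; have Dfg := siDB Df Dg.
rewrite siBB// !siBBr// (siS I Dg Df); ring.
Qed.

Lemma siQD f g : D f -> D g -> B (f + g) (f + g) = B f f + 2 * B f g + B g g.
Proof.
move=> Df Dg; have Dfg := siDD Df Dg.
rewrite siBD// !siBDr// (siS I Dg Df); ring.
Qed.

Lemma siQZ c f : D f -> B (c *: f) (c *: f) = c ^+ 2 * B f f.
Proof. by move=> Df; have Dcf := siDZ c Df; rewrite siBZ// siBZr//; ring. Qed.

Lemma siQN f : D f -> B (- f) (- f) = B f f.
Proof. by move=> Df; rewrite -scaleN1r siQZ// sqrrN expr1n mul1r. Qed.

Lemma siQsym f g : D f -> D g -> B (f - g) (f - g) = B (g - f) (g - f).
Proof. by move=> Df Dg; rewrite -opprB siQN//; exact: siDB. Qed.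

Lemma siCS f g : D f -> D g -> B f g ^+ 2 <= B f f * B g g.
Proof.
move=> Df Dg; have f0 := siP I Df; have g0 := siP I Dg.
have key t : 0 <= B f f - 2 * t * B f g + t ^+ 2 * B g g.
  have Dtg := siDZ t Dg.
  have := siP I (siDB Df Dtg); rewrite siQB// siBZr// siQZ//.
  by rewrite mulrA.
have [g00|gN0] := eqVneq (B g g) 0.
  rewrite g00 mulr0.
  have [->|fgN0] := eqVneq (B f g) 0; first by rewrite expr0n.
  (* Without the quadratic term the expression is affine in [t], and this [t] gives it the value
     -1. *)
  have := key ((B f f + 1) / (2 * B f g)).
  rewrite g00 mulr0 addr0.
  have -> : 2 * ((B f f + 1) / (2 * B f g)) * B f g = B f f + 1 by field.
  lra.
have gp : 0 < B g g by rewrite lt0r gN0.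
have := key (B f g / B g g).
have -> : B f f - 2 * (B f g / B g g) * B f g + (B f g / B g g) ^+ 2 * B g g =
  (B f f * B g g - B f g ^+ 2) / B g g by field.
by rewrite pmulr_lge0 ?invr_gt0// subr_ge0.
Qed.

Definition siN f := Num.sqrt (B f f).

Lemma siN_ge0 f : 0 <= siN f. Proof. exact: sqrtr_ge0. Qed.

Lemma siN_sqr f : D f -> siN f ^+ 2 = B f f.
Proof. by move=> Df; rewrite sqr_sqrtr//; exact: (siP I). Qed.

Lemma siN_CS f g : D f -> D g -> `|B f g| <= siN f * siN g.
Proof.
move=> Df Dg; rewrite -[leLHS]sqrtr_sqr /siN -sqrtrM; last exact: (siP I).
by apply: ler_wsqrtr; exact: siCS.
Qed.

Lemma siN_D f g : D f -> D g -> siN (f + g) <= siN f + siN g.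
Proof.
move=> Df Dg; rewrite -ler_sqr ?nnegrE ?addr_ge0 ?siN_ge0//.
rewrite siN_sqr; last exact: siDD.
rewrite siQD// sqrrD !siN_sqr//.
by have := siN_CS Df Dg; rewrite ler_norml mulr2n; lra.
Qed.

Lemma siN_Z c f : D f -> siN (c *: f) = `|c| * siN f.
Proof.
by move=> Df; rewrite /siN siQZ// sqrtrM ?sqr_ge0// sqrtr_sqr.
Qed.

Lemma siN_sym f g : D f -> D g -> siN (f - g) = siN (g - f).
Proof. by move=> Df Dg; rewrite /siN siQsym. Qed.

Lemma siN_B f g k : D f -> D g -> D k -> siN (f - k) <=
  siN (f - g) + siN (g - k).
Proof.
move=> Df Dg Dk; have -> : f - k = (f - g) + (g - k) by rewrite addrA subrK.
by apply: siN_D; exact: siDB.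
Qed.

Lemma siN_dist f g : D f -> D g -> `|siN f - siN g| <= siN (f - g).
Proof.
move=> Df Dg; rewrite ler_norml.
have := siN_D (siDB Df Dg) Dg; rewrite subrK.
have := siN_D (siDB Dg Df) Df; rewrite subrK (siN_sym Dg Df).
lra.
Qed.

End SemiInner.

Section Form.
Variables (R : realType) (X : choiceType) (b : X -> X -> R) (q : X -> R).
Hypothesis gb : is_graph b.
Implicit Types (f g : X -> R) (K L : {fset X}).

Definition supp_in K f := forall x, x \notin K -> f x = 0.

Lemma supp_inW K L f : (K `<=` L)%fset -> supp_in K f -> supp_in L f.
Proof.
by move=> /fsubsetP KL fK x xL; apply: fK; apply: contra xL; exact: KL.
Qed.

Lemma CcP f : Cc f <-> exists K, supp_in K f.
Proof.
split=> [fC|[K fK]].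
  exists (fset_set [set x | f x != 0]) => x; rewrite in_fset_set//.
  by move=> xf; apply/eqP; apply: contraNT xf => fx; rewrite inE.
apply: (@sub_finite_set _ _ [set` K]); last exact: finite_fset.
by move=> x /=; apply: contra_neqT; exact: fK.
Qed.

Lemma CcP2 f g : Cc f -> Cc g -> exists K, supp_in K f /\ supp_in K g.
Proof.
move=> /CcP[K fK] /CcP[L gL]; exists (K `|` L)%fset; split.
  exact/(supp_inW _ fK)/fsubsetUl.
exact/(supp_inW _ gL)/fsubsetUr.
Qed.

Lemma lincombE c f g x : (c *: f + g) x = c * f x + g x.
Proof. by []. Qed.

Lemma scalefctE c f x : (c *: f) x = c * f x.
Proof. by []. Qed.

Lemma supp_inL K c f g : supp_in K f -> supp_in K g -> supp_in K (c *: f + g).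
Proof. by move=> fK gK x xK; rewrite lincombE fK// gK// mulr0 addr0. Qed.

Lemma Cc0 : Cc (0 : X -> R).
Proof. by apply/CcP; exists fset0. Qed.

Lemma CcL c f g : Cc f -> Cc g -> Cc (c *: f + g).
Proof.
move=> fC gC; have [K [fK gK]] := CcP2 fC gC.
by apply/CcP; exists K; exact: supp_inL.
Qed.

Lemma CcD f g : Cc f -> Cc g -> Cc (f + g).
Proof. by move=> fC gC; rewrite -[f]scale1r; exact: CcL. Qed.

Lemma CcZ c f : Cc f -> Cc (c *: f).
Proof. by move=> fC; rewrite -[_ *: _]addr0; exact: (CcL _ fC Cc0). Qed.

Lemma CcN f : Cc f -> Cc (- f).
Proof. by move=> fC; rewrite -scaleN1r; exact: CcZ. Qed.

Lemma CcB f g : Cc f -> Cc g -> Cc (f - g).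
Proof. by move=> fC gC; apply/CcD/CcN. Qed.

Lemma Cc_abs f : Cc f -> Cc (fun x => `|f x|).
Proof. by move=> /CcP[K fK]; apply/CcP; exists K => x /fK ->;
  rewrite normr0. Qed.

Lemma Cc_one x : Cc (\1_[set x] : X -> R).
Proof.
apply/CcP; exists [fset x]%fset => y; rewrite inE => yx.
by rewrite indicE memNset//= => yx'; rewrite yx' eqxx in yx.
Qed.

Definition deg x := sumR (b x).

Lemma abs_summable_b x : abs_summable (b x).
Proof. by apply/esum_fin; [exact: (graph_ge0 gb)|exact: (graph_sum gb)]. Qed.

Lemma FdomP f : Fdom b f <-> forall x, abs_summable (fun y => b x y * f y).
Proof.
have E x : (\esum_(y in [set: X]) (b x y * `|f y|)%:E < +oo)%E <->
    abs_summable (fun y => b x y * f y).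
  rewrite esum_fin; last by move=> y; rewrite mulr_ge0//; exact: (graph_ge0 gb).
  split; apply: abs_summable_le => y; rewrite !normrM ?normr_id//.
by split=> fF x; have := fF x; [move=> /E|move=> ?; apply/E].
Qed.

Lemma HopE f x : Fdom b f ->
  Hop b q f x = (deg x + q x) * f x - sumR (fun y => b x y * f y).
Proof.
move=> /FdomP fF; rewrite /Hop.
have -> : (fun y => b x y * (f x - f y)) = fun y => f x * b x y - b x y * f y.
  by apply/funext => y; ring.
rewrite sumRB//; last exact/abs_summableZ/abs_summable_b.
by rewrite sumRZ; [rewrite /deg; ring|exact: abs_summable_b].
Qed.

Lemma Fdom_Cc f : Cc f -> Fdom b f.
Proof.
move=> /CcP[K fK]; apply/FdomP => x; apply: (@abs_summable_supp _ _ K) => y /fK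
  ->.
by rewrite mulr0.
Qed.

Lemma Hop_supp K f x : supp_in K f ->
  Hop b q f x = (deg x + q x) * f x - \sum_(y <- K) b x y * f y.
Proof.
move=> fK; rewrite HopE; last by apply: Fdom_Cc; apply/CcP; exists K.
by rewrite (@sumR_supp _ _ K)// => y /fK ->; rewrite mulr0.
Qed.

Lemma FdomL c f g : Fdom b f -> Fdom b g -> Fdom b (c *: f + g).
Proof.
move=> /FdomP fF /FdomP gF; apply/FdomP => x.
have -> : (fun y => b x y * (c *: f + g) y) =
    fun y => c * (b x y * f y) + b x y * g y.
  by apply/funext => y; rewrite lincombE; ring.
by apply: abs_summableD => //; exact: abs_summableZ.
Qed.

Lemma HopL c f g x : Fdom b f -> Fdom b g ->
  Hop b q (c *: f + g) x = c * Hop b q f x + Hop b q g x.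
Proof.
move=> fF gF; rewrite !HopE//; last exact: FdomL.
have -> : (fun y => b x y * (c *: f + g) y) =
    fun y => c * (b x y * f y) + b x y * g y.
  by apply/funext => y; rewrite lincombE; ring.
move: fF gF => /FdomP fF /FdomP gF.
rewrite sumRD//; last exact: abs_summableZ.
by rewrite sumRZ// lincombE; ring.
Qed.

(** Only finitely many rows are nonzero, so the family is a finite sum of families supported on
    single rows. *)
Lemma sumR_fst K (g : X * X -> R) : (forall p, p.1 \notin K -> g p = 0) ->
  (forall x, abs_summable (fun y => g (x, y))) ->
  abs_summable g /\ sumR g = \sum_(x <- K) sumR (fun y => g (x, y)).
Proof.
move=> gK gs; pose F x (p : X * X) := if p.1 == x then g p else 0.
have Fs x : abs_summable (F x) /\ sumR (F x) = sumR (fun y => g (x, y)).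
  have FE : F x \o pair x = fun y => g (x, y).
    by apply/funext => y; rewrite /F /= eqxx.
  rewrite -FE; apply: sumR_inj; [by move=> y z []| |by rewrite FE].
  move=> [u v] uN; rewrite /F /=; case: eqP => // ux.
  by have := uN v; rewrite ux eqxx.
have gE : g = fun p => \sum_(x <- K) F x p.
  apply/funext => p; have [pK|pK] := boolP (p.1 \in K).
    rewrite (big_fsetD1 _ pK)/= {1}/F eqxx big1_seq ?addr0// => x /=.
    by rewrite !inE /F => /andP[/negbTE + _]; rewrite eq_sym => ->.
  by rewrite gK// big1_seq// => x _; rewrite /F gK// if_same.
have [H1 H2] := sumR_big K (fun x => (Fs x).1).
rewrite -gE in H1 H2; split => //; rewrite H2; apply: eq_bigr => x _.
exact: (Fs x).2.
Qed.

Lemma sumR_snd K (g : X * X -> R) : (forall p, p.2 \notin K -> g p = 0) ->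
  (forall y, abs_summable (fun x => g (x, y))) ->
  abs_summable g /\ sumR g = \sum_(y <- K) sumR (fun x => g (x, y)).
Proof.
move=> gK gs; pose sw (p : X * X) := (p.2, p.1).
have [] := @sumR_fst K (g \o sw) => [p|x|H1 H2];
  [exact: (gK (sw p))|exact: gs|].
have [||H3 H4] := @sumR_inj _ _ _ sw g _ _ H1.
- by move=> [? ?] [? ?] [-> ->].
- by move=> [u v] /(_ (v, u)); rewrite eqxx.
by rewrite H4 H2.
Qed.

(** Green's formula. The product of differences splits into four families, each supported over
    finitely many rows or columns and hence summable by itself. The two diagonal ones both give the
    degree term, the two mixed ones the same finite double sum, which absorbs the factor one
    half. *)
Lemma hformE K phi psi : supp_in K phi -> supp_in K psi ->
  hform b q phi psi = \sum_(x <- K) psi x * Hop b q phi x.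
Proof.
move=> fK gK.
have [A1 A2] : abs_summable (fun p => b p.1 p.2 * (phi p.1 * psi p.1)) /\
    sumR (fun p => b p.1 p.2 * (phi p.1 * psi p.1)) =
    \sum_(x <- K) deg x * (phi x * psi x).
  have := @sumR_fst K (fun p => b p.1 p.2 * (phi p.1 * psi p.1)).
  case=> [p /fK ->|x|H1 ->]; first by rewrite mul0r mulr0.
    by apply: abs_summable_le (abs_summableZ (phi x * psi x) (abs_summable_b
      x)) => y /=; rewrite mulrC.
  split => //; apply: eq_bigr => x _ /=.
  transitivity (sumR (fun y => (phi x * psi x) * b x y)).
    by congr sumR; apply/funext => y; rewrite mulrC.
  by rewrite sumRZ 1?mulrC//; exact: abs_summable_b.
have [B1 B2] : abs_summable (fun p => b p.1 p.2 * (phi p.2 * psi p.2)) /\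
    sumR (fun p => b p.1 p.2 * (phi p.2 * psi p.2)) =
    \sum_(x <- K) deg x * (phi x * psi x).
  have := @sumR_snd K (fun p => b p.1 p.2 * (phi p.2 * psi p.2)).
  have E y : (fun x => b x y * (phi y * psi y)) =
      (fun x => (phi y * psi y) * b y x).
    by apply/funext => x; rewrite (graph_sym gb) mulrC.
  case=> [p /fK ->|y|H1 ->] /=; first by rewrite mul0r mulr0.
    by rewrite E; apply/abs_summableZ/abs_summable_b.
  split => //; apply: eq_bigr => y _.
  by rewrite E sumRZ 1?mulrC//; exact: abs_summable_b.
have [C1 C2] : abs_summable (fun p => b p.1 p.2 * (phi p.1 * psi p.2)) /\
    sumR (fun p => b p.1 p.2 * (phi p.1 * psi p.2)) =
    \sum_(x <- K) \sum_(y <- K) b x y * (phi x * psi y).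
  have := @sumR_fst K (fun p => b p.1 p.2 * (phi p.1 * psi p.2)).
  have E x y : y \notin K -> b x y * (phi x * psi y) = 0.
    by move=> /gK ->; rewrite !mulr0.
  case=> [p /fK ->|x|H1 ->] /=; first by rewrite mul0r mulr0.
    exact: (abs_summable_supp (E x)).
  by split => //; apply: eq_bigr => x _; rewrite (sumR_supp (E x)).
have [D1 D2] : abs_summable (fun p => b p.1 p.2 * (phi p.2 * psi p.1)) /\
    sumR (fun p => b p.1 p.2 * (phi p.2 * psi p.1)) =
    \sum_(x <- K) \sum_(y <- K) b x y * (phi x * psi y).
  have := @sumR_snd K (fun p => b p.1 p.2 * (phi p.2 * psi p.1)).
  have E y x : x \notin K -> b x y * (phi y * psi x) = 0.
    by move=> /gK ->; rewrite !mulr0.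
  case=> [p /fK ->|y|H1 ->] /=; first by rewrite mul0r mulr0.
    exact: (abs_summable_supp (E y)).
  split => //; apply: eq_bigr => y _; rewrite (sumR_supp (E y)).
  by apply: eq_bigr => x _; rewrite (graph_sym gb).
rewrite /hform.
have -> : (fun p : X * X =>
    b p.1 p.2 * (phi p.1 - phi p.2) * (psi p.1 - psi p.2)) =
  fun p => (b p.1 p.2 * (phi p.1 * psi p.1) + b p.1 p.2 * (phi p.2 * psi p.2)) -
   (b p.1 p.2 * (phi p.1 * psi p.2) + b p.1 p.2 * (phi p.2 * psi p.1)).
  by apply/funext => p; ring.
rewrite sumRB; [|exact: abs_summableD|exact: abs_summableD].
rewrite !sumRD// A2 B2 C2 D2.
rewrite (@sumR_supp _ _ K) => [|x /fK ->]; last by rewrite mulr0 mul0r.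
under [RHS]eq_bigr => x _.
  rewrite (Hop_supp _ fK) mulrBr mulr_sumr.
  have -> : psi x * ((deg x + q x) * phi x) =
    deg x * (phi x * psi x) + q x * phi x * psi x by ring.
  over.
rewrite sumrB big_split/=.
have -> : \sum_(x <- K) \sum_(y <- K) psi x * (b x y * phi y) =
    \sum_(x <- K) \sum_(y <- K) b x y * (phi x * psi y).
  rewrite exchange_big/=; apply: eq_bigr => x _; apply: eq_bigr => y _.
  by rewrite (graph_sym gb); ring.
by field.
Qed.

Lemma hform_sum K phi psi : supp_in K phi -> supp_in K psi ->
  hform b q phi psi = \sum_(x <- K) (deg x + q x) * (phi x * psi x) -
    \sum_(x <- K) \sum_(y <- K) b x y * (phi x * psi y).
Proof.
move=> fK gK; rewrite (hformE fK gK).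
under eq_bigr => x _.
  rewrite (Hop_supp _ fK) mulrBr mulr_sumr.
  have -> : psi x * ((deg x + q x) * phi x) =
    (deg x + q x) * (phi x * psi x) by ring.
  over.
rewrite sumrB; congr (_ - _).
rewrite exchange_big/=; apply: eq_bigr => x _; apply: eq_bigr => y _.
by rewrite (graph_sym gb); ring.
Qed.

Lemma hform_sym phi psi : Cc phi -> Cc psi ->
  hform b q phi psi = hform b q psi phi.
Proof.
move=> fC gC; have [K [fK gK]] := CcP2 fC gC.
rewrite !(@hform_sum K)//; congr (_ - _).
  by apply: eq_bigr => x _; rewrite [phi x * _]mulrC.
rewrite exchange_big/=; apply: eq_bigr => x _; apply: eq_bigr => y _.
by rewrite (graph_sym gb) [phi y * _]mulrC.
Qed.

Lemma hformL c f g k : Cc f -> Cc g -> Cc k ->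
  hform b q (c *: f + g) k = c * hform b q f k + hform b q g k.
Proof.
move=> fC gC kC; have [K [fK gK]] := CcP2 fC gC; have /CcP[L kL] := kC.
have KU := supp_inW (fsubsetUl K L); have LU := supp_inW (fsubsetUr K L).
rewrite !(@hformE (K `|` L)%fset)//; try by [exact: KU|exact: LU].
  rewrite mulr_sumr -big_split/=; apply: eq_bigr => x _.
  by rewrite HopL; [ring|exact: Fdom_Cc|exact: Fdom_Cc].
by apply: supp_inL; exact: KU.
Qed.

Lemma hform_si : form_ge0 b q -> semi_inner (@Cc R X) (hform b q).
Proof.
by move=> h0; split; [exact: Cc0|exact: CcL|exact: hformL|exact: hform_sym|].
Qed.

Lemma Hop_form f x : Cc f -> Hop b q f x = hform b q f \1_[set x].
Proof.
move=> /CcP[K fK]; pose L := (x |` K)%fset.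
have fL : supp_in L f by apply: supp_inW fK; exact: fsubsetUr.
have oL : supp_in L (\1_[set x] : X -> R).
  move=> y; rewrite !inE negb_or => /andP[yx _].
  by rewrite indicE memNset//= => yx'; rewrite yx' eqxx in yx.
rewrite (hformE fL oL) (big_fsetD1 x)/=; last by rewrite !inE eqxx.
rewrite indicE mem_set//= mul1r big1_seq ?addr0// => y /=.
rewrite !inE => /andP[yx _].
by rewrite indicE memNset/= ?mul0r// => yx'; rewrite yx' eqxx in yx.
Qed.

(** The diagonal terms do not change, and the subtracted off-diagonal terms can only grow because
    [b] is nonnegative. *)
Lemma hquad_abs f : Cc f -> hquad b q (fun x => `|f x|) <= hquad b q f.
Proof.
move=> /CcP[K fK]; rewrite /hquad.
have aK : supp_in K (fun x => `|f x|) by move=> x /fK ->; rewrite normr0.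
rewrite (hform_sum fK fK) (hform_sum aK aK).
under eq_bigr do rewrite -normrM -expr2 normrX real_normK ?num_real//.
under [X in _ <= X - _]eq_bigr do rewrite -expr2.
rewrite lerD2l lerN2; apply: ler_sum => x _; apply: ler_sum => y _.
apply: ler_wpM2l; first exact: (graph_ge0 gb).
by rewrite -normrM; exact: ler_norm.
Qed.

End Form.

(** * Bounded point evaluations from subcriticality and connectedness *)

Section Coercive.
Variables (R : realType) (X : choiceType) (b : X -> X -> R) (q : X -> R).
Hypothesis gb : is_graph b.
Implicit Types (f g : X -> R) (K L : {fset X}).

(** Everything that later arguments take from subcriticality. By [coercive_shift] it also holds for
    [q + al] with [al > 0] as soon as [h] is nonnegative. *)
Definition coercive := form_ge0 b q /\
  forall x, exists2 C : R, 0 < C & forall phi, Cc phi ->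
    phi x ^+ 2 <= C * hquad b q phi.

Local Notation h := (hform b q).
Local Notation N := (siN h).

(* Since h(|phi|) <= h(phi), Cauchy-Schwarz bounds H|phi|(x) = h(|phi|, 1_x) by
   a multiple of N phi. *)
Lemma Harnack_row : form_ge0 b q -> forall x, exists2 C : R, 0 < C &
  forall phi K, Cc phi -> \sum_(z <- K) b x z * `|phi z| <=
    C * (`|phi x| + N phi).
Proof.
move=> h0 x; have hsi := hform_si gb h0.
pose C : R := `|deg b x + q x| + N \1_[set x] + 1.
have N1 := siN_ge0 h \1_[set x]; exists C => [|phi K fC].
  by rewrite /C ltr_wpDl// addr_ge0.
pose psi z : R := `|phi z|; have gC : Cc psi by exact: Cc_abs.
have gF := Fdom_Cc gb gC.
have sE : sumR (fun z => b x z * psi z) = (deg b x + q x) * psi x - h psi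
  \1_[set x].
  by rewrite -Hop_form// HopE// opprB addrC subrK.
have bs : abs_summable (fun z => b x z * psi z) by move: gF => /(FdomP gb);
  exact.
apply: le_trans (fsum_le_sumR K bs _) _.
  by move=> z; rewrite mulr_ge0 ?(graph_ge0 gb)// /psi.
rewrite sE.
have H1 : (deg b x + q x) * psi x <= `|deg b x + q x| * `|phi x|.
  by apply: ler_wpM2r; [exact: normr_ge0|exact: ler_norm].
have H2 : - h psi \1_[set x] <= N phi * N \1_[set x].
  apply: le_trans (ler_norm _) _; rewrite normrN.
  apply: le_trans (siN_CS hsi gC (Cc_one R x)) _.
  apply: ler_wpM2r => //; apply: ler_wsqrtr; exact: hquad_abs.
apply: le_trans (lerD H1 H2) _.
have := siN_ge0 h phi; have := normr_ge0 (phi x);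
  have := normr_ge0 (deg b x + q x).
by rewrite /C; nra.
Qed.

(** A single term of the row sum at [x] bounds the value at a neighbour [y], at the price of a
    factor [1 / b x y]; induction carries this along the path. *)
Lemma Harnack_path : form_ge0 b q -> forall x (p : seq X),
  path (fun u v => 0 < b u v) x p ->
  exists2 C : R, 0 < C & forall phi, Cc phi ->
    `|phi (last x p)| <= C * (`|phi x| + N phi).
Proof.
move=> h0 x p; elim: p x => [|y p IH] x /=.
  move=> _; exists 1 => // phi _; rewrite mul1r lerDl; exact: siN_ge0.
case/andP => bxy /IH[C C0 HC]; have [D D0 HD] := Harnack_row h0 x.
exists (C * (D / b x y + 1)) => [|phi fC].
  by rewrite mulr_gt0// addr_gt0// divr_gt0.
apply: le_trans (HC _ fC) _; rewrite -mulrA; apply: ler_wpM2l; first exact: ltW.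
have := HD phi [fset y]%fset fC; rewrite big_seq_fset1 => H.
have Hy : `|phi y| <= D / b x y * (`|phi x| + N phi).
  by rewrite mulrAC ler_pdivlMr// mulrC.
have := normr_ge0 (phi x); lra.
Qed.

(** The weight need only be nonzero at one vertex [x0]. There it bounds the point evaluation
    directly, and the Harnack inequality along a path moves the bound to any [x]. *)
Lemma subcritical_coercive : connected_graph b -> form_ge0 b q ->
  subcritical b q -> coercive.
Proof.
move=> bc h0 [w [w0 [x0 wx0]] wh]; split => // x.
have hsi := hform_si gb h0.
have wp : 0 < w x0 by rewrite lt0r wx0 w0.
have Hx0 phi : Cc phi -> phi x0 ^+ 2 <= (w x0)^-1 * hquad b q phi.
  move=> fC; rewrite ler_pdivlMl//; apply: le_trans (wh _ fC).
  have /CcP[K fK] := fC.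
  have := @fsum_le_sumR _ _ (fun x => w x * phi x ^+ 2) [fset x0]%fset.
  rewrite big_seq_fset1; apply.
    by apply: (@abs_summable_supp _ _ K) => z /fK ->; rewrite expr0n mulr0.
  by move=> z; rewrite mulr_ge0// sqr_ge0.
have [p px xE] := bc x0 x; have [C C0] := Harnack_path h0 px; rewrite xE => HC.
exists (C ^+ 2 * (2 / w x0 + 2)) => [|phi fC].
  by rewrite mulr_gt0 ?exprn_gt0// addr_gt0// divr_gt0.
have := HC _ fC; have := Hx0 _ fC; rewrite /hquad -(siN_sqr hsi fC).
have := siN_ge0 h phi; set n := N phi => n0 Hn H.
rewrite -(real_normK (num_real (phi x0))) in Hn.
rewrite -(real_normK (num_real (phi x))).
have H2 : `|phi x| ^+ 2 <= (C * (`|phi x0| + n)) ^+ 2.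
  by rewrite lerXn2r// nnegrE// mulr_ge0 ?addr_ge0// ltW.
apply: le_trans H2 _; rewrite exprMn -mulrA; apply: ler_wpM2l.
  by rewrite exprn_ge0// ltW.
have : 0 <= (`|phi x0| - n) ^+ 2 by exact: sqr_ge0.
by move: Hn; set iw := (w x0)^-1; nra.
Qed.

End Coercive.

(** * Maximum principle and solvability on finite sets *)

Section Galerkin.
Variables (R : realType) (X : choiceType) (b : X -> X -> R) (q : X -> R).
Hypothesis gb : is_graph b.
Hypothesis co : coercive b q.
Implicit Types (f g : X -> R) (K L : {fset X}).
Local Notation h := (hform b q).
Local Notation N := (siN h).

Let hsi : semi_inner (@Cc R X) h. Proof. by apply: hform_si co.1. Qed.

Lemma Cc_pt x : exists2 C : R, 0 < C & forall phi, Cc phi ->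
  `|phi x| <= C * N phi.
Proof.
have [C C0 HC] := co.2 x; exists (Num.sqrt C) => [|phi fC];
  first by rewrite sqrtr_gt0.
rewrite -ler_sqr ?nnegrE ?mulr_ge0 ?sqrtr_ge0// real_normK ?num_real//.
by rewrite exprMn sqr_sqrtr ?(siN_sqr hsi)//; [exact: HC|exact: ltW].
Qed.

Lemma Cc_row x : exists2 C : R, 0 < C & forall phi K, Cc phi ->
  \sum_(z <- K) b x z * `|phi z| <= C * N phi.
Proof.
have [C C0 HC] := Harnack_row gb co.1 x; have [D D0 HD] := Cc_pt x.
exists (C * (D + 1)) => [|phi K fC]; first by rewrite mulr_gt0// addr_gt0.
apply: le_trans (HC _ _ fC) _; rewrite -mulrA; apply: ler_wpM2l;
  first exact: ltW.
have := HD _ fC; lra.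
Qed.

Lemma hquad_eq0 phi : Cc phi -> hquad b q phi <= 0 -> phi = 0.
Proof.
move=> fC h0; apply/funext => x; have [C C0 HC] := co.2 x.
apply/eqP; rewrite -sqrf_eq0 eq_le sqr_ge0 andbT.
by apply: le_trans (HC _ fC) _; rewrite pmulr_rle0.
Qed.

(* Testing [Hf >= 0] against the negative part of [f]. *)
Lemma max_principle K f : Fdom b f -> (forall x, x \notin K -> 0 <= f x) ->
  (forall x, x \in K -> 0 <= Hop b q f x) -> forall x, 0 <= f x.
Proof.
move=> fF f0 Hf.
have nK : supp_in K f^\- .
  by move=> x /f0 fx; rewrite /funrneg; apply/max_idPr; rewrite oppr_le0.
have nC : Cc f^\- by apply/CcP; exists K.
have pos_eq0 : f^\+ = 1 *: f^\- + f.
  by rewrite scale1r -{3}(funrposBneg f) addrC subrK.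
have pF : Fdom b f^\+.
  by rewrite pos_eq0; apply: FdomL => //; exact: Fdom_Cc.
have pn x : f^\+ x * f^\- x = 0.
  rewrite /funrpos /funrneg /Num.max; case: ltP => h1; case: ltP => h2; nra.
(* Where the negative part is nonzero the positive part vanishes, so of [H f^+] only the nonpositive
   sum over neighbours is left. *)
have Hp x : x \in K -> f^\- x * Hop b q f^\+ x <= 0.
  move=> xK; rewrite HopE// mulrBr.
  rewrite mulrCA [f^\- x * f^\+ x]mulrC pn mulr0 sub0r oppr_le0.
  rewrite mulr_ge0 ?funrneg_ge0//; apply: sumR_ge0.
    by move: pF => /(FdomP gb); exact.
  by move=> y; rewrite mulr_ge0 ?funrpos_ge0//; exact: (graph_ge0 gb).
have n0 : f^\- = 0.
  apply: hquad_eq0 => //; rewrite /hquad (hformE q gb nK nK).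
  rewrite big_seq; apply: sumr_le0 => x xK.
  have -> : Hop b q f^\- x = Hop b q f^\+ x - Hop b q f x.
    by rewrite pos_eq0 HopL ?mul1r ?addrK//; exact: Fdom_Cc.
  have := Hp _ xK; have := Hf _ xK; have := funrneg_ge0 f x.
  by nra.
by move=> x; rewrite -(funrposBneg f) n0 subr0; exact: funrpos_ge0.
Qed.

Lemma HK_unique K f g : supp_in K f -> supp_in K g ->
  (forall x, x \in K -> Hop b q f x = Hop b q g x) -> f = g.
Proof.
move=> fK gK fg; apply/eqP; rewrite -subr_eq0; apply/eqP.
have E : f - g = (-1) *: g + f by rewrite scaleN1r addrC.
have dK : supp_in K (f - g) by rewrite E; exact: supp_inL.
apply: hquad_eq0; first by apply/CcP; exists K.
rewrite /hquad (hformE q gb dK dK) big_seq big1// => x xK.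
have fF : Fdom b f by apply/(Fdom_Cc gb)/CcP; exists K.
have gF : Fdom b g by apply/(Fdom_Cc gb)/CcP; exists K.
by rewrite E HopL// fg// mulN1r addNr mulr0.
Qed.

Lemma Hop_sum n (v : 'I_n -> R) (phi : 'I_n -> X -> R) x :
  (forall i, Cc (phi i)) ->
  Cc (\sum_(i < n) v i *: phi i) /\
  Hop b q (\sum_(i < n) v i *: phi i) x = \sum_(i < n) v i * Hop b q (phi i) x.
Proof.
move=> fC; elim: n v phi fC => [|n IH] v phi fC.
  rewrite !big_ord0; split; first exact: Cc0.
  by rewrite (@Hop_supp _ _ _ _ gb fset0)// big_seq_fset0 subr0 mulr0.
have [H1 H2] := IH (fun i => v (lift ord0 i)) (fun i => phi (lift ord0 i))
  (fun i => fC (lift ord0 i)).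
rewrite !big_ord_recl; split; first exact: CcL.
by rewrite HopL ?H2//; exact: Fdom_Cc.
Qed.

(** In the basis of indicators of the points of [K] this is a square linear system; uniqueness, that
    is [HK_unique], makes its matrix invertible. The empty [K] is split off because the enumeration
    by [nth] needs a default point. *)
Lemma HK_exists K f : exists phi, supp_in K phi /\
  forall x, x \in K -> Hop b q phi x = f x.
Proof.
have [->|[x0 x0K]] := fset_0Vmem K.
  by exists 0; split => // x; rewrite inE.
pose n := size K; pose e (i : 'I_n) := nth x0 K i.
have eK i : e i \in K by exact: mem_nth.
have einj i j : (e i == e j) = (i == j).
  by rewrite /e nth_uniq// fset_uniq.
pose one (i : 'I_n) : X -> R := \1_[set e i].
have oneE i j : one i (e j) = (i == j)%:R.
  rewrite /one indicE; case: eqP => [->|ij]; first by rewrite mem_set.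
  by rewrite memNset//= => /eqP; rewrite einj eq_sym => /eqP.
have oneK i : supp_in K (one i).
  move=> y yK; rewrite /one indicE memNset//= => yE.
  by rewrite yE eK in yK.
pose A : 'M[R]_n := \matrix_(i, j) Hop b q (one i) (e j).
pose phi (v : 'rV[R]_n) := \sum_(i < n) v 0 i *: one i.
have phie v j : phi v (e j) = v 0 j.
  rewrite /phi fct_sumE (bigD1 j)//= big1 ?addr0.
    by rewrite scalefctE oneE eqxx mulr1.
  by move=> i ij; rewrite scalefctE oneE (negbTE ij) mulr0.
have phiK v : supp_in K (phi v).
  move=> x xK; rewrite /phi fct_sumE big1// => i _.
  by rewrite scalefctE oneK// mulr0.
have phiH v j : Hop b q (phi v) (e j) = (v *m A) 0 j.
  rewrite (Hop_sum _ _ (fun i => Cc_one R (e i))).2 mxE.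
  by apply: eq_bigr => i _; rewrite mxE.
have surj x : x \in K -> exists i, x = e i.
  move=> xK; have xn : (index x K < n)%N by rewrite index_mem.
  by exists (Ordinal xn); rewrite /e /= nth_index.
have Afree : row_free A.
  apply: inj_row_free => v vA.
  have v0 : phi v = 0.
    apply: (@HK_unique K) => // x /surj[i ->].
    rewrite phiH vA mxE (@Hop_supp _ _ _ _ gb fset0)// big_seq_fset0.
    by rewrite subr0 mulr0.
  by apply/rowP => j; rewrite -phie v0 mxE.
have Au : A \in unitmx by rewrite -row_free_unit.
pose w : 'rV[R]_n := \row_j f (e j).
exists (phi (w *m invmx A)); split => // x /surj[j ->].
by rewrite phiH mulmxKV// mxE.
Qed.

Lemma HKinvP (K : set X) f : finite_set K ->
  supp_in (fset_set K) (HKinv b q K f) /\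
  forall x, K x -> Hop b q (HKinv b q K f) x = f x.
Proof.
move=> Kfin; rewrite /HKinv; case: xgetP => [phi -> [H1 H2]|H].
  split => // x xK; apply: H1 => Kx.
  by move/negP: xK; apply; rewrite in_fset_set// inE.
have [phi [H1 H2]] := HK_exists (fset_set K) f.
exfalso; apply: (H phi); split => [y Ky|y Ky].
  by apply: H1; rewrite in_fset_set//; apply/negP; rewrite inE.
by apply: H2; rewrite in_fset_set// inE.
Qed.

End Galerkin.

(** * Extension of the form and Galerkin approximation *)

Section Sequences.
Variable R : realType.
Implicit Types (u v : nat -> R) (l : R).

Lemma cvgn_epsP u l : u n @[n --> \oo] --> l <->
  forall e, 0 < e -> exists n0 : nat, forall n, (n0 <= n)%N -> `|u n - l| <= e.
Proof.
split=> [/cvgrPdist_le H e e0|H].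
  by have [n0 _ Hn] := H _ e0; exists n0 => n n0n; rewrite distrC; exact: Hn.
apply/cvgrPdist_le => e e0; have [n0 Hn] := H _ e0.
by exists n0 => // n; rewrite /= distrC; exact: Hn.
Qed.

Lemma cvgn_unique u l l' :
  u n @[n --> \oo] --> l -> u n @[n --> \oo] --> l' -> l = l'.
Proof. by move=> ul ul'; rewrite -(cvg_lim _ ul)// -(cvg_lim _ ul'). Qed.

Lemma real_cauchy_cvg u :
  (forall e, 0 < e -> exists n0 : nat, forall m n, (n0 <= m)%N -> (n0 <= n)%N ->
    `|u m - u n| <= e) -> exists l : R, u n @[n --> \oo] --> l.
Proof.
move=> H; suff : cvg (u n @[n --> \oo]) by move=> /cvg_ex.
apply/cauchy_cvgP/cauchy_exP => e e0.
have e20 : 0 < e / 2 by lra.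
have [n0 Hn] := H _ e20; exists (u n0), n0 => // n n0n /=.
rewrite /ball/=; apply: le_lt_trans (Hn _ _ (leqnn _) n0n) _; lra.
Qed.

Lemma cvgn_le u v l l' : u n @[n --> \oo] --> l -> v n @[n --> \oo] --> l' ->
  (forall n, u n <= v n) -> l <= l'.
Proof.
by move=> ul vl uv; apply: (ler_cvg_to ul vl); exact: nearW.
Qed.

Lemma nondecreasing_bounded_cvg u M : (forall n m, (n <= m)%N -> u n <= u m) ->
  (forall n, u n <= M) ->
  exists l : R, [/\ u n @[n --> \oo] --> l, forall n, u n <= l & l <= M].
Proof.
move=> und uM.
have ub : has_ubound (range u) by exists M => _ [n _ <-].
exists (sup (range u)); split; first exact: nondecreasing_cvgn.
  by move=> n; apply: ub_le_sup => //; exists n.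
by apply: ge_sup; [exists (u 0%N), 0%N|move=> _ [n _ <-]].
Qed.

Lemma cvg_fsum (I : Type) (r : seq I) (F : I -> nat -> R) (l : I -> R) :
  (forall i, F i n @[n --> \oo] --> l i) ->
  \sum_(i <- r) F i n @[n --> \oo] --> \sum_(i <- r) l i.
Proof.
move=> Fl; elim: r => [|i r IH].
  rewrite big_nil; under eq_fun do rewrite big_nil; exact: cvg_cst.
rewrite big_cons; under eq_fun do rewrite big_cons; exact: cvgD.
Qed.

Lemma cvgn_cauchy u l : u n @[n --> \oo] --> l -> forall e, 0 < e ->
  exists n0 : nat, forall m n, (n0 <= m)%N -> (n0 <= n)%N -> `|u m - u n| <= e.
Proof.
move=> /cvgn_epsP ul e e0; have [|n0 H] := ul (e / 2); first by lra.
exists n0 => m n /H + /H; rewrite !ler_norml; lra.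
Qed.

End Sequences.

Section Completion.
Variables (R : realType) (X : choiceType) (b : X -> X -> R) (q : X -> R).
Hypothesis gb : is_graph b.
Hypothesis co : coercive b q.
Implicit Types (f g : X -> R) (K L : {fset X}) (phi psi : nat -> X -> R).
Local Notation h := (hform b q).
Local Notation N := (siN h).

Let hsi : semi_inner (@Cc R X) h. Proof. by apply: hform_si co.1. Qed.

(** The Cauchy condition involves [h] alone, without a base point; coercivity makes these the
    approximating sequences of [ho_approx] for every [o]. *)
Definition h_approx phi f := [/\ forall n, Cc (phi n),
  cauchy_wrt (hquad b q) phi
  & forall x, phi n x @[n --> \oo] --> f x].

Definition form_dom f := exists phi, h_approx phi f.

Definition approx_of f := xget (fun=> 0) [set phi | h_approx phi f].

(** The sequences are arbitrary choices; closability makes the value independent of them, as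
    [form_extP] records. *)
Definition form_ext f g := locked (lim (h (approx_of f n) (approx_of g n) @[n
  --> \oo])).

Lemma cauchyN phi : (forall n, Cc (phi n)) -> cauchy_wrt (hquad b q) phi <->
  forall e, 0 < e -> exists n0 : nat, forall m n, (n0 <= m)%N -> (n0 <= n)%N ->
    N (phi m - phi n) <= e.
Proof.
move=> fC; split=> H e e0.
  have [|n0 Hn] := H (e ^+ 2); first by rewrite exprn_gt0.
  exists n0 => m n mn0 nn0; have := Hn _ _ mn0 nn0.
  rewrite -ler_sqr ?nnegrE ?siN_ge0//; last exact: ltW.
  by rewrite (siN_sqr hsi); [exact: ltW|exact: CcB].
have se : 0 < Num.sqrt e / 2 by rewrite divr_gt0 ?sqrtr_gt0.
have [n0 Hn] := H _ se; exists n0 => m n mn0 nn0.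
rewrite /hquad -(siN_sqr hsi); last exact: CcB.
apply: (@le_lt_trans _ _ ((Num.sqrt e / 2) ^+ 2)).
  by rewrite ler_sqr ?nnegrE ?siN_ge0 ?(ltW se)//; exact: Hn.
by rewrite exprMn sqr_sqrtr ?ltW//; lra.
Qed.

Lemma h_approxN phi f : h_approx phi f -> forall e, 0 < e ->
  exists n0 : nat, forall m n, (n0 <= m)%N -> (n0 <= n)%N ->
    N (phi m - phi n) <= e.
Proof. by case=> fC /(cauchyN fC). Qed.

Lemma cauchy_bounded phi : (forall n, Cc (phi n)) ->
  (forall e, 0 < e -> exists n0 : nat, forall m n, (n0 <= m)%N -> (n0 <= n)%N ->
    N (phi m - phi n) <= e) ->
  exists2 M : R, 0 < M & exists n0 : nat, forall n, (n0 <= n)%N ->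
    N (phi n) <= M.
Proof.
move=> fC H; have [n0 Hn] := H 1 ltr01.
exists (N (phi n0) + 1); first by rewrite ltr_wpDl// siN_ge0.
exists n0 => n nn0; have := Hn _ _ nn0 (leqnn n0).
have := siN_dist hsi (fC n) (fC n0); rewrite ler_norml; lra.
Qed.

Lemma cauchy_pt phi : (forall n, Cc (phi n)) ->
  cauchy_wrt (hquad b q) phi -> exists f, h_approx phi f.
Proof.
move=> fC hC; have hN := (cauchyN fC).1 hC.
suff H : forall x, exists l : R, phi n x @[n --> \oo] --> l.
  by have [f Hf] := choice H; exists f.
move=> x; apply: real_cauchy_cvg => e e0; have [C C0 HC] := Cc_pt gb co x.
have [n0 Hn] := hN _ (divr_gt0 e0 C0); exists n0 => m n mn0 nn0.
have := HC _ (CcB (fC m) (fC n)); have := Hn _ _ mn0 nn0.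
rewrite ler_pdivlMr// mulrC => H1 H2; exact: le_trans H2 H1.
Qed.

Lemma h_approxL c phi psi f g : h_approx phi f -> h_approx psi g ->
  h_approx (fun n => c *: phi n + psi n) (c *: f + g).
Proof.
move=> Hf Hg; have [fC _ fl] := Hf; have [gC _ gl] := Hg.
have cC n : Cc (c *: phi n + psi n) by exact: CcL.
split=> //; last first.
  by move=> x; apply: cvgD => //; apply: cvgM => //; exact: cvg_cst.
apply/(cauchyN cC) => e e0.
have c0 : 0 < `|c| + 1 by rewrite ltr_wpDl.
have [|n1 H1] := h_approxN Hf (e := e / 2 / (`|c| + 1));
  first by rewrite !divr_gt0.
have [|n2 H2] := h_approxN Hg (e := e / 2); first by rewrite divr_gt0.
exists (maxn n1 n2) => m n; rewrite !geq_max => /andP[m1 m2] /andP[n1' n2'].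
have -> : c *: phi m + psi m - (c *: phi n + psi n) =
    c *: (phi m - phi n) + (psi m - psi n).
  by rewrite opprD addrACA scalerBr.
have dC := CcB (fC m) (fC n).
apply: le_trans (siN_D hsi (CcZ c dC) (CcB (gC m) (gC n))) _.
rewrite (siN_Z hsi)//.
have := H1 _ _ m1 n1'; rewrite ler_pdivlMr//; have := H2 _ _ m2 n2'.
have := siN_ge0 h (phi m - phi n); have := normr_ge0 c.
set A := N (phi m - phi n); nra.
Qed.

Lemma h_approx_cst f : Cc f -> h_approx (fun=> f) f.
Proof.
move=> fC; split=> // [|x]; last exact: cvg_cst.
apply/cauchyN => // e e0; exists 0%N => m n _ _.
by rewrite subrr /siN (siB0 hsi (Cc0 _ _)) sqrtr0 ltW.
Qed.

(** Letting [m] grow in the row bound for [phi n - phi m] over a fixed finite [K] gives convergence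
    in the weighted l1 norm of the row at [x], uniformly in [K]. This is what lets [H] pass to the
    limit. *)
Lemma h_approx_row phi f x : h_approx phi f ->
  abs_summable (fun y => b x y * f y) /\
  forall e, 0 < e -> exists n0 : nat, forall n, (n0 <= n)%N -> forall K,
    \sum_(y <- K) `|b x y * (phi n y - f y)| <= e.
Proof.
move=> Hf; have [fC _ fl] := Hf; have [C C0 HC] := Cc_row gb co x.
have key e : 0 < e -> exists n0 : nat, forall n, (n0 <= n)%N -> forall K,
    \sum_(y <- K) `|b x y * (phi n y - f y)| <= e.
  move=> e0; have [n0 Hn] := h_approxN Hf (divr_gt0 e0 C0).
  exists n0 => n nn0 K.
  have cv : (\sum_(y <- K) `|b x y * (phi n y - phi m y)|) @[m --> \oo] -->
      \sum_(y <- K) `|b x y * (phi n y - f y)|.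
    apply: cvg_fsum => y; apply: cvg_norm; apply: cvgM; first exact: cvg_cst.
    by apply: cvgB => //; exact: cvg_cst.
  apply: (cvgr_to_le cv); exists n0 => // m /= mn0.
  under eq_bigr do rewrite normrM (ger0_norm (graph_ge0 gb _ _)).
  apply: le_trans (HC _ K (CcB (fC n) (fC m))) _.
  have := Hn _ _ nn0 mn0; rewrite ler_pdivlMr// mulrC; exact.
split => //; have [n0 Hn] := key 1 ltr01.
have -> : (fun y => b x y * f y) =
    fun y => b x y * phi n0 y - b x y * (phi n0 y - f y).
  by apply/funext => y; ring.
apply: abs_summableB.
  by move: (Fdom_Cc gb (fC n0)) => /(FdomP gb); exact.
by exists 1; exact: Hn.
Qed.

Lemma h_approx_Fdom phi f : h_approx phi f -> Fdom b f.
Proof. by move=> Hf; apply/(FdomP gb) => x; have [] := h_approx_row x Hf. Qed.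

Lemma h_approx_Hop phi f x : h_approx phi f ->
  Hop b q (phi n) x @[n --> \oo] --> Hop b q f x.
Proof.
move=> Hf; have [fC _ fl] := Hf; have fF := h_approx_Fdom Hf.
have pF n : Fdom b (phi n) by exact: Fdom_Cc.
rewrite HopE//; under eq_fun do rewrite HopE//.
apply: cvgB; first by apply: cvgM => //; exact: cvg_cst.
apply/cvgn_epsP => e e0; have [bs H] := h_approx_row x Hf.
have [n0 Hn] := H _ e0; exists n0 => n nn0.
rewrite -sumRB//; last by move: (pF n) => /(FdomP gb); exact.
apply: ler_norm_sumR => K; under eq_bigr do rewrite -mulrBr; exact: Hn.
Qed.

Lemma h_approx_test phi f K g : h_approx phi f -> supp_in K g ->
  h (phi n) g @[n --> \oo] --> \sum_(x <- K) g x * Hop b q f x.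
Proof.
move=> Hf gK; have [fC _ _] := Hf.
have E n : h (phi n) g = \sum_(x <- K) g x * Hop b q (phi n) x.
  have /CcP[L fL] := fC n.
  rewrite (hformE q gb (K := K `|` L)%fset).
  - by apply: fsum_supp; [move=> x /gK ->; rewrite mul0r|exact: fsubsetUl].
  - exact/(supp_inW _ fL)/fsubsetUr.
  - exact/(supp_inW _ gK)/fsubsetUl.
under eq_fun do rewrite E.
by apply: cvg_fsum => x; apply: cvgM; [exact: cvg_cst|exact: h_approx_Hop].
Qed.

(** Split [h(phi n)] as [h(phi n - phi m, phi n) + h(phi m, phi n)]. The second term tends to 0 in
    [m], because [phi n] has finite support and [H (phi m)] tends to 0 pointwise; the first is small
    by the Cauchy condition and the boundedness of the norms. *)
Lemma closable phi : h_approx phi 0 -> hquad b q (phi n) @[n --> \oo] --> (0 :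
  R).
Proof.
move=> H0; have [fC hC _] := H0; have hN := h_approxN H0.
have [M M0 [n1 HM]] := cauchy_bounded fC hN.
apply/cvgn_epsP => e e0; have [n0 Hn] := hN _ (divr_gt0 e0 M0).
exists (maxn n0 n1) => n; rewrite geq_max => /andP[nn0 nn1].
rewrite subr0 ger0_norm; last exact: co.1.
have /CcP[K fK] := fC n.
have c0 : \sum_(x <- K) phi n x * Hop b q 0 x = 0.
  rewrite big1// => x _; rewrite (@Hop_supp _ _ _ _ gb fset0)// big_seq_fset0.
  by rewrite !subr0 !mulr0.
have := h_approx_test H0 fK; rewrite c0 => cv.
have cv2 : (hquad b q (phi n) - h (phi m) (phi n)) @[m --> \oo] -->
    hquad b q (phi n) - 0 by apply: cvgB => //; exact: cvg_cst.
rewrite -[leLHS]subr0; apply: (cvgr_to_le cv2); exists n0 => // m /= mn0.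
rewrite /hquad -(siBB hsi)//; apply: le_trans (ler_norm _) _.
apply: le_trans (siN_CS hsi (CcB (fC n) (fC m)) (fC n)) _.
have := Hn _ _ nn0 mn0; have := HM _ nn1; rewrite ler_pdivlMr//.
have := siN_ge0 h (phi n); have := siN_ge0 h (phi n - phi m); nra.
Qed.

Lemma h_approx_pair phi psi f g : h_approx phi f -> h_approx psi g ->
  exists l : R, h (phi n) (psi n) @[n --> \oo] --> l.
Proof.
move=> Hf Hg; have [fC _ _] := Hf; have [gC _ _] := Hg.
have [M M0 [n1 HM]] := cauchy_bounded fC (h_approxN Hf).
have [M' M'0 [n2 HM']] := cauchy_bounded gC (h_approxN Hg).
apply: real_cauchy_cvg => e e0.
have [|n3 H3] := h_approxN Hf (e := e / 2 / M'); first by rewrite !divr_gt0.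
have [|n4 H4] := h_approxN Hg (e := e / 2 / M); first by rewrite !divr_gt0.
exists (maxn (maxn n1 n2) (maxn n3 n4)) => m n.
rewrite !geq_max => /andP[/andP[m1 m2] /andP[m3 m4]] /andP[/andP[k1 k2]
  /andP[k3 k4]].
have -> : h (phi m) (psi m) - h (phi n) (psi n) =
    h (phi m - phi n) (psi m) + h (phi n) (psi m - psi n).
  by rewrite (siBB hsi)// (siBBr hsi)//; ring.
apply: le_trans (ler_normD _ _) _.
have := siN_CS hsi (CcB (fC m) (fC n)) (gC m).
have := siN_CS hsi (fC n) (CcB (gC m) (gC n)).
have := H3 _ _ m3 k3; have := H4 _ _ m4 k4.
rewrite !ler_pdivlMr//.
have := HM _ k1; have := HM' _ m2.
have := siN_ge0 h (phi n); have := siN_ge0 h (psi m).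
have := siN_ge0 h (phi m - phi n); have := siN_ge0 h (psi m - psi n).
set A := N (phi n); set B := N (psi m); set C := N (psi m - psi n).
set D := N (phi m - phi n) => C0 D0' B0 A0 BM AM CM DM H1 H2.
have : A * C <= M * C by exact: ler_wpM2r.
have : D * B <= D * M' by exact: ler_wpM2l.
lra.
Qed.

Lemma h_approxB phi psi f : h_approx phi f -> h_approx psi f ->
  h_approx (fun n => phi n - psi n) 0.
Proof.
move=> Hf Hg; have := h_approxL (-1) Hg Hf; rewrite scaleN1r addNr.
by under eq_fun do rewrite scaleN1r addrC.
Qed.

Lemma closable_pair phi psi g : h_approx phi 0 -> h_approx psi g ->
  h (phi n) (psi n) @[n --> \oo] --> (0 : R).
Proof.
move=> Hf Hg; have [fC _ _] := Hf; have [gC _ _] := Hg.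
have [M M0 [n1 HM]] := cauchy_bounded gC (h_approxN Hg).
apply/cvgn_epsP => e e0; have /cvgn_epsP/(_ ((e / M) ^+ 2))[] := closable Hf.
  by rewrite exprn_gt0// divr_gt0.
move=> n2 H2; exists (maxn n1 n2) => n; rewrite geq_max subr0 => /andP[nn1 nn2].
apply: le_trans (siN_CS hsi (fC n) (gC n)) _.
have := H2 _ nn2; rewrite subr0 ger0_norm; last exact: co.1.
rewrite /hquad -(siN_sqr hsi)// ler_sqr ?nnegrE ?siN_ge0 ?(ltW (divr_gt0 e0
  M0))//.
rewrite ler_pdivlMr//; apply: le_trans.
by apply: ler_wpM2l; [exact: siN_ge0|exact: HM].
Qed.

Lemma h_approx_pair_eq phi phi' psi psi' f g (l : R) : h_approx phi f ->
  h_approx phi' f ->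
  h_approx psi g -> h_approx psi' g ->
  h (phi n) (psi n) @[n --> \oo] --> l -> h (phi' n) (psi' n) @[n --> \oo] -->
    l.
Proof.
move=> Hf Hf' Hg Hg' cl.
have [fC _ _] := Hf; have [fC' _ _] := Hf'.
have [gC _ _] := Hg; have [gC' _ _] := Hg'.
have E n : h (phi' n) (psi' n) = h (phi n) (psi n) +
    (h (phi' n - phi n) (psi' n) + h (psi' n - psi n) (phi n)).
  rewrite (siBB hsi)// (siBB hsi)// (hform_sym q gb (gC' n))//.
  by rewrite (hform_sym q gb (gC n))//; ring.
under eq_fun do rewrite E.
rewrite -[l]addr0 -[X in l + X]addr0; apply: cvgD => //; apply: cvgD.
  exact: (closable_pair (h_approxB Hf' Hf) Hg').
exact: (closable_pair (h_approxB Hg' Hg) Hf).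
Qed.

Lemma approx_ofP f : form_dom f -> h_approx (approx_of f) f.
Proof.
by case=> phi Hf; rewrite /approx_of; case: xgetP => // H; exfalso;
  exact: (H phi).
Qed.

Lemma form_extP phi psi f g : h_approx phi f -> h_approx psi g ->
  h (phi n) (psi n) @[n --> \oo] --> form_ext f g.
Proof.
move=> Hf Hg; have rf : h_approx (approx_of f) f by apply: approx_ofP;
  exists phi.
have rg : h_approx (approx_of g) g by apply: approx_ofP; exists psi.
have [l Hl] := h_approx_pair rf rg.
rewrite /form_ext -lock (cvg_lim _ Hl)//; exact: (h_approx_pair_eq rf Hf rg Hg).
Qed.

Lemma form_dom_Cc f : Cc f -> form_dom f.
Proof. by move=> fC; exists (fun=> f); exact: h_approx_cst. Qed.

Lemma form_ext_Cc f g : Cc f -> Cc g -> form_ext f g = h f g.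
Proof.
move=> fC gC; have := form_extP (h_approx_cst fC) (h_approx_cst gC).
by move=> /cvg_lim <-//; rewrite lim_cst.
Qed.

Lemma form_ext_si : semi_inner form_dom form_ext.
Proof.
split.
- exact/form_dom_Cc/Cc0.
- by move=> c f g [phi Hf] [psi Hg]; eexists; exact: h_approxL Hf Hg.
- move=> c f g k [phi Hf] [psi Hg] [chi Hk].
  have [fC _ _] := Hf; have [gC _ _] := Hg; have [kC _ _] := Hk.
  have := form_extP (h_approxL c Hf Hg) Hk => /cvg_lim <-//.
  under eq_fun do rewrite (siB hsi)//.
  apply/cvg_lim => //; apply: cvgD; last exact: form_extP.
  by apply: cvgM; [exact: cvg_cst|exact: form_extP].
- move=> f g [phi Hf] [psi Hg]; have [fC _ _] := Hf; have [gC _ _] := Hg.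
  have := form_extP Hf Hg => /cvg_lim <-//.
  under eq_fun do rewrite (hform_sym q gb)//.
  by apply/cvg_lim => //; exact: form_extP.
- move=> f [phi Hf]; have [fC _ _] := Hf.
  apply: (cvgr_to_ge (form_extP Hf Hf)); apply: nearW => n; exact: co.1.
Qed.

Lemma form_dom_Fdom f : form_dom f -> Fdom b f.
Proof. by case=> phi; exact: h_approx_Fdom. Qed.

Lemma form_ext_test f g K : form_dom f -> supp_in K g ->
  form_ext f g = \sum_(x <- K) g x * Hop b q f x.
Proof.
move=> [phi Hf] gK; have gC : Cc g by apply/CcP; exists K.
exact: (cvgn_unique (form_extP Hf (h_approx_cst gC)) (h_approx_test Hf gK)).
Qed.

Lemma h_approx_form_ext phi f : h_approx phi f ->
  form_ext (phi n - f) (phi n - f) @[n --> \oo] --> (0 : R).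
Proof.
move=> Hf; have [fC hC _] := Hf; apply/cvgn_epsP => e e0.
have [n0 Hn] := hC _ e0; exists n0 => n nn0; rewrite subr0.
have Hd : h_approx (fun m => phi n - phi m) (phi n - f).
  have := h_approxL (-1) Hf (h_approx_cst (fC n)); rewrite scaleN1r addrC.
  by under eq_fun do rewrite scaleN1r addrC.
have aP := form_extP Hd Hd; have [_ _ _ _ pos] := form_ext_si.
rewrite ger0_norm; last by apply: pos; eexists; exact: Hd.
apply: (cvgr_to_le aP); exists n0 => // m /= mn0; exact/ltW/Hn.
Qed.

Lemma form_dom_pt x : exists2 C : R, 0 < C & forall f, form_dom f ->
  `|f x| <= C * siN form_ext f.
Proof.
have [C C0 HC] := Cc_pt gb co x; exists C => // f [phi Hf].
have [fC _ fl] := Hf.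
have c1 : `|phi n x| @[n --> \oo] --> `|f x| by apply: cvg_norm; exact: fl.
have c2 : C * N (phi n) @[n --> \oo] --> C * siN form_ext f.
  apply: cvgM; first exact: cvg_cst.
  by apply: (cvg_comp _ _ (form_extP Hf Hf)); exact: sqrt_continuous.
by apply: (cvgn_le c1 c2) => n; exact: HC.
Qed.

Lemma form_ext_eq0 f : form_dom f -> form_ext f f <= 0 -> f = 0.
Proof.
move=> fD f0; apply/funext => x; have [C C0 HC] := form_dom_pt x.
apply/eqP; rewrite -normr_le0; apply: le_trans (HC _ fD) _.
by rewrite /siN ler0_sqrtr// mulr0.
Qed.

(** For [f] orthogonal to [Cc], the squared distance to an approximating sequence tends to twice the
    energy of [f]; but it also tends to 0. *)
Lemma form_ext_dense f : form_dom f -> (forall g, Cc g ->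
  form_ext f g = 0) -> f = 0.
Proof.
move=> fD fg; apply: form_ext_eq0 => //; have [phi Hf] := fD;
  have [fC _ _] := Hf.
have := form_extP Hf Hf => cv.
have [si0' siL' siB' siS' siP'] := form_ext_si.
have c1 := h_approx_form_ext Hf.
have E n : form_ext (phi n - f) (phi n - f) = form_ext f f + h (phi n) (phi n).
  have pD : form_dom (phi n) by exact: form_dom_Cc.
  rewrite (siQB form_ext_si)// (siS' _ _ pD fD) fg// form_ext_Cc//; ring.
have c2 : form_ext (phi n - f) (phi n - f) @[n --> \oo] --> form_ext f f +
  form_ext f f.
  by under eq_fun do rewrite E; apply: cvgD => //; exact: cvg_cst.
have := cvgn_unique c1 c2; lra.
Qed.

Lemma quad_extE approx f : (forall phi, approx phi f -> h_approx phi f) ->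
  (exists phi, approx phi f) -> quad_ext b q approx f = form_ext f f.
Proof.
move=> H1 [phi Hphi]; rewrite /quad_ext.
case: xgetP => [psi _ Hpsi|H]; last by exfalso; exact: (H phi).
by apply/cvg_lim => //; apply: form_extP; exact: H1.
Qed.

Lemma polarizeE (Q : (X -> R) -> R) f g : (forall k, form_dom k ->
  Q k = form_ext k k) ->
  form_dom f -> form_dom g -> polarize Q f g = form_ext f g.
Proof.
move=> QE fD gD; rewrite /polarize !QE.
- rewrite (siQD form_ext_si fD gD) (siQB form_ext_si fD gD).
  by move: (form_ext f f) (form_ext f g) (form_ext g g) => A B C; lra.
- exact: (siDB form_ext_si).
- exact: (siDD form_ext_si).
Qed.

Lemma exhaustion_sub (K : nat -> set X) L : exhaustion K ->
  exists n0 : nat, forall n, (n0 <= n)%N -> (L `<=` fset_set (K n))%fset.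
Proof.
move=> [Kf KS KT].
have Kmono n m : (n <= m)%N -> K n `<=` K m.
  by move=> /subnKC <-; elim: (m - n)%N => [|k IH]; rewrite ?addn0// addnS;
    apply: subset_trans IH _.
have Kx x : exists n0 : nat, forall n, (n0 <= n)%N -> K n x.
  have : (\bigcup_n K n) x by rewrite KT.
  by case=> n0 _ Kx; exists n0 => n nn0; exact: (Kmono n0).
suff [n0 H] : exists n0 : nat, forall n, (n0 <= n)%N ->
  forall x, x \in enum_fset L -> K n x.
  exists n0 => n nn0; apply/fsubsetP => x xL.
  by rewrite in_fset_set// inE; exact: H.
elim: (enum_fset L) => [|x l [n1 IH]]; first by exists 0%N.
have [n2 H2] := Kx x; exists (maxn n1 n2) => n; rewrite geq_max => /andP[? ?] y.
by rewrite inE => /orP[/eqP ->|]; [exact: H2|exact: IH].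
Qed.

Lemma exhaustion_mono (K : nat -> set X) n m : exhaustion K -> (n <= m)%N ->
  (fset_set (K n) `<=` fset_set (K m))%fset.
Proof.
move=> [Kf KS _] nm; have Kmono : K n `<=` K m.
  move: nm => /subnKC <-; elim: (m - n)%N => [|k IH]; rewrite ?addn0// addnS.
  exact: subset_trans IH _.
by apply/fsubsetP => x; rewrite !in_fset_set// !inE; exact: Kmono.
Qed.

(* For n <= m, h(u_m - u_n) = <f, u_m> - <f, u_n>,
  so that the bounded increasing
   sequence <f, u_n> controls the Galerkin approximations u_n. *)
Lemma Galerkin (K : nat -> set X) f (M : R) : exhaustion K ->
  (forall L g, supp_in L g -> (\sum_(x <- L) f x * g x) ^+ 2 <=
    M * hquad b q g) ->
  exists g, h_approx (fun n => HKinv b q (K n) f) g /\ forall x,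
    Hop b q g x = f x.
Proof.
move=> Kex fM; have [Kf KS KT] := Kex.
pose u n := HKinv b q (K n) f; pose L n := fset_set (K n).
have uL n : supp_in (L n) (u n) by have [] := HKinvP gb co f (Kf n).
have uH n x : x \in L n -> Hop b q (u n) x = f x.
  rewrite in_fset_set// inE; have [_] := HKinvP gb co f (Kf n); exact.
have uC n : Cc (u n) by apply/CcP; exists (L n).
have ut n g : supp_in (L n) g -> h (u n) g = \sum_(x <- L n) f x * g x.
  move=> gL; rewrite (hformE q gb (uL n) gL) !big_seq.
  by apply: eq_bigr => x xL; rewrite uH// mulrC.
pose s n := hquad b q (u n).
have sE n : s n = \sum_(x <- L n) f x * u n x by exact: ut.
have s0 n : 0 <= s n by exact: co.1.
(* The hypothesis at [u n] reads [s n ^+ 2 <= M * s n]. It says nothing about [M] when [s n = 0],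
   hence the maximum. *)
have sM n : s n <= Num.max M 0.
  have [s00|sp] := eqVneq (s n) 0; first by rewrite s00 le_max lexx orbT.
  have {}sp : 0 < s n by rewrite lt0r sp s0.
  have := fM _ _ (uL n); rewrite -sE expr2 -/(s n) ler_pM2r// => H.
  by rewrite le_max H.
have cross n m : (n <= m)%N -> h (u m) (u n) = s n.
  move=> nm; have LL := exhaustion_mono Kex nm.
  rewrite ut; last exact: supp_inW (uL n).
  by rewrite sE; apply: fsum_supp => // x /(uL n) ->; rewrite mulr0.
have diff n m : (n <= m)%N -> hquad b q (u m - u n) = s m - s n.
  move=> nm; rewrite [LHS](siQB hsi (uC m) (uC n)) (cross _ _ nm).
  by rewrite -[h (u m) _]/(s m) -[h (u n) _]/(s n); lra.
have snd n m : (n <= m)%N -> s n <= s m.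
  by move=> nm; rewrite -subr_ge0 -diff//; apply: co.1; exact: CcB.
have [l [sl _ _]] := nondecreasing_bounded_cvg snd sM.
have uch : cauchy_wrt (hquad b q) u.
  move=> e e0; have [|n0 H] := cvgn_cauchy sl (e := e / 2);
    first by rewrite divr_gt0.
  exists n0; suff W m n : (n0 <= n)%N -> (n <= m)%N ->
    hquad b q (u m - u n) < e.
    move=> m n mn0 nn0; case/orP: (leq_total n m) => mn; first exact: W.
    by rewrite /hquad (siQsym hsi)//; exact: W.
  move=> nn0 nm; rewrite diff//.
  by have := H _ _ (leq_trans nn0 nm) nn0; rewrite ler_norml; lra.
have [g Hg] := cauchy_pt uC uch; exists g; split => // x.
have c1 := h_approx_Hop (x := x) Hg.
have [n0 Hn] := exhaustion_sub [fset x]%fset Kex.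
have c2 : Hop b q (u n) x @[n --> \oo] --> f x.
  apply/cvgn_epsP => e e0; exists n0 => n nn0; rewrite uH ?subrr ?normr0 ?ltW//.
  by apply: (fsubsetP (Hn _ nn0)); rewrite inE.
exact: (cvgn_unique c1 c2).
Qed.

End Completion.

Global Opaque form_ext.

(** * The Green function of the extended form *)

Lemma exhaustion_exists (R : realType) (X : choiceType) (b : X -> X -> R)
    (o : X) : is_graph b -> connected_graph b ->
  exists K : nat -> set X, exhaustion K.
Proof.
move=> gb bc.
have bfin u e : 0 < e -> finite_set [set v | e <= b u v].
  move=> e0; apply: contrapT => ninf.
  have [M HM] := abs_summable_b gb u.
  have M0 : 0 <= M by have := HM fset0; rewrite big_seq_fset0.
  have [B BA Bn] := infinite_set_fset (Num.truncn (M / e)).+1 ninf.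
  have := HM B; apply/negP; rewrite -ltNge.
  apply: (@lt_le_trans _ _ (\sum_(v <- B) e)).
    rewrite big_const_seq count_predT iter_addr_0 -/(size B).
    rewrite -[X in _ < X]mulr_natr -ltr_pdivrMl// mulrC.
    by apply: lt_le_trans (Num.Theory.truncnS_gt _) _; rewrite ler_nat.
  rewrite !big_seq; apply: ler_sum => v vB; apply: le_trans (ler_norm _).
  exact: BA.
pose K := fix K n := if n is m.+1 then
  K m `|` \bigcup_(u in K m) [set v | m.+1%:R^-1 <= b u v] else [set o].
exists K; split.
- elim=> [|n IH] /=; first exact: finite_set1.
  rewrite finite_setU; split => //; apply: bigcup_finite => // u _.
  exact: bfin.
- by move=> n x Kx; left.
- apply/seteqP; split => // y _.
  have [p px <-] := bc o y; have : (\bigcup_n K n) o by exists 0%N.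
  suff main u : path (fun u v => 0 < b u v) u p -> (\bigcup_n K n) u ->
    (\bigcup_n K n) (last u p) by exact: main.
  elim: p u {px} => [//|v p IH] u /= /andP[uv vp] [m _ Ku]; apply: IH vp _.
  have Kmono k : K (m + k)%N u.
    by elim: k => [|k IH]; [rewrite addn0|rewrite addnS; left].
  have [k Hk] : exists k, (m + k).+1%:R^-1 <= b u v.
    exists (Num.truncn (b u v)^-1); rewrite invf_ple ?posrE//.
    apply: le_trans (ltW (Num.Theory.truncnS_gt _)) _.
    by rewrite ler_nat ltnS leq_addl.
  by exists (m + k).+1 => //; right; exists u.
Qed.

Section GreenKernel.
Variables (R : realType) (X : choiceType) (b : X -> X -> R) (q : X -> R).
Hypothesis gb : is_graph b.
Hypothesis co : coercive b q.
Implicit Types (f g : X -> R) (x y : X).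
Local Notation h := (hform b q).
Local Notation a := (form_ext b q).
Local Notation fdom := (form_dom b q).
Local Notation N := (siN a).
Local Notation HK := (HKinv b q).

Let asi : semi_inner fdom a. Proof. exact: form_ext_si. Qed.

Lemma HKinv_supp (K : set X) f : finite_set K -> supp_in (fset_set K) (HK K f).
Proof. by move=> Kf; have [] := HKinvP gb co f Kf. Qed.

Lemma HKinv_eq (K : set X) f x : finite_set K -> x \in fset_set K ->
  Hop b q (HK K f) x = f x.
Proof.
move=> Kf; rewrite in_fset_set// inE => Kx.
by have [_] := HKinvP gb co f Kf; exact.
Qed.

Lemma HKinv_Cc (K : set X) f : finite_set K -> Cc (HK K f).
Proof. by move=> Kf; apply/CcP; exists (fset_set K); exact: HKinv_supp. Qed.

Lemma HKinv_Fdom (K : set X) f : finite_set K -> Fdom b (HK K f).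
Proof. by move=> Kf; apply: Fdom_Cc => //; exact: HKinv_Cc. Qed.

Lemma HopB f g x : Fdom b f -> Fdom b g ->
  Hop b q (f - g) x = Hop b q f x - Hop b q g x.
Proof.
move=> fF gF; have -> : f - g = (-1) *: g + f by rewrite scaleN1r addrC.
by rewrite HopL// mulN1r addrC.
Qed.

Lemma FdomB f g : Fdom b f -> Fdom b g -> Fdom b (f - g).
Proof.
move=> fF gF; have -> : f - g = (-1) *: g + f by rewrite scaleN1r addrC.
exact: FdomL.
Qed.

Lemma comparison (K : {fset X}) f g : Fdom b f -> Fdom b g ->
  (forall x, x \notin K -> f x <= g x) ->
  (forall x, x \in K -> Hop b q f x <= Hop b q g x) -> forall x, f x <= g x.
Proof.
move=> fF gF fg Hfg x; rewrite -subr_ge0.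
apply: (max_principle gb co (K := K) (f := g - f)); first exact: FdomB.
  by move=> y yK; rewrite subr_ge0; exact: fg.
by move=> y yK; rewrite HopB// subr_ge0; exact: Hfg.
Qed.

Lemma HKinv_ge0 (K : set X) f : finite_set K -> (forall x, 0 <= f x) ->
  forall x, 0 <= HK K f x.
Proof.
move=> Kf f0; apply: (max_principle gb co (K := fset_set K)).
- exact: HKinv_Fdom.
- by move=> x xK; rewrite HKinv_supp.
- by move=> x xK; rewrite HKinv_eq.
Qed.

Lemma HKinv_le_super (K : set X) f g : finite_set K -> (forall x, 0 <= g x) ->
  Fdom b g -> (forall x, f x <= Hop b q g x) -> forall x, HK K f x <= g x.
Proof.
move=> Kf g0 gF Hg; apply: (@comparison (fset_set K)) => //.
- exact: HKinv_Fdom.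
- by move=> x xK; rewrite HKinv_supp.
- by move=> x xK; rewrite HKinv_eq.
Qed.

Lemma HKinv_mono (K L : set X) f : finite_set L -> K `<=` L ->
  (forall x, 0 <= f x) -> forall x, HK K f x <= HK L f x.
Proof.
move=> Lf KL f0; have Kf : finite_set K by exact: sub_finite_set Lf.
have KL' x : x \in fset_set K -> x \in fset_set L.
  by rewrite !in_fset_set// !inE; exact: KL.
apply: (@comparison (fset_set K)); try exact: HKinv_Fdom.
- by move=> x xK; rewrite [leLHS]HKinv_supp//; exact: HKinv_ge0.
- by move=> x xK; rewrite !HKinv_eq//; exact: KL'.
Qed.

Lemma form_ext_cvg phi f g : h_approx b q phi f -> fdom g ->
  a (phi n) g @[n --> \oo] --> a f g.
Proof.
move=> Hf gD; have [fC _ _] := Hf; have fD : fdom f by exists phi.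
have pD n : fdom (phi n) by exact: form_dom_Cc.
apply/cvgn_epsP => e e0.
have N0 : 0 < N g + 1 by rewrite ltr_wpDl// siN_ge0.
have /cvgn_epsP/(_ ((e / (N g + 1)) ^+ 2))[] := h_approx_form_ext gb co Hf.
  by rewrite exprn_gt0// divr_gt0.
move=> n0 Hn; exists n0 => n nn0; rewrite -(siBB asi)//.
have dD := siDB asi (pD n) fD.
apply: le_trans (siN_CS asi dD gD) _.
have := Hn _ nn0; rewrite subr0 ger0_norm; last exact: (siP asi).
rewrite -(siN_sqr asi)// => /(ler_of_sqr (siN_ge0 _ _) (ltW (divr_gt0 e0 N0))).
rewrite ler_pdivlMr//; apply: le_trans.
by apply: ler_wpM2l; [exact: siN_ge0|rewrite lerDl].
Qed.

(** The representer of evaluation at [x], given by its equation so that comparison arguments apply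
    to it; [green_D0] and [reproducing_green] translate to and from the reproducing property. *)
Definition green x g := fdom g /\ forall z, Hop b q g z = \1_[set x] z.

Lemma indic1E x y : \1_[set x] y = (y == x)%:R :> R.
Proof.
rewrite indicE; case: eqP => [->|yx]; first by rewrite mem_set.
by rewrite memNset.
Qed.

Lemma fsum_indic x f (L : {fset X}) : supp_in L f ->
  \sum_(z <- L) f z * \1_[set x] z = f x.
Proof.
move=> fL; have [xL|xL] := boolP (x \in L).
  rewrite (big_fsetD1 _ xL)/= indic1E eqxx mulr1 big1_seq ?addr0// => z /=.
  by rewrite !inE indic1E => /andP[/negbTE -> _]; rewrite mulr0.
rewrite fL// big1_seq// => z /= zL; rewrite indic1E.
by case: eqP => [zx|]; [rewrite -zx zL in xL|rewrite mulr0].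
Qed.

Lemma green_Cc x g f : green x g -> Cc f -> a g f = f x.
Proof.
move=> [gD gH] /CcP[L fL]; rewrite (form_ext_test gb co gD fL).
by rewrite -[RHS](fsum_indic x fL); apply: eq_bigr => z _; rewrite gH.
Qed.

Lemma green_D0 x g f : green x g -> fdom f -> a g f = f x.
Proof.
move=> gg [phi Hf]; have [fC _ fl] := Hf; have [gD _] := gg.
have := form_ext_cvg Hf gD; have E n : a (phi n) g = phi n x.
  by rewrite (siS asi)//; [exact: green_Cc|exact: form_dom_Cc].
under eq_fun do rewrite E.
move=> c; rewrite (cvgn_unique (fl x) c) (siS asi)//.
by exists phi.
Qed.

Lemma reproducing_green x g : fdom g -> (forall f, Cc f -> a g f = f x) ->
  green x g.
Proof.
move=> gD ag; split => // z; have /CcP[L zL] := Cc_one R z.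
have := ag _ (Cc_one R z); rewrite (form_ext_test gb co gD zL).
have -> : \sum_(y <- L) \1_[set z] y * Hop b q g y = Hop b q g z.
  have [zL'|zL'] := boolP (z \in L).
    rewrite (big_fsetD1 _ zL')/= indic1E eqxx mul1r big1_seq ?addr0// => y /=.
    by rewrite !inE indic1E => /andP[/negbTE -> _]; rewrite mul0r.
  by have := zL _ zL'; rewrite indic1E eqxx => /eqP; rewrite oner_eq0.
by move=> ->; rewrite !indic1E eq_sym.
Qed.

Lemma green_unique x g g' : green x g -> green x g' -> g = g'.
Proof.
move=> gg gg'; have [gD _] := gg; have [gD' _] := gg'.
apply/eqP; rewrite -subr_eq0; apply/eqP; apply: (form_ext_dense gb co).
  exact: (siDB asi).
move=> f fC; have fD : fdom f by exact: form_dom_Cc.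
by rewrite (siBB asi)// (green_Cc gg)// (green_Cc gg')// subrr.
Qed.

Lemma green_exists (K : nat -> set X) x : exhaustion K ->
  exists g, h_approx b q (fun n => HK (K n) \1_[set x]) g /\ green x g.
Proof.
move=> Kex; have [C C0 HC] := co.2 x.
have [L g gL|g [Hg gH]] := Galerkin (f := \1_[set x]) (M := C) gb co Kex.
  under eq_bigr do rewrite mulrC.
  by rewrite fsum_indic//; apply: HC; apply/CcP; exists L.
by exists g; split => //; split => //; eexists; exact: Hg.
Qed.

Lemma green_cvg (K : nat -> set X) x g : exhaustion K -> green x g ->
  h_approx b q (fun n => HK (K n) \1_[set x]) g.
Proof.
move=> Kex gg; have [g' [Hg' gg']] := green_exists x Kex.
by rewrite (green_unique gg gg').
Qed.

Lemma indic1_ge0 x z : 0 <= \1_[set x] z :> R.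
Proof. by rewrite indic1E ler0n. Qed.

(** By reproduction [g x] is the energy of [g]; if it were 0, then [g = 0], against [H g x = 1]. *)
Lemma green_self x g : green x g -> 0 < g x.
Proof.
move=> gg; have [gD gH] := gg.
rewrite -(green_D0 gg gD) lt0r (siP asi)// andbT; apply/eqP => g0.
have gz : g = 0 by apply: (form_ext_eq0 gb co) => //; rewrite g0.
have := gH x; rewrite gz (@Hop_supp _ _ _ _ gb fset0)// big_seq_fset0.
by rewrite subr0 mulr0 indic1E eqxx => /esym/eqP; rewrite oner_eq0.
Qed.

Lemma green_sym x y g g' : green x g -> green y g' -> g y = g' x.
Proof.
move=> gg gg'; have [gD _] := gg; have [gD' _] := gg'.
by rewrite -(green_D0 gg gD') (siS asi)// (green_D0 gg' gD).
Qed.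

Lemma HKinv_le_green (K : nat -> set X) n x y g : exhaustion K -> green x g ->
  HK (K n) \1_[set x] y <= g y.
Proof.
move=> Kex gg; have [_ _ gl] := green_cvg Kex gg; have [Kf _ _] := Kex.
apply: (cvgr_to_ge (gl y)); exists n => // m /= nm.
apply: HKinv_mono => //.
by move=> z Kz; have := exhaustion_mono Kex nm => /fsubsetP/(_ z);
  rewrite !in_fset_set// !inE; exact.
Qed.

Lemma green_ge0 (K : nat -> set X) x y g : exhaustion K -> green x g ->
  0 <= g y.
Proof.
move=> Kex gg; have [Kf _ _] := Kex.
apply: le_trans (HKinv_le_green 0%N y Kex gg); exact: HKinv_ge0.
Qed.

Lemma green_le (K : nat -> set X) x y g u : exhaustion K -> green x g ->
  (forall z, 0 <= u z) -> Fdom b u -> (forall z, \1_[set x] z <= Hop b q u z) ->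
  g y <= u y.
Proof.
move=> Kex gg u0 uF Hu; have [_ _ gl] := green_cvg Kex gg; have [Kf _ _] := Kex.
by apply: (cvgr_to_le (gl y)); apply: nearW => n; exact: HKinv_le_super.
Qed.

End GreenKernel.

(** * Adding a positive constant to the potential *)

Section Shift.
Variables (R : realType) (X : choiceType) (b : X -> X -> R) (q : X -> R).
Hypothesis gb : is_graph b.
Hypothesis h0 : form_ge0 b q.
Implicit Types (f g : X -> R) (x y : X) (al be : R).

(** On forms this adds [al] times the l2 inner product, so kernels for [q + al] are resolvents of
    [H1] at [-al]. *)
Definition shiftq al : X -> R := fun x => q x + al.

Lemma Hop_shift al f x : Fdom b f ->
  Hop b (shiftq al) f x = Hop b q f x + al * f x.
Proof. by move=> fF; rewrite !HopE// /shiftq; ring. Qed.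

Lemma hform_shift al f g : Cc f -> Cc g ->
  hform b (shiftq al) f g = hform b q f g + al * l2inner f g.
Proof.
move=> fC gC; have [K [fK gK]] := CcP2 fC gC.
rewrite (hformE (shiftq al) gb fK gK) (hformE q gb fK gK) /l2inner.
rewrite (@sumR_supp _ _ K); last by move=> x /fK ->; rewrite mul0r.
rewrite mulr_sumr -big_split/=; apply: eq_bigr => x _.
by rewrite Hop_shift; [ring|exact: Fdom_Cc].
Qed.

Lemma l2inner_Cc_ge f x : Cc f -> f x ^+ 2 <= l2inner f f.
Proof.
move=> /CcP[K fK]; have := @fsum_le_sumR _ _ (fun x => f x * f x) [fset x]%fset.
rewrite big_seq_fset1 expr2; apply.
  by apply: (@abs_summable_supp _ _ K) => z /fK ->; rewrite mul0r.
by move=> z; rewrite -expr2 sqr_ge0.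
Qed.

Lemma coercive_shift al : 0 < al -> coercive b (shiftq al).
Proof.
move=> al0; have key phi x : Cc phi -> al * phi x ^+ 2 <=
  hquad b (shiftq al) phi.
  move=> fC; rewrite /hquad hform_shift//; apply: ler_wpDl; first exact: h0.
  by apply: ler_wpM2l; [exact: ltW|exact: l2inner_Cc_ge].
split=> [phi fC|x].
  have [[x _]|xE] := pselect (exists x : X, True).
    by apply: le_trans (key _ x fC); rewrite mulr_ge0 ?sqr_ge0// ltW.
  rewrite /hquad (hformE _ gb (K := fset0)) ?big_seq_fset0// => x.
    by exfalso; apply: xE; exists x.
  by exfalso; apply: xE; exists x.
exists al^-1; first by rewrite invr_gt0.
by move=> phi fC; rewrite ler_pdivlMl//; exact: key.
Qed.

Lemma green_shift_le (K : nat -> set X) al be x y g g' : exhaustion K ->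
  0 < be -> be <= al ->
  green b (shiftq al) x g -> green b (shiftq be) x g' -> g y <= g' y.
Proof.
move=> Kex be0 beal gg gg'; have al0 : 0 < al by lra.
have ca := coercive_shift al0; have cb := coercive_shift be0.
have [gD' gH'] := gg'; have gF' := form_dom_Fdom gb cb gD'.
have g0' z : 0 <= g' z by exact: (green_ge0 gb cb z Kex gg').
apply: (green_le gb ca y Kex gg) => // z.
have := gH' z; rewrite !Hop_shift// => <-; rewrite lerD2l.
exact: ler_wpM2r.
Qed.

Lemma green_shift_le0 (K : nat -> set X) al x y g g' : exhaustion K ->
  coercive b q -> 0 < al ->
  green b (shiftq al) x g -> green b q x g' -> g y <= g' y.
Proof.
move=> Kex cq al0 gg gg'; have ca := coercive_shift al0.
have [gD' gH'] := gg'; have gF' := form_dom_Fdom gb cq gD'.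
have g0' z : 0 <= g' z by exact: (green_ge0 gb cq z Kex gg').
apply: (green_le gb ca y Kex gg) => // z.
by rewrite Hop_shift// gH' lerDl mulr_ge0// ltW.
Qed.

(* Compare H_K^-1 1_x with ga + al * v, where v = H_K^-1 (H_K^-1 1_x). *)
Lemma green_shift_cvg (K : nat -> set X) x y g : exhaustion K -> coercive b q ->
  green b q x g -> forall e, 0 < e -> exists2 d : R, 0 < d &
  forall al ga, 0 < al -> al <= d -> green b (shiftq al) x ga ->
    g y - e <= ga y.
Proof.
move=> Kex cq gg e e0; have [Kf _ _] := Kex.
have [_ _ gl] := green_cvg gb cq Kex gg.
have /cvgn_epsP/(_ (e / 2))[] := gl y; first by rewrite divr_gt0.
move=> n /(_ n (leqnn n)) Hn; set gn := HKinv b q (K n) \1_[set x] in Hn.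
pose v := HKinv b q (K n) gn.
have gn0 z : 0 <= gn z by apply: HKinv_ge0 => //; exact: indic1_ge0.
have v0 z : 0 <= v z by exact: HKinv_ge0.
(* For [al] below this bound [al * v y <= e / 2]; the [+ 1] guards against [v y = 0]. *)
have d0 : 0 < e / 2 / (v y + 1) by rewrite !divr_gt0// ltr_wpDl.
exists (e / 2 / (v y + 1)) => // al ga al0 ald gga.
have ca := coercive_shift al0.
have gnF : Fdom b gn by exact: HKinv_Fdom.
have vF : Fdom b v by exact: HKinv_Fdom.
have [gaD gaH] := gga; have gaF := form_dom_Fdom gb ca gaD.
have ga0 z : 0 <= ga z by exact: (green_ge0 gb ca z Kex gga).
have gnc : supp_in (fset_set (K n)) gn by exact: HKinv_supp.
have H z : gn z <= al * v z + ga z.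
  apply: (comparison gb ca (K := fset_set (K n)) (f := gn) (g := al *: v + ga)).
  - exact: HKinv_Fdom.
  - exact: FdomL.
  - move=> w wK; rewrite gnc// lincombE addr_ge0// mulr_ge0//; exact: ltW.
  (* On [K n], the operator [H + al] maps [gn] to [1_x + al * gn] and [al * v + ga] to the same plus
     [al ^+ 2 * v]. *)
  - move=> w wK; rewrite HopL// gaH !Hop_shift// !HKinv_eq//.
    have := v0 w; have := gn0 w; nra.
have := H y; have vy := v0 y.
have : al * (v y + 1) <= e / 2 by rewrite -ler_pdivlMr// ltr_wpDl.
move: Hn; rewrite ler_norml; lra.
Qed.

End Shift.

(** * Generation and uniqueness of contraction semigroups *)

Section HilleYosida.
Variables (R : realType) (V : normedModType R).
Implicit Types (u v w f g k : V) (s t e d : R) (n m : nat).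

Definition eps_cvg (u : nat -> V) (l : V) := forall e, 0 < e ->
  exists n0 : nat, forall n, (n0 <= n)%N -> `|u n - l| <= e.

Definition eps_cauchy (u : nat -> V) := forall e, 0 < e ->
  exists n0 : nat, forall m n, (n0 <= m)%N -> (n0 <= n)%N -> `|u m - u n| <= e.

Lemma subrACA u v w f : (u - v) - (w - f) = (u - w) - (v - f).
Proof. by rewrite !opprD !opprK addrACA. Qed.

Lemma normV_eps u : (forall e, 0 < e -> `|u| <= e) -> u = 0.
Proof.
move=> H; apply/eqP; rewrite -normr_le0; apply/ler_addgt0Pr => e e0.
by rewrite add0r; exact: H.
Qed.

Lemma ler_distV u v w : `|u - w| <= `|u - v| + `|v - w|.
Proof.
have -> : u - w = (u - v) + (v - w) by rewrite addrA subrK.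
exact: ler_normD.
Qed.

Lemma eps_cvg_unique (u : nat -> V) l l' : eps_cvg u l -> eps_cvg u l' ->
  l = l'.
Proof.
move=> H H'; apply/eqP; rewrite -subr_eq0; apply/eqP; apply: normV_eps => e e0.
have e20 : 0 < e / 2 by lra.
have [n1 H1] := H _ e20; have [n2 H2] := H' _ e20.
have := H1 _ (leq_maxl n1 n2); have := H2 _ (leq_maxr n1 n2).
have := ler_distV l (u (maxn n1 n2)) l'; rewrite (distrC l (u _)); lra.
Qed.

Lemma eps_cvg_le (u : nat -> V) l (M : R) v : eps_cvg u l ->
  (forall n, `|u n - v| <= M) -> `|l - v| <= M.
Proof.
move=> H uM; apply/ler_addgt0Pr => e e0; have [n0 Hn] := H _ e0.
have := Hn _ (leqnn n0); have := uM n0; have := ler_distV l (u n0) v.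
rewrite (distrC l (u _)); lra.
Qed.

Hypothesis complete : forall u : nat -> V, eps_cauchy u ->
  exists l, eps_cvg u l.

Definition contraction (P : V -> V) :=
  (forall f g, P (f - g) = P f - P g) /\ forall f, `|P f| <= `|f|.

Lemma contraction_dist P f g : contraction P -> `|P f - P g| <= `|f - g|.
Proof. by case=> PB Pc; rewrite -PB. Qed.

Lemma contraction_iter P n : contraction P -> contraction (iter n P).
Proof.
move=> [PB Pc]; elim: n => [|n [IB Ic]]; first by split.
by split => [f g|f] /=; [rewrite IB PB|exact: le_trans (Pc _) (Ic _)].
Qed.

Lemma contraction_comp P Q : contraction P -> contraction Q ->
  contraction (P \o Q).
Proof.
move=> [PB Pc] [QB Qc]; split=> [f g|f] /=; first by rewrite QB PB.
exact: le_trans (Pc _) (Qc _).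
Qed.

Lemma iter_commute (P Q : V -> V) n f : (forall f, P (Q f) = Q (P f)) ->
  iter n P (Q f) = Q (iter n P f).
Proof. by move=> PQ; elim: n => //= n ->; rewrite PQ. Qed.

Lemma iter_comp (P Q : V -> V) n f : (forall f, P (Q f) = Q (P f)) ->
  iter n P (iter n Q f) = iter n (P \o Q) f.
Proof.
move=> PQ; elim: n => //= n <-; congr (P _).
by apply: iter_commute => g; rewrite PQ.
Qed.

(** The difference of the powers telescopes into [n] terms; commutation brings [P - Q] next to [f],
    and the remaining factors are contractions. *)
Lemma telescope_iter P Q n f : contraction P -> contraction Q ->
  (forall f, P (Q f) = Q (P f)) -> `|iter n P f - iter n Q f| <=
    n%:R * `|P f - Q f|.
Proof.
move=> cP cQ PQ; elim: n f => [|n IH] f.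
  by rewrite subrr normr0 mul0r.
rewrite !iterSr; apply: le_trans (ler_distV _ (iter n P (Q f)) _) _.
have h1 := contraction_dist (P f) (Q f) (contraction_iter n cP).
have h2 : n%:R * `|P (Q f) - Q (Q f)| <= n%:R * `|P f - Q f|.
  by apply: ler_wpM2l => //; rewrite PQ; exact: contraction_dist.
by have := IH (Q f); rewrite -[n.+1]addn1 natrD mulrDl mul1r; lra.
Qed.

(** * Resolvents and backward Euler construction of the semigroup *)

Variable A : V -> V -> Prop.
Hypothesis A_lin : forall (c : R) u g v k, A u g -> A v k ->
  A (c *: u + v) (c *: g + k).
Hypothesis A_accretive : forall s u g, 0 < s -> A u g -> `|u| <= `|u + s *: g|.
Hypothesis A_range : forall s f, 0 < s -> exists u g, A u g /\ u + s *: g = f.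
Hypothesis A_dense : forall f e, 0 < e -> exists u g, A u g /\ `|u - f| <= e.

(** This is [(1 + s A)^-1], the backward Euler step of length [s]; [resolvent] uses the other
    normalisation [(A - l)^-1]. *)
Definition resolv s f := xget 0 [set u | exists g, A u g /\ u + s *: g = f].

Lemma opB u g v k : A u g -> A v k -> A (u - v) (g - k).
Proof.
move=> ug vk; have -> : u - v = (-1) *: v + u by rewrite scaleN1r addrC.
by have -> : g - k = (-1) *: k + g by [rewrite scaleN1r addrC]; exact: A_lin.
Qed.

Lemma op0 : A 0 0.
Proof. by have [u [g [ug _]]] := A_range 0 (@ltr01 R); have := opB ug ug;
  rewrite !subrr. Qed.

Lemma opZ c u g : A u g -> A (c *: u) (c *: g).
Proof. by move=> ug; rewrite -[_ *: u]addr0 -[_ *: g]addr0;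
  exact: A_lin op0. Qed.

Lemma opD u g v k : A u g -> A v k -> A (u + v) (g + k).
Proof. by move=> ug vk; rewrite -[u]scale1r -[g]scale1r; exact: A_lin. Qed.

Lemma resolv_spec s f : 0 < s -> exists g,
  A (resolv s f) g /\ resolv s f + s *: g = f.
Proof.
move=> s0; rewrite /resolv; case: xgetP => [u _ //|H].
by have [u [g ug]] := A_range f s0; exfalso; apply: (H u); exists g.
Qed.

Lemma resolv_eq s u g : 0 < s -> A u g -> resolv s (u + s *: g) = u.
Proof.
move=> s0 ug; have [k [Jk E]] := resolv_spec (u + s *: g) s0.
apply/eqP; rewrite -subr_eq0 -normr_le0.
apply: le_trans (A_accretive s0 (opB Jk ug)) _.
by rewrite scalerBr addrACA -opprD E subrr normr0.
Qed.

Lemma resolv_contraction s : 0 < s -> contraction (resolv s).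
Proof.
move=> s0; split=> [f g|f].
  have [k [Hk <-]] := resolv_spec f s0; have [l [Hl <-]] := resolv_spec g s0.
  rewrite opprD addrACA -scalerBr resolv_eq//; last exact: opB.
  by rewrite !resolv_eq.
have [k [Hk E]] := resolv_spec f s0; rewrite -{2}E; exact: A_accretive.
Qed.

Lemma resolv_Z s c f : 0 < s -> resolv s (c *: f) = c *: resolv s f.
Proof.
move=> s0; have [k [Hk E]] := resolv_spec f s0;
  rewrite -{1}E scalerDr scalerA mulrC.
by rewrite -scalerA resolv_eq//; exact: opZ.
Qed.

Lemma resolv_D s f g : 0 < s -> resolv s (f + g) = resolv s f + resolv s g.
Proof.
move=> s0; have [JB _] := resolv_contraction s0.
have JN : resolv s (- g) = - resolv s g by rewrite -scaleN1r resolv_Z//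
  scaleN1r.
by rewrite -{1}[g]opprK JB JN opprK.
Qed.

(** If [k] is the image of [resolv s u] under [A], then [s k = u - resolv s u] is a difference of
    domain vectors. So [k] is in the domain, and [(1 + s A) k = g]. *)
Lemma resolv_A s u g : 0 < s -> A u g -> A (resolv s u) (resolv s g).
Proof.
move=> s0 ug; have [k [Hk E]] := resolv_spec u s0.
have uE : u - resolv s u = s *: k by rewrite -{1}E addrC addKr.
have : A (s^-1 *: (s *: k)) (s^-1 *: (g - k)) by rewrite -uE; apply/opZ/opB.
rewrite scalerA mulVf ?gt_eqF// scale1r => /(resolv_eq s0).
by rewrite scalerA mulfV ?gt_eqF// scale1r addrC subrK => ->.
Qed.

Lemma resolv_comm s t f : 0 < s -> 0 < t ->
  resolv s (resolv t f) = resolv t (resolv s f).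
Proof.
move=> s0 t0; have [g [Hg E]] := resolv_spec f t0.
by rewrite -{2}E resolv_D// resolv_Z// resolv_eq//; exact: resolv_A.
Qed.

Lemma resolv_sub s u g : 0 < s -> A u g -> u - resolv s u = s *: resolv s g.
Proof.
move=> s0 ug; rewrite -{1}(resolv_eq s0 ug) resolv_D// resolv_Z//.
by rewrite addrC addKr.
Qed.

Lemma resolv_near s u g : 0 < s -> A u g -> `|resolv s u - u| <= s * `|g|.
Proof.
move=> s0 ug; rewrite distrC (resolv_sub s0 ug) normrZ gtr0_norm//.
by apply: ler_wpM2l; [exact: ltW|exact: (resolv_contraction s0).2].
Qed.

Lemma resolv_cvg f e : 0 < e -> exists2 d, 0 < d & forall s, 0 < s ->
  s <= d -> `|resolv s f - f| <= e.
Proof.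
move=> e0; have [|u [g [ug fu]]] := A_dense f (e := e / 4); first by lra.
exists (e / 4 / (`|g| + 1)); first by rewrite !divr_gt0// ltr_wpDl.
move=> s s0; rewrite ler_pdivlMr; last by rewrite ltr_wpDl.
move=> sd; have h1 := resolv_near s0 ug.
have h2 := contraction_dist f u (resolv_contraction s0).
have h3 := ler_distV (resolv s f) (resolv s u) f;
  have h4 := ler_distV (resolv s u) u f.
move: h2; rewrite (distrC f); have := normr_ge0 g; nra.
Qed.

(** [(1 + s A)(1 + t A)] and [1 + (s + t) A] differ by [s t A^2]; on the domain of [A^2] contractive
    resolvents leave an error of that size. *)
Lemma resolv_add s t u g k : 0 < s -> 0 < t -> A u g -> A g k ->
  `|resolv s (resolv t u) - resolv (s + t) u| <= s * t * `|k|.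
Proof.
move=> s0 t0 ug gk; have st0 : 0 < s + t by rewrite addr_gt0.
pose v := resolv (s + t) u; pose g' := resolv (s + t) g;
  pose k' := resolv (s + t) k.
have vg' : A v g' by exact: resolv_A.
have gk' : A g' k' by exact: resolv_A.
have uE : u = v + (s + t) *: g' by rewrite -(resolv_sub st0 ug) addrC subrK.
have E : u + (s * t) *: k' = (v + t *: g') + s *: (g' + t *: k').
  rewrite uE scalerDl scalerDr scalerA -!addrA; congr (v + _).
  by rewrite !addrA; congr (_ + _); rewrite addrC.
have vE : resolv s (resolv t u) + (s * t) *: resolv s (resolv t k') = v.
  have <- : resolv s (resolv t (u + (s * t) *: k')) = v.
    by rewrite E resolv_comm// resolv_eq//;
      [rewrite resolv_eq|apply: opD => //; exact: opZ].
  by rewrite (resolv_D _ _ t0) (resolv_Z _ _ t0) (resolv_D _ _ s0) (resolv_Z _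
    _ s0).
rewrite -/v -vE opprD addrA subrr sub0r normrN normrZ gtr0_norm ?mulr_gt0//.
apply: ler_wpM2l; first by rewrite mulr_ge0// ltW.
apply: le_trans ((resolv_contraction s0).2 _) _.
apply: le_trans ((resolv_contraction t0).2 _) _.
exact: (resolv_contraction st0).2.
Qed.

Lemma square_dom_dense f e : 0 < e -> exists u g k, [/\ A u g, A g k &
  `|u - f| <= e].
Proof.
move=> e0; have [|u [g [ug uf]]] := A_dense f (e := e / 2); first by lra.
have [|d d0 Hd] := resolv_cvg u (e := e / 2); first by lra.
have [k [Hk _]] := resolv_spec g d0.
exists (resolv d u), (resolv d g), k; split => //; first exact: resolv_A.
have := ler_distV (resolv d u) u f; have := Hd _ d0 (lexx d); lra.
Qed.

(** With powers of two, refinement replaces each step by two half steps, so [resolv_add] compares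
    consecutive approximations. *)
Definition euler t n f := iter (2 ^ n) (resolv (t / (2 ^ n)%:R)) f.

Lemma pow2_gt0 n : 0 < (2 ^ n)%:R :> R.
Proof. by rewrite ltr0n expn_gt0. Qed.

Lemma euler_contraction t n : 0 < t -> contraction (euler t n).
Proof.
move=> t0; apply/contraction_iter/resolv_contraction.
by rewrite divr_gt0// pow2_gt0.
Qed.

(** Each of the [2 ^ n] steps is split into two of length [t / 2 ^ n.+1], at the cost of that length
    squared times the norm of [A^2 u]. *)
Lemma euler_step t n u g k : 0 < t -> A u g -> A g k ->
  `|euler t n.+1 u - euler t n u| <= t ^+ 2 * `|k| / (2 ^ n.+2)%:R.
Proof.
move=> t0 ug gk; pose s := t / (2 ^ n.+1)%:R.
have p0 := pow2_gt0 n.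
have s0 : 0 < s by rewrite divr_gt0// pow2_gt0.
have E2 : t / (2 ^ n)%:R = s + s.
  rewrite /s expnS natrM; field; exact: lt0r_neq0.
have -> : euler t n.+1 u = iter (2 ^ n) (resolv s \o resolv s) u.
  rewrite /euler -/s expnS mul2n -addnn iterD iter_comp// => f.
rewrite /euler E2.
have ss0 : 0 < s + s by rewrite addr_gt0.
have cJ := resolv_contraction s0.
apply: le_trans (telescope_iter _ _ (contraction_comp cJ cJ)
  (resolv_contraction ss0) _) _.
  by move=> f /=; rewrite (resolv_comm f s0 ss0) (resolv_comm _ s0 ss0).
have := resolv_add s0 s0 ug gk; move=> H.
apply: (@le_trans _ _ ((2 ^ n)%:R * (s * s * `|k|))).
  by apply: ler_wpM2l => //; exact: ltW.
rewrite le_eqVlt; apply/orP; left; apply/eqP.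
rewrite /s !expnS !natrM; field; exact: lt0r_neq0.
Qed.

Lemma euler_dist t n j u g k : 0 < t -> A u g -> A g k ->
  `|euler t (n + j) u - euler t n u| <= t ^+ 2 * `|k| / (2 ^ n.+1)%:R.
Proof.
(* [a i] is the tail, from [i] on, of the geometric series of one-step errors. *)
move=> t0 ug gk; pose a i := t ^+ 2 * `|k| / (2 ^ i.+1)%:R : R.
have a0 i : 0 <= a i by rewrite /a divr_ge0 ?mulr_ge0 ?sqr_ge0// ltW// pow2_gt0.
suff : `|euler t (n + j) u - euler t n u| <= a n - a (n + j)%N.
  by have := a0 (n + j)%N; rewrite /a; lra.
elim: j => [|j IH]; first by rewrite addn0 !subrr normr0.
rewrite addnS; have := euler_step (n + j) t0 ug gk.
have := ler_distV (euler t (n + j).+1 u) (euler t (n + j) u) (euler t n u).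
have aS : a (n + j)%N - a (n + j).+1 = t ^+ 2 * `|k| / (2 ^ (n + j).+2)%:R.
  rewrite /a (expnS 2 (n + j).+1) natrM; have := pow2_gt0 (n + j).+1.
  by move=> /lt0r_neq0 ?; field.
by rewrite -aS; lra.
Qed.

Lemma pow2_small (M : R) e : 0 < e -> exists n0 : nat, forall n, (n0 <= n)%N ->
  M / (2 ^ n)%:R <= e.
Proof.
move=> e0; exists (Num.truncn (`|M| / e)).+1 => n nn.
have p0 := pow2_gt0 n.
rewrite ler_pdivrMr// mulrC -ler_pdivrMr//.
apply: (@le_trans _ _ (`|M| / e)); first
  by rewrite ler_pM2r ?invr_gt0// ler_norm.
apply: le_trans (ltW (Num.Theory.truncnS_gt _)) _.
rewrite ler_nat; apply: leq_trans nn _; apply: ltnW; exact: ltn_expl.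
Qed.

(** The error bound needs a vector in the domain of [A^2]; such vectors are dense, and the
    approximations are contractions uniformly in [n]. *)
Lemma euler_cauchy t f : 0 < t -> eps_cauchy (euler t ^~ f).
Proof.
move=> t0 e e0; have [|u [g [k [ug gk uf]]]] := square_dom_dense f (e :=
  e / 4); first by lra.
have [|n0 Hn] := pow2_small (t ^+ 2 * `|k|) (e := e / 4); first by lra.
have key n : (n0 <= n)%N -> `|euler t n u - euler t n0 u| <= e / 4.
  move=> /subnKC <-; apply: le_trans (euler_dist n0 (n - n0) t0 ug gk) _.
  exact: Hn.
have d n := contraction_dist f u (euler_contraction n t0).
exists n0 => m n mn0 nn0; have := key _ mn0; have := key _ nn0.
have := d m; have := d n.
have := ler_distV (euler t m f) (euler t m u) (euler t n f).
have := ler_distV (euler t m u) (euler t n0 u) (euler t n f).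
have := ler_distV (euler t n0 u) (euler t n u) (euler t n f).
move: uf; rewrite (distrC u f) (distrC (euler t n0 u) (euler t n u)) (distrC
  (euler t n u) (euler t n f)).
lra.
Qed.

(** The other branch gives the identity at time 0, where the step length degenerates. *)
Definition sgrp t f := if 0 < t then xget 0 [set l | eps_cvg (euler t ^~ f) l]
  else f.

Lemma sgrp_cvg t f : 0 < t -> eps_cvg (euler t ^~ f) (sgrp t f).
Proof.
move=> t0; rewrite /sgrp t0; case: xgetP => [l _ //|H].
by have [l Hl] := complete (euler_cauchy f t0); exfalso; exact: (H l).
Qed.

Lemma sgrp0 f : sgrp 0 f = f. Proof. by rewrite /sgrp ltxx. Qed.

Lemma sgrp_contraction t : 0 <= t -> contraction (sgrp t).
Proof.
rewrite le_eqVlt => /predU1P[<-|t0]; first by split => *; rewrite !sgrp0.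
split=> [f g|f]; last first.
  rewrite -[sgrp t f]subr0; apply: (eps_cvg_le (sgrp_cvg f t0)) => n.
  by rewrite subr0; exact: (euler_contraction n t0).2.
apply: (eps_cvg_unique (sgrp_cvg (f - g) t0)) => e e0.
have [|n1 H1] := sgrp_cvg f t0 (e := e / 2); first by rewrite divr_gt0.
have [|n2 H2] := sgrp_cvg g t0 (e := e / 2); first by rewrite divr_gt0.
exists (maxn n1 n2) => n; rewrite geq_max => /andP[/H1 h1 /H2 h2].
rewrite (euler_contraction n t0).1 subrACA.
by apply: le_trans (ler_normB _ _) _; lra.
Qed.

Lemma euler_Z t n c f : 0 < t -> euler t n (c *: f) = c *: euler t n f.
Proof.
move=> t0; have s0 : 0 < t / (2 ^ n)%:R by rewrite divr_gt0// pow2_gt0.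
by rewrite /euler; move: (t / _) s0 => s s0; elim: (2 ^ n)%N => //= m ->;
  rewrite resolv_Z.
Qed.

Lemma sgrp_Z t c f : 0 <= t -> sgrp t (c *: f) = c *: sgrp t f.
Proof.
rewrite le_eqVlt => /predU1P[<-|t0]; first by rewrite !sgrp0.
apply: (eps_cvg_unique (sgrp_cvg (c *: f) t0)) => e e0.
have c0 : 0 < `|c| + 1 by rewrite ltr_wpDl.
have [n1 H1] := sgrp_cvg f t0 (divr_gt0 e0 c0).
exists n1 => n /H1; rewrite euler_Z// -scalerBr normrZ ler_pdivlMr//.
by have := normr_ge0 (euler t n f - sgrp t f); nra.
Qed.

Lemma sgrp_D t f g : 0 <= t -> sgrp t (f + g) = sgrp t f + sgrp t g.
Proof.
move=> t0; have [SB _] := sgrp_contraction t0.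
by rewrite -{1}[g]opprK SB -(scaleN1r g) sgrp_Z// scaleN1r opprK.
Qed.

Lemma sgrp_resolv t u g k : 0 < t -> A u g -> A g k ->
  `|sgrp t u - resolv t u| <= t ^+ 2 * `|k|.
Proof.
move=> t0 ug gk; apply: (eps_cvg_le (sgrp_cvg u t0)) => n.
have := euler_dist 0 n t0 ug gk; rewrite add0n {2}/euler expn0 divr1 /= => H.
apply: le_trans H _; have : 0 <= t ^+ 2 * `|k| by rewrite mulr_ge0// sqr_ge0.
by rewrite expn1; lra.
Qed.

Lemma sgrp_sub t u g : 0 <= t -> A u g -> `|sgrp t u - u| <= t * `|g|.
Proof.
rewrite le_eqVlt => /predU1P[<-|t0] ug; first
  by rewrite sgrp0 subrr normr0 mul0r.
apply: (eps_cvg_le (sgrp_cvg u t0)) => n; have p0 := pow2_gt0 n.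
have s0 : 0 < t / (2 ^ n)%:R by rewrite divr_gt0.
have cid : contraction (fun f : V => f) by split.
have := telescope_iter (2 ^ n) u (resolv_contraction s0) cid (fun=> erefl).
have iid m : iter m (fun f : V => f) u = u by elim: m.
rewrite iid => H; apply: le_trans H _.
apply: (@le_trans _ _ ((2 ^ n)%:R * (t / (2 ^ n)%:R * `|g|))).
  by apply: ler_wpM2l => //; exact: resolv_near.
by rewrite mulrA mulrCA divff ?mulr1//; exact: lt0r_neq0.
Qed.

Lemma sgrp_second_order t u g k : 0 < t -> A u g -> A g k ->
  `|sgrp t u - u + t *: g| <= 2 * t ^+ 2 * `|k|.
Proof.
move=> t0 ug gk; have h1 := sgrp_resolv t0 ug gk.
have h2 : `|resolv t u - u + t *: g| <= t ^+ 2 * `|k|.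
  have -> : resolv t u - u + t *: g = t *: (t *: resolv t k).
    by rewrite -(resolv_sub t0 gk) scalerBr -(resolv_sub t0 ug) opprB addrC.
  rewrite scalerA normrZ gtr0_norm ?mulr_gt0// -expr2.
  by apply: ler_wpM2l; [exact: sqr_ge0|exact: (resolv_contraction t0).2].
have -> : sgrp t u - u + t *: g = (sgrp t u - resolv t u) + (resolv t u - u + t
  *: g).
  by rewrite !addrA subrK.
apply: le_trans (ler_normD _ _) _; lra.
Qed.

(** The domain of [A^2] is a core: [resolv d] commutes with [A], so [resolv d u] and its image under
    [A] converge to [u] and [g] together. *)
Lemma square_dom_core u g e : 0 < e -> A u g ->
  exists v h k, [/\ A v h, A h k, `|v - u| <= e & `|h - g| <= e].
Proof.
move=> e0 ug; have [d1 d10 H1] := resolv_cvg u e0;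
  have [d2 d20 H2] := resolv_cvg g e0.
pose d := Num.min d1 d2; have d0 : 0 < d by rewrite lt_min d10 d20.
have [k [Hk _]] := resolv_spec g d0.
exists (resolv d u), (resolv d g), k; split => //; first exact: resolv_A.
  by apply: H1 => //; rewrite ge_min lexx.
by apply: H2 => //; rewrite ge_min lexx orbT.
Qed.

(** The right derivative at time 0, with the division by [t] cleared. *)
Definition eps_gen (T : R -> V -> V) f g := forall e, 0 < e ->
  exists2 d, 0 < d & forall t, 0 < t -> t <= d ->
    `|T t f - f - t *: g| <= e * t.

Lemma sgrp_gen_A u g : A u g -> eps_gen sgrp u (- g).
Proof.
move=> ug e e0; have e40 : 0 < e / 4 by lra.
have [v [h [k [vh hk vu hg]]]] := square_dom_core e40 ug.
have k0 : 0 < 2 * (`|k| + 1) by rewrite mulr_gt0// ltr_wpDl.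
exists (e / 4 / (2 * (`|k| + 1))); first by rewrite divr_gt0.
move=> t t0; rewrite ler_pdivlMr// => td; rewrite scalerN opprK.
have h1 := sgrp_second_order t0 vh hk.
have h2 := sgrp_sub (ltW t0) (opB vh ug);
  rewrite (sgrp_contraction (ltW t0)).1 in h2.
have -> : sgrp t u - u + t *: g = (sgrp t v - v + t *: h) -
    ((sgrp t v - sgrp t u - (v - u)) + t *: (h - g)).
  by rewrite scalerBr (subrACA (sgrp t v)) opprD addrACA !subKr.
apply: le_trans (ler_normB _ _) _.
have h3 := ler_normD (sgrp t v - sgrp t u - (v - u)) (t *: (h - g)).
have h4 : `|t *: (h - g)| = t * `|h - g| by rewrite normrZ gtr0_norm.
have h5 : t * `|h - g| <= t * (e / 4) by apply: ler_wpM2l => //; exact: ltW.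
have h6 : 2 * t ^+ 2 * `|k| <= t * (e / 4).
  have := normr_ge0 k; nra.
have := mulr_gt0 e0 t0; lra.
Qed.

Lemma sgrp_cont0 f e : 0 < e -> exists2 d, 0 < d & forall t, 0 <= t -> t <= d ->
  `|sgrp t f - f| <= e.
Proof.
move=> e0; have [|u [g [ug fu]]] := A_dense f (e := e / 4); first by lra.
exists (e / 4 / (`|g| + 1)); first by rewrite !divr_gt0// ltr_wpDl.
move=> s s0; rewrite ler_pdivlMr; last by rewrite ltr_wpDl.
move=> sd; have h1 := sgrp_sub s0 ug.
have h2 := contraction_dist f u (sgrp_contraction s0).
have h3 := ler_distV (sgrp s f) (sgrp s u) f;
  have h4 := ler_distV (sgrp s u) u f.
move: h2; rewrite (distrC f); have := normr_ge0 g; nra.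
Qed.

(** For [m = 2 ^ n], replacing [m] products of steps [s / m] and [t / m] by steps [(s + t) / m]
    costs [m] times [s t / m^2] times the norm of [A^2 u], which tends to 0. Density of the domain
    of [A^2] and contractivity do the rest. *)
Lemma sgrp_add s t f : 0 <= s -> 0 <= t -> sgrp (s + t) f = sgrp s (sgrp t f).
Proof.
rewrite le_eqVlt => /predU1P[<-|s0]; first by rewrite add0r sgrp0.
rewrite le_eqVlt => /predU1P[<-|t0]; first by rewrite addr0 sgrp0.
have st0 : 0 < s + t by rewrite addr_gt0.
suff key u g k : A u g -> A g k -> sgrp (s + t) u = sgrp s (sgrp t u).
  apply/eqP; rewrite -subr_eq0; apply/eqP; apply: normV_eps => e e0.
  have [|u [g [k [ug gk uf]]]] := square_dom_dense f (e := e / 2); first by lra.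
  have h1 := contraction_dist f u (sgrp_contraction (ltW st0)).
  have h2 := contraction_dist (sgrp t u) (sgrp t f) (sgrp_contraction (ltW s0)).
  have h3 := contraction_dist u f (sgrp_contraction (ltW t0)).
  have := ler_distV (sgrp (s + t) f) (sgrp (s + t) u) (sgrp s (sgrp t f)).
  rewrite (key _ _ _ ug gk) in h1 *; rewrite (distrC f u) in h1; lra.
move=> ug gk; apply: (eps_cvg_unique (sgrp_cvg u st0)) => e e0.
have e40 : 0 < e / 4 by lra.
have [n1 H1] := sgrp_cvg u t0 e40; have [n2 H2] := sgrp_cvg (sgrp t u) s0 e40.
have [n3 H3] := pow2_small (s * t * `|k|) e40.
exists (maxn n1 (maxn n2 n3)) => n; rewrite !geq_max => /and3P[/H1 h1 /H2 h2
  /H3 h3].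
have p0 := pow2_gt0 n; pose m := (2 ^ n)%N.
have sm : 0 < s / m%:R by rewrite divr_gt0.
have tm : 0 < t / m%:R by rewrite divr_gt0.
have stm : 0 < (s + t) / m%:R by rewrite divr_gt0.
have h4 : `|euler s n (euler t n u) - euler (s + t) n u| <= e / 4.
  rewrite /euler iter_comp => [|f'] ; last exact: resolv_comm.
  have cs := resolv_contraction sm; have ct := resolv_contraction tm.
  have cst := resolv_contraction stm.
  apply: le_trans (telescope_iter _ _ (contraction_comp cs ct) cst _) _.
    by move=> f' /=; rewrite (resolv_comm _ tm stm) (resolv_comm _ sm stm).
  rewrite /= mulrDl; have := resolv_add sm tm ug gk => H.
  apply: le_trans h3; apply: (@le_trans _ _ (m%:R * (s / m%:R * (t / m%:R) *
    `|k|))).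
    exact: ler_wpM2l.
  rewrite le_eqVlt; apply/orP; left; apply/eqP; rewrite -/m.
  by field; exact: lt0r_neq0.
have h5 := contraction_dist (euler t n u) (sgrp t u) (euler_contraction n s0).
have := ler_distV (euler (s + t) n u) (euler s n (euler t n u)) (sgrp s (sgrp t
  u)).
have := ler_distV (euler s n (euler t n u)) (euler s n (sgrp t u)) (sgrp s
  (sgrp t u)).
rewrite (distrC (euler (s + t) n u) (euler s n (euler t n u))); lra.
Qed.

Lemma eps_gen_B T f g f' g' : (forall t u v, 0 <= t ->
  T t (u - v) = T t u - T t v) ->
  eps_gen T f g -> eps_gen T f' g' -> eps_gen T (f - f') (g - g').
Proof.
move=> semigroupB H H' e e0; have e20 : 0 < e / 2 by lra.
have [d1 d10 H1] := H _ e20; have [d2 d20 H2] := H' _ e20.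
exists (Num.min d1 d2); first by rewrite lt_min d10 d20.
move=> t t0; rewrite le_min => /andP[/(H1 _ t0) h1 /(H2 _ t0) h2].
rewrite (semigroupB _ _ _ (ltW t0)) scalerBr (subrACA (T t f)) (subrACA (T t f
  - f)).
apply: le_trans (ler_normB _ _) _; lra.
Qed.

(** That the generator is no larger than [-A] rests on the range condition: [u] solves
    [u + A u = f - g], so the generator maps [w = f - u] to [w] itself. Then [sgrp d w] is close to
    [(1 + d) w], and contractivity forces [w = 0]. *)
Lemma sgrp_gen f g : eps_gen sgrp f g <-> A f (- g).
Proof.
split=> [H|/sgrp_gen_A]; last by rewrite opprK.
have [u [k [uk E1]]] := A_range (f - g) (@ltr01 R).
rewrite scale1r in E1.
have Hw := eps_gen_B (fun t u v h => (sgrp_contraction h).1 u v) H (sgrp_gen_A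
  uk).
have fE : f = u + k + g by rewrite E1 subrK.
have wE : g - - k = f - u by rewrite opprK fE -[u + k + g]addrA [u + _]addrC
  addrK addrC.
rewrite wE in Hw; set w := f - u in Hw.
suff w0 : w = 0.
  have fu : f = u by apply/eqP; rewrite -subr_eq0; apply/eqP.
  have -> : - g = k.
    apply/eqP; rewrite eq_sym -addr_eq0 addrC; apply/eqP.
    by rewrite -[k]opprK wE.
  by rewrite fu.
apply: normV_eps => e e0; have [d d0 H1] := Hw _ e0.
have := H1 _ d0 (lexx d); have := (sgrp_contraction (ltW d0)).2 w.
have E2 : (1 + d) *: w = sgrp d w - (sgrp d w - w - d *: w).
  by rewrite scalerDl scale1r -[sgrp d w - w - _]addrA -opprD subKr.
have : `|(1 + d) *: w| <= `|sgrp d w| + `|sgrp d w - w - d *: w|.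
  by rewrite E2; exact: ler_normB.
rewrite normrZ gtr0_norm ?addr_gt0// => h1 h2 h3.
have : d * `|w| <= d * e by lra.
by rewrite ler_pM2l.
Qed.

Lemma sgrp_cont f e : 0 < e -> exists2 d, 0 < d & forall s t, 0 <= s ->
  0 <= t ->
  `|s - t| <= d -> `|sgrp s f - sgrp t f| <= e.
Proof.
move=> e0; have [d d0 Hd] := sgrp_cont0 f e0; exists d => //.
suff W s t : 0 <= s -> s <= t -> t - s <= d -> `|sgrp s f - sgrp t f| <= e.
  move=> s t s0 t0; case/orP: (le_total s t) => st.
    by rewrite distrC ger0_norm ?subr_ge0//; exact: W.
  by rewrite ger0_norm ?subr_ge0// distrC; exact: W.
move=> s0 st td; have -> : t = s + (t - s) by ring.
have ts0 : 0 <= t - s by lra.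
rewrite sgrp_add// distrC; apply: le_trans (contraction_dist _ _
  (sgrp_contraction s0)) _.
exact: Hd.
Qed.

Lemma sgrp_deriv u g t e : A u g -> 0 < t -> 0 < e -> exists2 d, 0 < d &
  forall h : R, `|h| <= d -> `|sgrp (t + h) u - sgrp t u + h *: sgrp t g| <= e
    * `|h|.
Proof.
move=> ug t0 e0; have e20 : 0 < e / 2 by lra.
have [d1 d10 H1] := sgrp_gen_A ug e20; have [d2 d20 H2] := sgrp_cont g e20.
exists (Num.min (Num.min d1 d2) t); first by rewrite !lt_min d10 d20.
move=> h; rewrite !le_min => /andP[/andP[hd1 hd2] ht].
have {}H1 (k : R) : 0 < k -> k <= d1 -> `|sgrp k u - u + k *: g| <= e / 2 * k.
  by move=> k0 kd; have := H1 _ k0 kd; rewrite scalerN opprK.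
have [h0|h0|->] := ltgtP h 0; last first.
- by rewrite addr0 subrr scale0r addr0 !normr0 mulr0.
- rewrite gtr0_norm// in hd1 hd2 ht *; rewrite (sgrp_add _ (ltW t0) (ltW h0)).
  rewrite -sgrp_Z ?(ltW t0)// -(sgrp_contraction (ltW t0)).1 -sgrp_D ?(ltW
    t0)//.
  apply: le_trans ((sgrp_contraction (ltW t0)).2 _) _.
  by apply: le_trans (H1 _ h0 hd1) _; have := mulr_gt0 e0 h0; lra.
(* For the left derivative, [sgrp (t - k)] is factored out; what remains is the right derivative at
   0 and the continuity of the orbit of [g]. *)
rewrite ltr0_norm// in hd1 hd2 ht *; pose k := - h.
have k0 : 0 < k by rewrite oppr_gt0.
have tk0 : 0 <= t - k by rewrite subr_ge0.
have -> : t + h = t - k by rewrite opprK.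
have -> : h *: sgrp t g = - (k *: sgrp t g) by rewrite -scaleNr opprK.
have -> : sgrp t u = sgrp (t - k) (sgrp k u) by rewrite -sgrp_add ?subrK// ltW.
have -> : sgrp (t - k) u - sgrp (t - k) (sgrp k u) - k *: sgrp t g =
    k *: (sgrp (t - k) g - sgrp t g) - sgrp (t - k) (sgrp k u - u + k *: g).
  rewrite sgrp_D// (sgrp_contraction tk0).1 sgrp_Z// scalerBr opprD opprB.
  by rewrite [RHS]addrC addrA subrK.
apply: le_trans (ler_normB _ _) _.
have h1 := (sgrp_contraction tk0).2 (sgrp k u - u + k *: g).
have h2 := H1 _ k0 hd1.
have h3 : `|sgrp (t - k) g - sgrp t g| <= e / 2.
  apply: H2 => //; first exact: ltW.
  by rewrite addrAC subrr sub0r normrN gtr0_norm.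
rewrite normrZ gtr0_norm//; have : k * `|sgrp (t - k) g - sgrp t g| <=
  k * (e / 2).
  by apply: ler_wpM2l => //; exact: ltW.
rewrite -/k; lra.
Qed.

(** * Uniqueness of the semigroup with generator [-A] *)

Variable T : R -> V -> V.
Hypothesis T_lin : forall t (c : R) u v, 0 <= t ->
  T t (c *: u + v) = c *: T t u + T t v.
Hypothesis T_bounded : forall t, 0 <= t -> exists M : R, forall f,
  `|T t f| <= M * `|f|.
Hypothesis T0 : forall f, T 0 f = f.
Hypothesis T_add : forall s t f, 0 <= s -> 0 <= t -> T (s + t) f = T s (T t f).
Hypothesis T_cont0 : forall f e, 0 < e -> exists2 d, 0 < d &
  forall t, 0 < t -> t <= d -> `|T t f - f| <= e.

Lemma semigroupB t u v : 0 <= t -> T t (u - v) = T t u - T t v.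
Proof.
move=> t0; have -> : u - v = (-1) *: v + u by rewrite scaleN1r addrC.
by rewrite T_lin// scaleN1r addrC.
Qed.

Lemma semigroupZ t c u : 0 <= t -> T t (c *: u) = c *: T t u.
Proof.
move=> t0; have T00 : T t 0 = 0 by have := semigroupB 0 0 t0; rewrite !subrr.
by rewrite -[c *: u]addr0 T_lin// T00 addr0.
Qed.

Lemma semigroup_bounded_pos t : 0 <= t -> exists2 M : R, 0 < M &
  forall f, `|T t f| <= M * `|f|.
Proof.
move=> t0; have [M HM] := T_bounded t0; exists (`|M| + 1);
  first by rewrite ltr_wpDl.
move=> f; apply: le_trans (HM f) _; apply: ler_wpM2r => //.
by apply: le_trans (ler_norm M) _; rewrite lerDl.
Qed.

Lemma semigroup_right_cont f t e : 0 <= t -> 0 < e -> exists2 d, 0 < d &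
  forall h : R, 0 <= h -> h <= d -> `|T (t + h) f - T t f| <= e.
Proof.
move=> t0 e0; have [M M0 HM] := semigroup_bounded_pos t0.
have [d d0 Hd] := T_cont0 f (divr_gt0 e0 M0); exists d => // h.
rewrite le_eqVlt => /predU1P[<- _|h0 hd].
  by rewrite addr0 subrr normr0 ltW.
rewrite T_add// ?(ltW h0)// -semigroupB//; apply: le_trans (HM _) _.
by have := Hd _ h0 hd; rewrite ler_pdivlMr// mulrC.
Qed.

(* A right-continuous function has continuity points in every interval: shrink
  to
   an intersection of nested intervals along which the oscillation tends to 0.
     *)
Lemma semigroup_cont_point f (b : R) : 0 < b -> exists c : R, [/\ 0 < c, c < b &
  forall e, 0 < e -> exists2 d, 0 < d &
    forall x : R, `|x - c| <= d -> `|T x f - T c f| <= e].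
Proof.
move=> b0.
have step (np : nat * (R * R)) : exists p' : R * R,
    0 <= np.2.1 -> np.2.1 < np.2.2 ->
    [/\ np.2.1 < p'.1, p'.1 < p'.2, p'.2 < np.2.2 & forall x y : R,
      p'.1 <= x <= p'.2 -> p'.1 <= y <= p'.2 ->
        `|T x f - T y f| <= np.1.+1%:R^-1].
  case: np => n [a c] /=.
  have : 0 < n.+1%:R^-1 :> R by rewrite invr_gt0.
  move: (n.+1%:R^-1 : R) => et et0.
  have [a0|] := boolP (0 <= a); last by exists (0, 0).
  have [ac|] := boolP (a < c); last by exists (0, 0).
  have n0 : 0 < et / 2 by rewrite divr_gt0.
  have m0 : 0 <= (a + c) / 2 by lra.
  have [d d0 Hd] := semigroup_right_cont f m0 n0.
  (* The next interval runs from [h / 2] to [h] to the right of the midpoint. Right continuity at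
     the midpoint bounds its oscillation, and the factor 4 keeps it strictly inside. *)
  pose h := Num.min d ((c - a) / 4).
  have h0 : 0 < h by rewrite lt_min d0; lra.
  have hd : h <= d by rewrite ge_min lexx.
  have hc : h <= (c - a) / 4 by rewrite ge_min lexx orbT.
  exists ((a + c) / 2 + h / 2, (a + c) / 2 + h) => _ _ /=; split; try lra.
  have key x : (a + c) / 2 + h / 2 <= x <= (a + c) / 2 + h ->
      `|T x f - T ((a + c) / 2) f| <= et / 2.
    move=> /andP[x1 x2]; have -> : x = (a + c) / 2 + (x - (a + c) / 2) by ring.
    by apply: Hd; lra.
  move=> x y /key hx /key hy; have := ler_distV (T x f) (T ((a + c) / 2) f) (T
    y f).
  by move: hy; rewrite (distrC (T y f) (T _ f)); lra.
have [nxt Hnxt] := choice step.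
pose I := fix I n : R * R := if n is m.+1 then nxt (m, I m) else (0, b).
have I0 n : 0 <= (I n).1 /\ (I n).1 < (I n).2.
  elim: n => [|n [IH1 IH2]] //=.
  have [h1 h2 _ _] := Hnxt (n, I n) IH1 IH2; split => //.
  by apply: le_trans IH1 _; exact: ltW.
have IS n : [/\ (I n).1 < (I n.+1).1, (I n.+1).2 < (I n).2 & forall x y : R,
      (I n.+1).1 <= x <= (I n.+1).2 -> (I n.+1).1 <= y <= (I n.+1).2 ->
      `|T x f - T y f| <= n.+1%:R^-1].
  by have [? ?] := I0 n; have [] := Hnxt (n, I n).
have Imono n m : (n <= m)%N -> (I n).1 <= (I m).1 /\ (I m).2 <= (I n).2.
  move=> /subnKC <-; elim: (m - n)%N => [|k [h1 h2]]; rewrite ?addn0// addnS.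
  have [g1 g2 _] := IS (n + k)%N; split; first exact: le_trans h1 (ltW g1).
  exact: le_trans (ltW g2) h2.
have Icross n m : (I n).1 <= (I m).2.
  have [h1 _] := Imono n (maxn n m) (leq_maxl _ _).
  have [_ h2] := Imono m (maxn n m) (leq_maxr _ _).
  by have [_ h3] := I0 (maxn n m); lra.
pose c := sup (range (fun n => (I n).1)).
have ub : has_ubound (range (fun n => (I n).1)) by exists b => _ [n _ <-];
  exact: (Icross n 0%N).
have c1 n : (I n).1 <= c by apply: ub_le_sup => //; exists n.
have c2 n : c <= (I n).2.
  by apply: ge_sup; [exists (I 0%N).1, 0%N|move=> _ [m _ <-]; exact: Icross].
have c1' n : (I n).1 < c by have [h _ _] := IS n; exact: lt_le_trans h (c1 _).
have c2' n : c < (I n).2 by have [_ h _] := IS n; exact: le_lt_trans (c2 _) h.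
exists c; split; [exact: (c1' 0%N)|exact: (c2' 0%N)|] => e e0.
pose n := Num.truncn e^-1.
have ne : n.+1%:R^-1 <= e.
  by rewrite invf_ple ?posrE//; exact: ltW (Num.Theory.truncnS_gt _).
pose d := Num.min (c - (I n.+1).1) ((I n.+1).2 - c).
exists d; first by rewrite lt_min !subr_gt0 c1' c2'.
move=> x; rewrite ler_norml => /andP[h1 h2].
have d1 : d <= c - (I n.+1).1 by rewrite ge_min lexx.
have d2 : d <= (I n.+1).2 - c by rewrite ge_min lexx orbT.
have [_ _ H] := IS n; apply: le_trans ne; apply: H.
  by apply/andP; split; lra.
by rewrite c1 c2.
Qed.

(** With a continuity point [c < t], the difference [T (t - h) f - T t f] is the image of
    [T (c - h) f - T c f] under the single bounded operator [T (t - c)]. *)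
Lemma semigroup_left_cont f t e : 0 < t -> 0 < e -> exists2 d, 0 < d &
  forall h : R, 0 <= h -> h <= d -> h <= t -> `|T (t - h) f - T t f| <= e.
Proof.
move=> t0 e0; have [c [c0 ct Hc]] := semigroup_cont_point f t0.
have r0 : 0 <= t - c by lra.
have [M M0 HM] := semigroup_bounded_pos r0;
  have [d d0 Hd] := Hc _ (divr_gt0 e0 M0).
exists (Num.min d c); first by rewrite lt_min d0.
move=> h h0; rewrite le_min => /andP[hd hc] _.
have -> : t - h = (t - c) + (c - h) by ring.
have -> : T t f = T (t - c) (T c f) by rewrite -T_add ?subrK// ltW.
rewrite (T_add f r0 (_ : 0 <= c - h)) ?subr_ge0// -semigroupB//.
apply: le_trans (HM _) _; rewrite mulrC -ler_pdivlMr//; apply: Hd.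
by rewrite addrAC subrr sub0r normrN ger0_norm.
Qed.

Hypothesis T_gen : forall f g, eps_gen T f g <-> A f (- g).

Lemma semigroup_eps_gen f g t : 0 <= t -> eps_gen T f g ->
  eps_gen T (T t f) (T t g).
Proof.
move=> t0 H e e0; have [M M0 HM] := semigroup_bounded_pos t0.
have [d d0 Hd] := H _ (divr_gt0 e0 M0).
exists d => // h h0 hd.
have -> : T h (T t f) = T t (T h f) by rewrite -!T_add ?(ltW h0)// addrC.
rewrite -semigroupZ// -!semigroupB//; apply: le_trans (HM _) _.
by have := Hd _ h0 hd; rewrite mulrAC ler_pdivlMr// mulrC.
Qed.

(* s |-> S_(t-s) T_s f has right derivative 0 and is left-continuous. *)
Lemma semigroup_unique_gen f g t : 0 <= t -> A f g -> T t f = sgrp t f.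
Proof.
rewrite le_eqVlt => /predU1P[<-|t0] fg; first by rewrite T0 sgrp0.
apply/eqP; rewrite -subr_eq0; apply/eqP.
pose phi s := sgrp (t - s) (T s f).
have -> : T t f - sgrp t f = phi t - phi 0.
  by rewrite /phi subrr sgrp0 subr0 T0.
have Tgen s : 0 <= s -> exists k, A (T s f) k.
  move=> s0; have /(semigroup_eps_gen s0)/T_gen : eps_gen T f (- g)
    by rewrite T_gen opprK.
  by move=> H; eexists; exact: H.
have left s : 0 < s -> s <= t -> forall e, 0 < e -> exists2 d, 0 < d &
    forall h : R, 0 <= h -> h <= d -> h <= s -> `|phi (s - h) - phi s| <= e.
  move=> s0 st e e0; have e20 : 0 < e / 2 by lra.
  have [d1 d10 H1] := semigroup_left_cont f s0 e20.
  have [d2 d20 H2] := sgrp_cont0 (T s f) e20.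
  exists (Num.min d1 d2); first by rewrite lt_min d10 d20.
  move=> h h0; rewrite le_min => /andP[hd1 hd2] hs.
  have ts0 : 0 <= t - s by lra.
  have tsh0 : 0 <= t - (s - h) by lra.
  have E1 : phi s = sgrp (t - s) (T s f) by [].
  apply: le_trans (ler_distV _ (sgrp (t - (s - h)) (T s f)) _) _.
  have h1 := contraction_dist (T (s - h) f) (T s f) (sgrp_contraction tsh0).
  have h2 : `|sgrp (t - (s - h)) (T s f) - phi s| <= e / 2.
    have -> : t - (s - h) = (t - s) + h by ring.
    rewrite sgrp_add// /phi.
    apply: le_trans (contraction_dist _ _ (sgrp_contraction ts0)) _; exact: H2.
  have := H1 _ h0 hd1 hs; rewrite /phi in h2 *; lra.
have right s e : 0 <= s -> s < t -> 0 < e -> exists2 d, 0 < d &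
    forall h : R, 0 < h -> h <= d -> `|phi (s + h) - phi s| <= e * h.
  move=> s0 st e0; have e20 : 0 < e / 2 by lra.
  have [k Hk] := Tgen _ s0.
  have /T_gen : A (T s f) (- - k) by rewrite opprK.
  move=> /(_ _ e20)[d1 d10 H1].
  have [d2 d20 H2] := sgrp_gen_A Hk e20.
  exists (Num.min (Num.min d1 d2) (t - s));
    first by rewrite !lt_min d10 d20 subr_gt0.
  move=> h h0; rewrite !le_min => /andP[/andP[/(H1 _ h0) h1 /(H2 _ h0) h2] hts].
  have ts0 : 0 <= t - (s + h) by lra.
  have -> : phi s = sgrp (t - (s + h)) (sgrp h (T s f)).
    by rewrite /phi -sgrp_add// ?(ltW h0)//; congr (sgrp _ _); ring.
  have Ts : T (s + h) f = T h (T s f) by rewrite addrC T_add// ltW.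
  rewrite /phi Ts.
  apply: le_trans (contraction_dist _ _ (sgrp_contraction ts0)) _.
  (* Both semigroups have the same generator at [T s f], so their first-order terms cancel. *)
  have -> : T h (T s f) - sgrp h (T s f) =
    (T h (T s f) - T s f - h *: - k) - (sgrp h (T s f) - T s f - h *: - k).
    by rewrite subrACA subrr subr0 (subrACA (T h _)) subrr subr0.
  apply: le_trans (ler_normB _ _) _; lra.
apply: normV_eps => e e0; pose e' := e / t;
  have e'0 : 0 < e' by rewrite divr_gt0.
(* Continuous induction: left continuity carries the slope bound [e'] to the supremum [c], and the
   vanishing right derivative carries it beyond [c] unless [c = t]. *)
pose good : set R := [set s | 0 <= s <= t /\
  forall r, 0 <= r <= s -> `|phi r - phi 0| <= e' * r].
have good0 : good 0.
  split; first by rewrite lexx ltW.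
  by move=> r /le_anti <-; rewrite subrr normr0 mulr0.
have ub : has_ubound good by exists t => s [/andP[]].
pose c := sup good.
have c0 : 0 <= c by exact: ub_le_sup.
have ct : c <= t by apply: ge_sup; [exists 0|move=> s [/andP[]]].
have below r : 0 <= r -> r < c -> `|phi r - phi 0| <= e' * r.
  move=> r0 rc; have [s gs rs] : exists2 s, good s & r < s.
    by apply: sup_gt => //; exists 0.
  by case: gs => _; apply; rewrite r0 ltW.
have cgood : `|phi c - phi 0| <= e' * c.
  move: c0; rewrite le_eqVlt => /predU1P[<-|c0].
    by rewrite subrr normr0 mulr0.
  apply/ler_addgt0Pr => d d0; have [d1 d10 H1] := left _ c0 ct _ d0.
  pose h := Num.min d1 c; have h0 : 0 < h by rewrite lt_min d10.
  have hc : h <= c by rewrite ge_min lexx orbT.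
  have hd : h <= d1 by rewrite ge_min lexx.
  have := H1 _ (ltW h0) hd hc; have := ler_distV (phi c) (phi (c - h)) (phi 0).
  rewrite (distrC (phi c) (phi (c - h))).
  have := below (c - h); rewrite subr_ge0 gtrBl => /(_ hc h0).
  have : 0 < e' * h by rewrite mulr_gt0.
  lra.
have [ctE|ctN] := eqVneq c t.
  by move: cgood; rewrite ctE /e' divfK// gt_eqF.
have {}ct : c < t by rewrite lt_neqAle ctN.
have [d d0 Hd] := right _ _ c0 ct e'0.
pose h := Num.min d (t - c); have h0 : 0 < h by rewrite lt_min d0 subr_gt0.
have hd : h <= d by rewrite ge_min lexx.
have hct : h <= t - c by rewrite ge_min lexx orbT.
suff : good (c + h) by move=> /(ub_le_sup ub); rewrite -/c; lra.
split; first by apply/andP; split; lra.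
move=> r /andP[r0 rch]; have [rc|cr] := ltP r c; first exact: below.
move: cr; rewrite le_eqVlt => /predU1P[<- //|cr].
have rc0 : 0 < r - c by lra.
have rcd : r - c <= d by lra.
have := Hd _ rc0 rcd; rewrite (_ : c + (r - c) = r); last by ring.
have := ler_distV (phi r) (phi c) (phi 0); lra.
Qed.

Lemma semigroup_unique f t : 0 <= t -> T t f = sgrp t f.
Proof.
move=> t0; apply/eqP; rewrite -subr_eq0; apply/eqP; apply: normV_eps => e e0.
have [M M0 HM] := semigroup_bounded_pos t0.
have [|u [g [ug uf]]] := A_dense f (e := e / (M + 1));
  first by rewrite divr_gt0// addr_gt0.
have := HM (f - u); rewrite semigroupB// (semigroup_unique_gen t0 ug).
have := contraction_dist u f (sgrp_contraction t0).
have := ler_distV (T t f) (sgrp t u) (sgrp t f).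
move: uf; rewrite ler_pdivlMr ?addr_gt0// (distrC f u).
set B := `|u - f|; nra.
Qed.

End HilleYosida.

Global Opaque sgrp.

(** * The operator H1 and its semigroup on l2 *)

Section L2.
Variables (R : realType) (X : choiceType).
Implicit Types (f g : X -> R) (K L : {fset X}).

Lemma l2P f : l2 f <-> abs_summable (fun x => f x ^+ 2).
Proof. by apply: esum_fin => x; exact: sqr_ge0. Qed.

Lemma abs_summable_mul f g : l2 f -> l2 g -> abs_summable (fun x => f x * g x).
Proof.
move=> /l2P fs /l2P gs; apply: abs_summable_le (abs_summableD fs gs) => x.
rewrite [leRHS]ger0_norm ?addr_ge0 ?sqr_ge0// ler_norml.
have := sqr_ge0 (f x + g x); have := sqr_ge0 (f x - g x).
rewrite !expr2; nra.
Qed.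

Lemma l2_Cc f : Cc f -> l2 f.
Proof.
move=> /CcP[K fK]; apply/l2P; apply: (abs_summable_supp (K := K)) => x /fK ->.
by rewrite expr0n.
Qed.

Lemma l2_lin c f g : l2 f -> l2 g -> l2 (c *: f + g).
Proof.
move=> fl gl; have fg := abs_summable_mul fl gl;
  move: fl gl => /l2P fs /l2P gs; apply/l2P.
have -> : (fun x => (c *: f + g) x ^+ 2) =
    fun x => c ^+ 2 * f x ^+ 2 + (2 * c * (f x * g x) + g x ^+ 2).
  by apply/funext => x; rewrite lincombE; ring.
by apply: abs_summableD; [exact: abs_summableZ|apply: abs_summableD => //;
  exact: abs_summableZ].
Qed.

Lemma l2_si : semi_inner (@l2 R X) (@l2inner R X).
Proof.
split.
- exact/l2_Cc/Cc0.
- exact: l2_lin.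
- move=> c f g k fl gl kl; have fk := abs_summable_mul fl kl;
  have gk := abs_summable_mul gl kl.
  rewrite /l2inner -sumRZ// -sumRD//; last exact: abs_summableZ.
  by congr sumR; apply/funext => x; rewrite lincombE; ring.
- by move=> f g _ _; congr sumR; apply/funext => x; rewrite mulrC.
- move=> f fl; apply: sumR_ge0; first exact: abs_summable_mul.
  by move=> x; rewrite -expr2 sqr_ge0.
Qed.

Lemma fsum_le_l2 f K : l2 f -> \sum_(x <- K) f x ^+ 2 <= l2inner f f.
Proof.
move=> fl; under eq_bigr do rewrite expr2; apply: fsum_le_sumR;
  first exact: abs_summable_mul.
by move=> x; rewrite -expr2 sqr_ge0.
Qed.

Lemma l2norm_sqr f : l2 f -> l2norm f ^+ 2 = l2inner f f.
Proof. by move=> fl; rewrite /l2norm sqr_sqrtr//; exact: (siP l2_si). Qed.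

Lemma l2norm_ge0 f : 0 <= l2norm f. Proof. exact: sqrtr_ge0. Qed.

Lemma l2_pt f x : l2 f -> `|f x| <= l2norm f.
Proof.
move=> fl; apply: ler_of_sqr; rewrite ?sqrtr_ge0//.
rewrite l2norm_sqr// real_normK ?num_real//.
by have := fsum_le_l2 [fset x]%fset fl; rewrite big_seq_fset1.
Qed.

Lemma l2norm_eq0 f : l2 f -> l2norm f = 0 -> f = 0.
Proof.
move=> fl f0; apply/funext => x; apply/eqP; rewrite -normr_le0 -f0.
exact: l2_pt.
Qed.

Lemma l2_le f (M : R) : 0 <= M -> (forall K, \sum_(x <- K) f x ^+ 2 <=
  M ^+ 2) ->
  l2 f /\ l2norm f <= M.
Proof.
move=> M0 HM; have fs : abs_summable (fun x => f x ^+ 2).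
  exists (M ^+ 2) => K; apply: le_trans (HM K).
  by apply: ler_sum => x _; rewrite ger0_norm// sqr_ge0.
have fl : l2 f by apply/l2P.
split => //; apply: ler_of_sqr => //; first exact: l2norm_ge0.
rewrite l2norm_sqr// /l2inner; under eq_fun do rewrite -expr2.
exact: sumR_le_bound.
Qed.

Lemma l2_Fatou (u : nat -> X -> R) f (M : R) (n0 : nat) : 0 <= M ->
  (forall n, l2 (u n)) -> (forall x, u n x @[n --> \oo] --> f x) ->
  (forall n, (n0 <= n)%N -> l2norm (u n) <= M) -> l2 f /\ l2norm f <= M.
Proof.
move=> M0 ul uf uM; apply: l2_le => // K.
have cv : (\sum_(x <- K) u n x ^+ 2) @[n --> \oo] --> \sum_(x <- K) f x ^+ 2.
  by apply: cvg_fsum => x; apply: cvgM; exact: uf.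
apply: (cvgr_to_le cv); exists n0 => // n /= nn0.
apply: le_trans (fsum_le_l2 K (ul n)) _; rewrite -l2norm_sqr//.
by rewrite lerXn2r ?nnegrE ?l2norm_ge0//; exact: uM.
Qed.

(** Fatou applied to [u n - u m] as [m] grows turns the Cauchy bound into a bound on [u n - f]. *)
Lemma l2_cauchy_lim (u : nat -> X -> R) f : (forall n, l2 (u n)) ->
  (forall x, u n x @[n --> \oo] --> f x) ->
  (forall e, 0 < e -> exists n0 : nat, forall m n, (n0 <= m)%N -> (n0 <= n)%N ->
    l2norm (u m - u n) <= e) ->
  l2 f /\ l2norm (u n - f) @[n --> \oo] --> (0 : R).
Proof.
move=> ul uf uc.
have key e : 0 < e -> exists n0 : nat, forall n, (n0 <= n)%N ->
    l2 (u n - f) /\ l2norm (u n - f) <= e.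
  move=> e0; have [n0 Hn] := uc _ e0; exists n0 => n nn0.
  apply: (@l2_Fatou (fun m => u n - u m) _ _ n0); first exact: ltW.
  - by move=> m; exact: (siDB l2_si).
  - by move=> x; apply: cvgB; [exact: cvg_cst|exact: uf].
  - by move=> m mn0; exact: Hn.
split.
  have [n0 /(_ n0 (leqnn _))[dl _]] := key 1 ltr01.
  have -> : f = u n0 - (u n0 - f) by rewrite opprB addrC subrK.
  exact: (siDB l2_si).
apply/cvgn_epsP => e e0; have [n0 Hn] := key _ e0; exists n0 => n nn0.
by rewrite subr0 ger0_norm ?l2norm_ge0//; have [] := Hn _ nn0.
Qed.

Lemma l2_complete (u : nat -> X -> R) : (forall n, l2 (u n)) ->
  (forall e, 0 < e -> exists n0 : nat, forall m n, (n0 <= m)%N -> (n0 <= n)%N ->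
    l2norm (u m - u n) <= e) ->
  exists f, l2 f /\ l2norm (u n - f) @[n --> \oo] --> (0 : R).
Proof.
move=> ul uc; have H x : exists l : R, u n x @[n --> \oo] --> l.
  apply: real_cauchy_cvg => e e0; have [n0 Hn] := uc _ e0.
  exists n0 => m n mn0 nn0; apply: le_trans (Hn _ _ mn0 nn0).
  by apply: (@l2_pt (u m - u n) x); exact: (siDB l2_si).
have [f Hf] := choice H; exists f; exact: l2_cauchy_lim.
Qed.

Lemma l2_dense f e : l2 f -> 0 < e -> exists g, Cc g /\ l2norm (g - f) <= e.
Proof.
move=> fl e0; have fs := abs_summable_mul fl fl.
have e20 : 0 < e ^+ 2 by rewrite exprn_gt0.
have [K HK] := sumR_approx fs e20.
pose g x := if x \in K then f x else 0.
exists g; split; first by apply/CcP; exists K => x /negbTE; rewrite /g => ->.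
have [//||_ H] := @l2_le (g - f) e; [exact: ltW| |exact: H].
move=> L; apply: (@le_trans _ _ (l2inner f f - \sum_(x <- K) f x * f x));
  last first.
  by have := HK _ (fsubset_refl K); rewrite ler_norml -/(l2inner f f); lra.
rewrite lerBrDr.
have -> : \sum_(x <- K) f x * f x = \sum_(x <- (K `|` L)%fset) g x * g x.
  rewrite [RHS](@fsum_supp _ _ K); last exact: fsubsetUl.
    by rewrite !big_seq; apply: eq_bigr => x xK; rewrite /g xK.
  by move=> x /negbTE; rewrite /g => ->; rewrite mul0r.
have fl2 := fsum_le_l2 (K `|` L)%fset fl; apply: le_trans fl2.
apply: (@le_trans _ _ (\sum_(x <- (K `|` L)%fset) (g - f) x ^+ 2 +
    \sum_(x <- (K `|` L)%fset) g x * g x)).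
  rewrite lerD2r; apply: fsum_subset; last exact: fsubsetUr.
  by move=> x; exact: sqr_ge0.
rewrite -big_split/=; apply: ler_sum => x _.
have -> : (g - f) x = g x - f x by [].
by rewrite /g; case: ifP => _; rewrite ?subrr; lra.
Qed.

End L2.

(** * The Hilbert space l2 as a normed module *)

Section L2Type.
Variables (R : realType) (X : choiceType).

Definition l2pred : {pred (X -> R)} := [pred f | `[< l2 f >]].

Lemma l2predP (f : X -> R) : reflect (l2 f) (f \in l2pred).
Proof. exact: asboolP. Qed.

Lemma l2_submod_closed : submod_closed l2pred.
Proof.
split=> [|c f g /l2predP fl /l2predP gl]; first exact/l2predP/l2_Cc/Cc0.
exact/l2predP/l2_lin.
Qed.

HB.instance Definition _ := GRing.isSubmodClosed.Build R (X ->
  R) l2pred l2_submod_closed.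

(** The abstract semigroup theory runs on a normed module, the definitions speak of plain functions;
    [mkL2] and [L2val] are the two directions of the bridge. *)
Record L2 := MkL2 { L2val :> X -> R; _ : L2val \in l2pred }.
HB.instance Definition _ := [isSub for L2val].
HB.instance Definition _ := [Choice of L2 by <:].
HB.instance Definition _ := [SubChoice_isSubLmodule of L2 by <:].

Lemma L2P (f : L2) : l2 f. Proof. by case: f => f /= /l2predP. Qed.

Let nrm (f : L2) := l2norm f.

Let nrmD f g : nrm (f + g) <= nrm f + nrm g.
Proof. by apply: (siN_D (l2_si R X)); exact: L2P. Qed.

Let nrmZ (c : R) f : nrm (c *: f) = `|c| * nrm f.
Proof. by apply: (siN_Z (l2_si R X)); exact: L2P. Qed.

Let nrm0 f : nrm f = 0 -> f = 0.
Proof. by move=> f0; apply/val_inj/l2norm_eq0 => //; exact: L2P. Qed.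

HB.instance Definition _ := Lmodule_isNormed.Build R L2 nrmD nrmZ nrm0.

Definition mkL2 (f : X -> R) (fl : l2 f) : L2 := MkL2 (introT (l2predP f) fl).

Lemma L2normE (f : L2) : `|f| = l2norm f. Proof. by []. Qed.

Lemma L2_complete (u : nat -> L2) : eps_cauchy u -> exists l, eps_cvg u l.
Proof.
move=> uc; have [//|f [fl Hf]] := l2_complete (fun n => L2P (u n)).
exists (mkL2 fl) => e e0; have /cvgn_epsP/(_ _ e0)[n0 Hn] := Hf.
by exists n0 => n nn0; have := Hn _ nn0; rewrite subr0 ger0_norm// sqrtr_ge0.
Qed.

End L2Type.

(** * The closure of the form in l2 and its operator *)

Section FormClosure.
Variables (R : realType) (X : choiceType) (b : X -> X -> R) (q : X -> R).
Hypothesis gb : is_graph b.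
Hypothesis h0 : form_ge0 b q.
Implicit Types (f g : X -> R) (phi : nat -> X -> R) (al : R).

Let lsi := l2_si R X.

Lemma hquad_shift al f : Cc f ->
  hquad b (shiftq q al) f = hquad b q f + al * l2norm f ^+ 2.
Proof. by move=> fC; rewrite /hquad hform_shift// l2norm_sqr//;
  exact: l2_Cc. Qed.

(** The form of [q + al] is [h] plus [al] times the squared l2 norm, so being Cauchy for it means
    being Cauchy for both. With the converse [l2_approx_h_approx], the domain of the closure is the
    completed domain of [q + al]. *)
Lemma h_approx_shift al phi f : 0 < al -> h_approx b (shiftq q al) phi f ->
  l2_approx b q phi f.
Proof.
move=> al0 [fC hC fl].
have qe n m : hquad b (shiftq q al) (phi n - phi m) =
    hquad b q (phi n - phi m) + al * l2norm (phi n - phi m) ^+ 2.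
  exact/hquad_shift/CcB.
have [||ffl fcv] := @l2_cauchy_lim _ _ phi f _ fl; [by move=> n;
  exact: l2_Cc| |].
  move=> e e0; have [|n0 Hn] := hC (al * e ^+ 2);
    first by rewrite mulr_gt0 ?exprn_gt0.
  exists n0 => m n mn0 nn0; have := Hn _ _ mn0 nn0; rewrite qe => H.
  apply: ler_of_sqr; [exact: l2norm_ge0|exact: ltW|].
  have : al * l2norm (phi m - phi n) ^+ 2 <= al * e ^+ 2.
    by have := h0 (CcB (fC m) (fC n)); lra.
  by rewrite ler_pM2l.
split => // e e0; have [n0 Hn] := hC _ e0; exists n0 => m n mn0 nn0.
apply: le_lt_trans (Hn _ _ mn0 nn0); rewrite qe lerDl.
by rewrite mulr_ge0 ?sqr_ge0// ltW.
Qed.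

Lemma l2_approx_pt phi f x : l2_approx b q phi f ->
  phi n x @[n --> \oo] --> f x.
Proof.
move=> [fl fC _ cv]; apply/cvgn_epsP => e e0;
  have /cvgn_epsP/(_ _ e0)[n0 Hn] := cv.
exists n0 => n nn0; apply: le_trans (_ : l2norm (phi n - f) <= e).
  by apply: (@l2_pt _ _ (phi n - f) x); apply: (siDB lsi) => //; exact: l2_Cc.
by have := Hn _ nn0; rewrite subr0 ger0_norm// l2norm_ge0.
Qed.

Lemma l2_approx_h_approx al phi f : 0 < al -> l2_approx b q phi f ->
  h_approx b (shiftq q al) phi f.
Proof.
move=> al0 Hf; have [fl fC hC cv] := Hf; split => //; last first.
  by move=> x; exact: l2_approx_pt.
move=> e e0; have e20 : 0 < e / 2 by lra.
have [n1 H1] := hC _ e20.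
(* Chosen so that [al * (d + d) ^+ 2 = e / 4], the share of the l2 part. *)
pose d := Num.sqrt (e / 4 / al) / 2.
have s0 : 0 < e / 4 / al by rewrite !divr_gt0.
have d0 : 0 < d by rewrite divr_gt0// sqrtr_gt0.
have /cvgn_epsP/(_ _ d0)[n2 H2] := cv.
exists (maxn n1 n2) => m n; rewrite !geq_max => /andP[m1 m2] /andP[k1 k2].
have -> : hquad b (shiftq q al) (phi m - phi n) =
    hquad b q (phi m - phi n) + al * l2norm (phi m - phi n) ^+ 2.
  exact/hquad_shift/CcB.
have := H1 _ _ m1 k1; have := H2 _ m2; have := H2 _ k2.
rewrite !subr0 !ger0_norm ?l2norm_ge0// => g1 g2 g3.
have lf n' := l2_Cc (fC n').
have g4 : l2norm (phi m - phi n) <= d + d.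
  apply: le_trans (siN_B lsi (lf m) fl (lf n)) _.
  by rewrite [X in _ + X](siN_sym lsi fl (lf n)); exact: lerD.
have g5 : l2norm (phi m - phi n) ^+ 2 <= e / 4 / al.
  apply: le_trans (_ : (d + d) ^+ 2 <= _).
    by rewrite lerXn2r ?nnegrE ?l2norm_ge0//; lra.
  have -> : d + d = Num.sqrt (e / 4 / al) by rewrite /d; field.
  by rewrite sqr_sqrtr// ltW.
have : al * l2norm (phi m - phi n) ^+ 2 <= al * (e / 4 / al).
  by apply: ler_wpM2l => //; exact: ltW.
rewrite [al * (_ / al)]mulrC divfK ?gt_eqF//; lra.
Qed.

Section WithShift.
Variable al : R.
Hypothesis al0 : 0 < al.
Local Notation qa := (shiftq q al).
Local Notation D := (form_dom b qa).
Local Notation a := (form_ext b qa).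

Let ca := coercive_shift gb h0 al0.
Let asi : semi_inner D a. Proof. exact: (form_ext_si gb ca). Qed.

(** The closure of [h], recovered from the completed form of [q + al]; by [closure_formE] its values
    on the domain are the same for every [al > 0]. *)
Definition cform f g := a f g - al * l2inner f g.

Lemma closure_domE f : closure_dom b q f <-> D f.
Proof.
by split=> -[phi Hf]; exists phi; [exact: l2_approx_h_approx|exact:
  h_approx_shift Hf].
Qed.

Lemma D_l2 f : D f -> l2 f.
Proof. by move=> [phi /(h_approx_shift al0)[]]. Qed.

Lemma l2_approx_inner phi f g : l2_approx b q phi f -> l2 g ->
  l2inner (phi n) g @[n --> \oo] --> l2inner f g.
Proof.
move=> [fl fC _ cv] gl; apply/cvgn_epsP => e e0.
have g0 : 0 < l2norm g + 1 by rewrite ltr_wpDl// l2norm_ge0.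
have /cvgn_epsP/(_ _ (divr_gt0 e0 g0))[n0 Hn] := cv; exists n0 => n nn0.
have pl := l2_Cc (fC n); rewrite -(siBB lsi)//.
apply: le_trans (siN_CS lsi (siDB lsi pl fl) gl) _.
have := Hn _ nn0; rewrite subr0 ger0_norm ?l2norm_ge0// ler_pdivlMr//.
apply: le_trans; apply: ler_wpM2l; first exact: l2norm_ge0.
by rewrite lerDl.
Qed.

Lemma l2_approx_norm phi f : l2_approx b q phi f ->
  l2inner (phi n) (phi n) @[n --> \oo] --> l2inner f f.
Proof.
move=> [fl fC _ cv]; have -> : l2inner f f = l2norm f * l2norm f.
  by rewrite -expr2 l2norm_sqr.
have pl n := l2_Cc (fC n).
under eq_fun do rewrite -l2norm_sqr// expr2.
suff : l2norm (phi n) @[n --> \oo] --> l2norm f by move=> H; exact: cvgM.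
apply/cvgn_epsP => e e0; have /cvgn_epsP/(_ _ e0)[n0 Hn] := cv;
  exists n0 => n nn0.
apply: le_trans (siN_dist lsi (pl n) fl) _.
by have := Hn _ nn0; rewrite subr0 ger0_norm// l2norm_ge0.
Qed.

Lemma quad_ext_l2 f : D f -> quad_ext b q (l2_approx b q) f = cform f f.
Proof.
move=> [psi Hpsi]; rewrite /quad_ext.
case: xgetP => [phi _ Hphi|H]; last by exfalso; apply: (H psi);
  exact: h_approx_shift Hpsi.
have [fl fC _ cv] := Hphi; apply/cvg_lim => //.
have E n : hquad b q (phi n) = hquad b qa (phi n) - al * l2inner (phi n) (phi
  n).
  by rewrite hquad_shift// l2norm_sqr ?addrK//; exact: l2_Cc.
under eq_fun do rewrite E.
have Hp := l2_approx_h_approx al0 Hphi.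
apply: cvgB; first exact: (form_extP gb ca Hp Hp).
by apply: cvgM; [exact: cvg_cst|exact: l2_approx_norm].
Qed.

Lemma cform_si : semi_inner D cform.
Proof.
split.
- exact: (si0 asi).
- exact: (siL asi).
- move=> c f g k fD gD kD; have fl := D_l2 fD; have gl := D_l2 gD;
  have kl := D_l2 kD.
  rewrite /cform (siB asi c fD gD kD) (siB lsi c fl gl kl).
  by move: (a f k) (a g k) (l2inner f k) (l2inner g k) => A B C E; ring.
- move=> f g fD gD; have fl := D_l2 fD; have gl := D_l2 gD.
  by rewrite /cform (siS asi fD gD) (siS lsi fl gl).
- move=> f [phi Hp]; have Hl := h_approx_shift al0 Hp; have [fl fC _ _] := Hl.
  have cv : hquad b q (phi n) @[n --> \oo] --> cform f f.
    have E n : hquad b q (phi n) = hquad b qa (phi n) - al * l2inner (phi n)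
      (phi n).
      by rewrite hquad_shift// l2norm_sqr ?addrK//; exact: l2_Cc.
    under eq_fun do rewrite E.
    apply: cvgB; first exact: (form_extP gb ca Hp Hp).
    by apply: cvgM; [exact: cvg_cst|exact: l2_approx_norm].
  by apply: (cvgr_to_ge cv); apply: nearW => n; exact: h0.
Qed.

Lemma closure_formE f g : D f -> D g -> closure_form b q f g = cform f g.
Proof.
move=> fD gD; rewrite /closure_form /polarize.
rewrite !quad_ext_l2; [|exact: (siDB asi)|exact: (siDD asi)].
rewrite (siQD cform_si fD gD) (siQB cform_si fD gD).
by move: (cform f f) (cform f g) (cform g g) => A B C; lra.
Qed.

(** Testing against indicators turns the weak definition of [H1] into the formal operator.
    Conversely, the weak identity holds for finitely supported test functions by Green's formula and
    extends to the form domain by approximation. *)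
Lemma H1E f g : H1 b q f g <-> [/\ D f, l2 g & forall z, Hop b q f z = g z].
Proof.
have Hsh f' z : D f' -> Hop b qa f' z = Hop b q f' z + al * f' z.
  by move=> fD; apply: Hop_shift => //; exact: (form_dom_Fdom gb ca fD).
split=> [[/closure_domE fD gl Hf]|[fD gl Hf]].
  split => // z; have oD : D \1_[set z] by apply: form_dom_Cc => //;
    exact: Cc_one.
  have /CcP[L zL] := Cc_one R z.
  have := Hf _ ((closure_domE _).2 oD); rewrite closure_formE// /cform.
  rewrite (form_ext_test gb ca fD zL).
  have one_sum (F : X -> R) : \sum_(x <- L) \1_[set z] x * F x = F z.
    have [zL'|zL'] := boolP (z \in L).
      rewrite (big_fsetD1 _ zL')/= indic1E eqxx mul1r big1_seq ?addr0// => y /=.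
      by rewrite !inE indic1E => /andP[/negbTE -> _]; rewrite mul0r.
    by have := zL _ zL'; rewrite indic1E eqxx => /eqP; rewrite oner_eq0.
  have inner_one (F : X -> R) : l2inner F \1_[set z] = F z.
    rewrite /l2inner (@sumR_supp _ _ L); last by move=> x /zL ->; rewrite mulr0.
    by rewrite -[RHS](one_sum F); apply: eq_bigr => x _; rewrite mulrC.
  by rewrite one_sum !inner_one Hsh// addrK.
split => //; first exact/closure_domE.
move=> psi /closure_domE pD; have pD' := pD; case: pD' => phi Hp.
have Hl := h_approx_shift al0 Hp; have [pl pC _ _] := Hl.
rewrite closure_formE// /cform; apply/eqP; rewrite subr_eq; apply/eqP.
have fl := D_l2 fD.
have E n : a (phi n) f = l2inner (phi n) (al *: f + g).
  have pnD : D (phi n) by exact: form_dom_Cc.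
  have /CcP[L nL] := pC n.
  rewrite (siS asi)// (form_ext_test gb ca fD nL) /l2inner (@sumR_supp _ _ L).
    by apply: eq_bigr => x _; rewrite Hsh// Hf lincombE addrC.
  by move=> x /nL ->; rewrite mul0r.
have sl : l2 (al *: f + g) by exact: l2_lin.
have c1 := form_ext_cvg gb ca Hp fD; have c2 := l2_approx_inner Hl sl.
move: c1; under eq_fun do rewrite E; move=> c1.
rewrite (siS asi)// (cvgn_unique c1 c2) (siBDr lsi) ?(siBZr lsi)//;
  last exact: (siDZ lsi).
by rewrite (siS lsi pl fl) (siS lsi pl gl) addrC.
Qed.

(** With [al = 1 / s] this is the range condition for [1 + s H1]: the equation is
    [(H + al) u = al f], and Cauchy-Schwarz in l2 bounds its right-hand side, as a functional, with
    constant [al * l2inner f f]. Positivity is inherited from the solutions on finite sets. *)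
Lemma H1_range (K : nat -> set X) f : exhaustion K -> l2 f ->
  exists u, [/\ H1 b q u (al *: (f - u)),
    h_approx b qa (fun n => HKinv b qa (K n) (al *: f)) u
    & (forall x, 0 <= f x) -> forall x, 0 <= u x].
Proof.
move=> Kex fl.
have [L g gL|u [Hu HH]] := Galerkin (f := al *: f) (M :=
  al * l2inner f f) gb ca Kex.
  have gC : Cc g by apply/CcP; exists L.
  have gl := l2_Cc gC.
  have -> : \sum_(x <- L) (al *: f) x * g x = al * l2inner f g.
    rewrite /l2inner (@sumR_supp _ _ L); last by move=> x /gL ->; rewrite mulr0.
    by rewrite mulr_sumr; apply: eq_bigr => x _; rewrite scalefctE mulrA.
  rewrite exprMn hquad_shift// l2norm_sqr// expr2 -!mulrA.
  apply: ler_wpM2l; first exact: ltW.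
  apply: (@le_trans _ _ (al * (l2inner f f * l2inner g g))).
    apply: ler_wpM2l; first exact: ltW.
    exact: siCS lsi _ _ _ _.
  rewrite mulrCA; apply: ler_wpM2l; first exact: (siP lsi).
  by rewrite lerDr; exact: h0.
have uD : D u by eexists; exact: Hu.
have ul := D_l2 uD; exists u; split => //.
  apply/H1E; split => //; first exact/(siDZ lsi)/(siDB lsi).
  move=> z; have := HH z; rewrite Hop_shift//;
    last exact: (form_dom_Fdom gb ca uD).
  by rewrite !scalefctE => E; have -> : (f - u) z = f z - u z by []; lra.
move=> f0 x; have [_ _ /(_ x) cv] := Hu; have [Kf _ _] := Kex.
apply: (cvgr_to_ge cv); apply: nearW => n.
by apply: (HKinv_ge0 gb ca) => // z; rewrite scalefctE mulr_ge0// ltW.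
Qed.

End WithShift.
End FormClosure.

Section SidedLimits.
Variable R : realType.
Implicit Types F : R -> R.

Lemma cvg_at_right0P F l : F t @[t --> 0^'+] --> l <->
  forall e, 0 < e -> exists2 d : R, 0 < d & forall t, 0 < t -> t <= d ->
    `|F t - l| <= e.
Proof.
split=> [/cvgrPdist_le H e e0|H].
  have := H _ e0; rewrite near_withinE => /nbhs_normP[d /= d0 Hd].
  exists (d / 2); first by rewrite divr_gt0.
  move=> t t0 td; rewrite distrC; apply: Hd => //=.
  by rewrite sub0r normrN gtr0_norm//; lra.
apply/cvgrPdist_le => e e0; have [d d0 Hd] := H _ e0.
rewrite near_withinE; apply/nbhs_normP; exists d => // t /=.
rewrite sub0r normrN => td t0; rewrite distrC; apply: Hd => //.
by rewrite gtr0_norm// in td; exact: ltW.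
Qed.

Lemma cvg_at_left0 F l :
  (forall e, 0 < e -> exists2 d : R, 0 < d & forall t, 0 < t -> t <= d ->
    `|F (- t) - l| <= e) -> F t @[t --> 0^'-] --> l.
Proof.
move=> H; apply/cvgrPdist_le => e e0; have [d d0 Hd] := H _ e0.
rewrite near_withinE; apply/nbhs_normP; exists d => // t /=.
rewrite sub0r normrN => td t0; rewrite distrC -[t]opprK; apply: Hd.
  by rewrite oppr_gt0.
by rewrite ltr0_norm// in td; exact: ltW.
Qed.

End SidedLimits.

(** * The semigroup generated by [- H1] on l2 *)

Section HeatSemigroup.
Variables (R : realType) (X : choiceType) (b : X -> X -> R) (q : X -> R).
Hypothesis gb : is_graph b.
Hypothesis h0 : form_ge0 b q.
Variable K : nat -> set X.
Hypothesis Kex : exhaustion K.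
Implicit Types (f g u v : X -> R) (F G U W : L2 R X) (s t e : R).

Let lsi := l2_si R X.

Definition H1L2 U G : Prop := H1 b q U G.

Lemma H1L2_lin (c : R) U G W F : H1L2 U G -> H1L2 W F ->
  H1L2 (c *: U + W) (c *: G + F).
Proof.
have c1 := coercive_shift gb h0 (@ltr01 R).
move=> /(H1E gb h0 ltr01)[UD Gl UG] /(H1E gb h0 ltr01)[WD Fl WF].
apply/(H1E gb h0 ltr01); split.
- exact: (siL (form_ext_si gb c1)).
- exact: (siL lsi).
- move=> z; have uF := form_dom_Fdom gb c1 UD;
  have wF := form_dom_Fdom gb c1 WD.
  have := HopL q gb c z uF wF; rewrite UG WF; exact.
Qed.

Lemma H1_ge0 f g : H1 b q f g -> 0 <= l2inner g f.
Proof.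
move=> fg; have [fD gl _] := fg; have [fD1 _ _] := (H1E gb h0 ltr01 f g).1 fg.
have [_ _ /(_ _ fD)] := fg; rewrite (closure_formE gb h0 ltr01)// => <-.
exact: (siP (cform_si gb h0 ltr01)).
Qed.

Lemma H1L2_accretive s U G : 0 < s -> H1L2 U G -> `|U| <= `|U + s *: G|.
Proof.
move=> s0 UG; have ge := H1_ge0 UG.
have Ul := L2P U; have Gl := L2P G; have sl := L2P (U + s *: G).
have [->|u0] := eqVneq U 0; first by rewrite normr0.
have {}u0 : 0 < `|U| by rewrite normr_gt0.
rewrite -(ler_pM2r u0); apply: (@le_trans _ _ (l2inner (U + s *: G) U)).
  have -> : `|U| * `|U| = l2inner U U by rewrite -expr2 L2normE l2norm_sqr.
  have -> : l2inner (U + s *: G) U = l2inner (U : X -> R) U + s * l2inner G U.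
    rewrite -[LHS]/(l2inner ((U : X -> R) + s *: (G : X -> R)) U).
    by rewrite (siBD lsi)// ?(siBZ lsi)//; exact: (siDZ lsi).
  by rewrite lerDl mulr_ge0// ltW.
exact: le_trans (ler_norm _) (siN_CS lsi sl Ul).
Qed.

Lemma H1L2_range s F : 0 < s -> exists U G, H1L2 U G /\ U + s *: G = F.
Proof.
move=> s0; have al0 : 0 < s^-1 by rewrite invr_gt0.
have [u [Hu _ _]] := H1_range gb h0 al0 Kex (L2P F).
have [/(closure_domE gb h0 al0)/(D_l2 gb h0 al0) ul gl _] := Hu.
exists (mkL2 ul), (mkL2 gl); split => //; apply/val_inj/funext => x /=.
change (u x + s * (s^-1 * (F x - u x)) = F x).
by rewrite mulrA mulfV ?gt_eqF// mul1r addrC subrK.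
Qed.

(* With psi = u - phi, the inequality 0 <= h(u - phi/2) yields
   al * ||psi||^2 <= h(phi) / 4. *)
Lemma H1L2_dense F e : 0 < e -> exists U G, H1L2 U G /\ `|U - F| <= e.
Proof.
move=> e0; have [|phi [pC pF]] := l2_dense (L2P F) (e := e / 2);
  first by rewrite divr_gt0.
(* The first summand makes [hquad b q phi / (4 * al)] at most [(e / 2) ^+ 2]; the second keeps [al]
   positive when the energy of [phi] is 0. *)
have hp := h0 pC; pose al := hquad b q phi / e ^+ 2 + 1.
have e20 : 0 < e ^+ 2 by rewrite exprn_gt0.
have al0 : 0 < al by rewrite ltr_wpDl// divr_ge0// ltW.
have pl := l2_Cc pC; have [u [Hu _ _]] := H1_range gb h0 al0 Kex pl.
have csi := cform_si gb h0 al0.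
have [uC gl Hu2] := Hu; have uD := (closure_domE gb h0 al0 u).1 uC.
have ul := D_l2 gb h0 al0 uD.
have pD : form_dom b (shiftq q al) phi by apply: form_dom_Cc => //;
  exact: coercive_shift.
exists (mkL2 ul), (mkL2 gl); split => //; rewrite L2normE.
have Fl := L2P F.
apply: le_trans (siN_B lsi ul pl Fl) _.
suff : l2norm (u - phi) <= e / 2 by move=> H; apply: le_trans (lerD H pF) _;
  lra.
have psiD := siDB csi uD pD; have psil := siDB lsi ul pl.
have h2D := siDZ csi 2^-1 pD.
have c1 : cform b q al u (u - phi) = - (al * l2norm (u - phi) ^+ 2).
  rewrite -(closure_formE gb h0 al0)// Hu2; last exact/(closure_domE gb h0 al0).
  rewrite -(opprB u) scalerN (siBN lsi)//; last exact: (siDZ lsi).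
  by rewrite (siBZ lsi)// l2norm_sqr.
have c2 : cform b q al phi phi = hquad b q phi.
  rewrite /cform (form_ext_Cc gb (coercive_shift gb h0 al0))// hform_shift//.
  by rewrite addrK.
have := siP csi (siDB csi uD h2D).
rewrite (siQB csi uD h2D) (siBZr csi _ pD uD) (siQZ csi _ pD) c2.
move: c1; rewrite (siBBr csi uD pD uD).
set A := cform _ _ _ _ _; set B := cform _ _ _ _ _; set N := l2norm _ => c1 ge.
apply: ler_of_sqr; [exact: l2norm_ge0|by rewrite ltW// divr_gt0|].
rewrite -/N -(ler_pM2l al0).
have -> : al * (e / 2) ^+ 2 = (hquad b q phi + e ^+ 2) / 4.
  by rewrite /al; field; rewrite gt_eqF.
have : 2^-1 ^+ 2 * hquad b q phi = hquad b q phi / 4 by field.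
lra.
Qed.

Definition heat := sgrp H1L2.

Let lin := H1L2_lin.
Let acc := H1L2_accretive.
Let rng := H1L2_range.
Let dns := H1L2_dense.
Let cpl := @L2_complete R X.

(** [C0_semigroup] is about maps on all functions; outside l2 the value [f] is a default. *)
Definition heat_fun t f : X -> R :=
  match pselect (l2 f) with left fl => L2val (heat t (mkL2 fl)) | right _ => f
    end.

Lemma heat_funE t F : heat_fun t F = heat t F.
Proof.
rewrite /heat_fun; case: pselect => [fl|]; last by have := L2P F.
by congr (L2val (heat t _)); apply/val_inj.
Qed.

Lemma heat_l2 t f : l2 f -> l2 (heat_fun t f).
Proof. by move=> fl; rewrite (heat_funE t (mkL2 fl)); exact: L2P. Qed.

Lemma eps_gen_generator (T : R -> (X -> R) -> X -> R) (TL : R -> L2 R X ->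
  L2 R X)
  F G : (forall t F, 0 <= t -> L2val (TL t F) = T t F) ->
  eps_gen TL F G <-> generator T F G.
Proof.
move=> TE.
have key t : 0 < t -> l2norm (fun x => (T t F x - F x) / t - G x) =
    t^-1 * `|TL t F - F - t *: G|.
  move=> t0; transitivity `|t^-1 *: (TL t F - F - t *: G)|; last first.
    by rewrite normrZ gtr0_norm ?invr_gt0.
  rewrite L2normE; congr l2norm.
  apply/funext => x; rewrite -(TE _ _ (ltW t0)).
  change ((TL t F x - F x) / t - G x = t^-1 * (TL t F x - F x - t * G x)).
  by field; rewrite gt_eqF.
have eqv t e : 0 < t -> (`|TL t F - F - t *: G| <= e * t) =
    (`|l2norm (fun x => (T t F x - F x) / t - G x) - 0| <= e).
  move=> t0; rewrite subr0 ger0_norm ?l2norm_ge0// key//.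
  by rewrite ler_pdivrMl// mulrC.
split=> [H|[_ _ H]].
  split; [exact: L2P|exact: L2P|]; apply/cvg_at_right0P => e e0.
  by have [d d0 Hd] := H _ e0; exists d => // t t0 td; rewrite -eqv//;
    exact: Hd.
move=> e e0; have /cvg_at_right0P/(_ _ e0)[d d0 Hd] := H.
by exists d => // t t0 td; rewrite eqv//; exact: Hd.
Qed.

Lemma heat_C0 : C0_semigroup heat_fun.
Proof.
have Sc t (t0 : 0 <= t) := sgrp_contraction cpl lin acc rng dns t0.
split.
- by move=> t f _; exact: heat_l2.
- move=> t c f g t0 fl gl.
  have -> : (fun x => c * f x + g x) = (c *: mkL2 fl + mkL2 gl : L2 R X) by [].
  rewrite heat_funE (heat_funE t (mkL2 fl)) (heat_funE t (mkL2 gl)) /heat.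
  by rewrite (sgrp_D cpl lin acc rng dns)// (sgrp_Z cpl lin acc rng dns).
- move=> t t0; exists 1 => f fl; rewrite mul1r (heat_funE t (mkL2 fl)).
  exact: (Sc _ t0).2.
- by move=> f fl; rewrite (heat_funE 0 (mkL2 fl)) /heat sgrp0.
- move=> s t f s0 t0 fl; rewrite (heat_funE (s + t) (mkL2 fl)) (heat_funE t
  (mkL2 fl)).
  by rewrite heat_funE /heat (sgrp_add cpl lin acc rng dns).
- move=> f fl; apply/cvg_at_right0P => e e0.
  have [d d0 Hd] := sgrp_cont0 cpl lin acc rng dns (mkL2 fl) e0.
  exists d => // t t0 td; rewrite subr0 ger0_norm ?l2norm_ge0//.
  by rewrite (heat_funE t (mkL2 fl)); have := Hd _ (ltW t0) td.
Qed.

Lemma heat_generator f g : generator heat_fun f g <-> H1 b q f (- g).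
Proof.
have H F G : generator heat_fun F G <-> H1 b q F (- (G : X -> R)).
  rewrite -(@eps_gen_generator heat_fun heat) => [|t W _];
    last by rewrite heat_funE.
  by rewrite (sgrp_gen cpl lin acc rng dns).
split=> [gfg|hfg].
  have [fl gl _] := gfg; exact: (H (mkL2 fl) (mkL2 gl)).1.
have [fc ngl _] := hfg.
have fl := D_l2 gb h0 ltr01 ((closure_domE gb h0 ltr01 f).1 fc).
have gl : l2 g by rewrite -[g]opprK; exact: (siDN lsi).
exact: (H (mkL2 fl) (mkL2 gl)).2.
Qed.

Lemma exp_semigroupE t F : 0 <= t -> exp_semigroup (H1 b q) t F = heat t F.
Proof.
move=> t0; rewrite /exp_semigroup.
case: xgetP => [T _ [TC Tgen]|H]; last first.
  by exfalso; apply: (H heat_fun); split;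
    [exact: heat_C0|exact: heat_generator].
(* The chosen [T] becomes a map on [L2], with the identity as default for [s < 0]. *)
pose TL s G : L2 R X := match pselect (0 <= s) with
  | left s0 => mkL2 (C0_l2 TC s0 (L2P G)) | right _ => G end.
have TLE s G : 0 <= s -> L2val (TL s G) = T s G.
  by move=> s0; rewrite /TL; case: pselect.
rewrite -TLE//; congr L2val.
apply: (semigroup_unique cpl lin acc rng dns (T := TL)) => //.
- move=> s c U W s0; apply/val_inj; rewrite /= TLE//.
  change (T s (fun x => c * U x + W x) = (fun x => c * TL s U x + TL s W x)).
  by rewrite (C0_linear TC)//; [rewrite !TLE//|exact: L2P|exact: L2P].
- move=> s s0; have [M HM] := C0_bounded TC s0; exists M => G.
  by rewrite L2normE TLE//; apply: HM; exact: L2P.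
- by move=> G; apply/val_inj; rewrite /= TLE// (C0_zero TC)//; exact: L2P.
- move=> s r G s0 r0; apply/val_inj; rewrite /= !TLE ?addr_ge0//.
  by rewrite (C0_add TC)//; exact: L2P.
- move=> G e e0; have /cvg_at_right0P/(_ _ e0)[d d0 Hd] :=
  C0_continuous TC (L2P G).
  exists d => // s s0 sd; have := Hd _ s0 sd;
    rewrite subr0 ger0_norm ?l2norm_ge0//.
  by rewrite -(TLE _ _ (ltW s0)).
- move=> U W; rewrite (eps_gen_generator _ _ TLE); exact: Tgen.
Qed.

(** Positivity belongs to the resolvents; it passes to the Euler products and, as the l2 norm
    controls point values, to their limit. *)
Lemma heat_ge0 t F : 0 <= t -> (forall x, 0 <= F x) ->
  forall x, 0 <= heat t F x.
Proof.
rewrite le_eqVlt => /predU1P[<-|t0] F0 x; first by rewrite /heat sgrp0.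
have Jpos s U : 0 < s -> (forall x, 0 <= U x) ->
  forall x, 0 <= resolv H1L2 s U x.
  move=> s0 U0 y; have al0 : 0 < s^-1 by rewrite invr_gt0.
  have [u [Hu _ /(_ U0) u0]] := H1_range gb h0 al0 Kex (L2P U).
  have [/(closure_domE gb h0 al0)/(D_l2 gb h0 al0) ul gl _] := Hu.
  have uE : mkL2 ul + s *: mkL2 gl = U.
    apply/val_inj/funext => z /=.
    change (u z + s * (s^-1 * (U z - u z)) = U z).
    by rewrite mulrA mulfV ?gt_eqF// mul1r addrC subrK.
  have := @resolv_eq _ _ _ lin acc rng s (mkL2 ul) (mkL2 gl) s0 Hu.
  by rewrite uE => ->; exact: u0.
have Epos n y : 0 <= euler H1L2 t n F y.
  have s0 : 0 < t / (2 ^ n)%:R by rewrite divr_gt0// pow2_gt0.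
  rewrite /euler; move: (t / _) s0 => s s0.
  by elim: (2 ^ n)%N y => [|m IH] y; [exact: F0|rewrite iterS; exact: Jpos].
apply/ler_addgt0Pr => e e0.
have [n0 Hn] := sgrp_cvg cpl lin acc rng dns F t0 e0.
have := Hn _ (leqnn n0); have := Epos n0 x.
rewrite L2normE => E1 E2; have := @l2_pt _ _ (euler H1L2 t n0 F - heat t F : L2
  R X) x (L2P _).
have -> : (euler H1L2 t n0 F - heat t F : L2 R X) x =
  euler H1L2 t n0 F x - heat t F x by [].
move=> E3; have := le_trans E3 E2; rewrite ler_norml; lra.
Qed.

End HeatSemigroup.

(** * The time integral of the semigroup *)

Lemma diff_quotient_bound (R : realType) (A B C h e : R) : h != 0 ->
  `|B - C + h * A| <= e * `|h| -> `|- A - h^-1 * (B - C)| <= e.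
Proof.
move=> h0 H; have -> : - A - h^-1 * (B - C) =
  - (h^-1 * (B - C + h * A)) by field.
by rewrite normrN normrM normfV mulrC ler_pdivrMr ?normr_gt0.
Qed.

Section GreenIntegral.
Variables (R : realType) (X : choiceType) (b : X -> X -> R) (q : X -> R).
Hypothesis gb : is_graph b.
Hypothesis h0 : form_ge0 b q.
Variable K : nat -> set X.
Hypothesis Kex : exhaustion K.
Implicit Types (f g u v : X -> R) (x y : X) (s t e al : R).

Let lsi := l2_si R X.
Let lin := H1L2_lin gb h0.
Let acc := H1L2_accretive gb h0.
Let rng := H1L2_range gb h0 Kex.
Let dns := H1L2_dense gb h0 Kex.
Let cpl := @L2_complete R X.
Local Notation ht := (heat b q).

Definition resolvent_eq l f u := exists2 g, H1 b q u g &
  forall x, g x - l * u x = f x.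

(** For [al > 0] the form domain of [q + al] lies in l2, so a kernel of [q + al] is a solution in
    the domain of [H1]. *)
Lemma green_resolvent_eq al x g : 0 < al ->
  green b (shiftq q al) x g <-> resolvent_eq (- al) \1_[set x] g.
Proof.
move=> al0; have ca := coercive_shift gb h0 al0; split=> [[gD gH]|[g' gg' E]].
  have gF := form_dom_Fdom gb ca gD; have gl := D_l2 gb h0 al0 gD.
  exists (\1_[set x] - al *: g); last first.
    move=> z; have -> : (\1_[set x] - al *: g) z =
      \1_[set x] z - al * g z by [].
    by rewrite mulNr opprK subrK.
  apply/(H1E gb h0 al0); split => //.
    by apply: (siDB lsi); [exact/l2_Cc/Cc_one|exact: (siDZ lsi)].
  move=> z; have := gH z; rewrite Hop_shift// => E.
  have -> : (\1_[set x] - al *: g) z = \1_[set x] z - al * g z by [].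
  by rewrite -E addrK.
have [gD gl gH] := (H1E gb h0 al0 _ _).1 gg'; split => // z.
rewrite Hop_shift//; last exact: (form_dom_Fdom gb ca gD).
by rewrite gH -E mulNr opprK.
Qed.

Lemma resolventE l x g : l < 0 -> green b (shiftq q (- l)) x g ->
  resolvent (H1 b q) l \1_[set x] = g.
Proof.
move=> l0 gg; have al0 : 0 < - l by rewrite oppr_gt0.
have ca := coercive_shift gb h0 al0.
rewrite /resolvent; case: xgetP => [u _ Hu|H].
  apply: (green_unique gb ca _ gg); apply/(green_resolvent_eq _ _ al0).
  by rewrite opprK.
exfalso; apply: (H g); have := (green_resolvent_eq x g al0).1 gg.
by rewrite opprK.
Qed.

Lemma l2_one x : l2 (\1_[set x] : X -> R). Proof. exact/l2_Cc/Cc_one. Qed.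

(** The absolute value makes this continuous on the whole line, as the calculus on the reals
    expects; for [0 <= t] nothing changes. *)
Definition orbit U y t : R := ht `|t| U y.

Lemma L2_pt (U : L2 R X) y : `|U y| <= `|U|.
Proof. by rewrite L2normE; exact: l2_pt (L2P U). Qed.

Lemma L2B_pt (U W : L2 R X) y : `|U y - W y| <= `|U - W|.
Proof. by rewrite L2normE; exact: (@l2_pt _ _ (U - W : L2 R X) y (L2P _)). Qed.

Lemma orbit_cont U y : continuous (orbit U y).
Proof.
move=> t; apply/cvgrPdist_le => e e0.
have [d d0 Hd] := sgrp_cont cpl lin acc rng dns U e0.
apply/nbhs_normP; exists d => // s /= ts.
apply: le_trans (L2B_pt _ _ y) _; apply: Hd => //.
by apply: le_trans (ler_dist_dist _ _) _; exact: ltW.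
Qed.

Lemma orbit_deriv (U W : L2 R X) y t : H1L2 b q U W -> 0 < t ->
  is_derive t (1 : R) (orbit U y) (- orbit W y t).
Proof.
move=> UW t0.
have cv : h^-1 *: ((orbit U y \o shift t) (h *: (1 : R)) - orbit U y t)
    @[h --> (0 : R)^'] --> - orbit W y t.
  apply/cvgrPdist_le => e e0.
  have [d d0 Hd] := sgrp_deriv cpl lin acc rng dns UW t0 e0.
  rewrite near_withinE; apply/nbhs_normP.
  exists (Num.min d t); first by rewrite /= lt_min d0.
  move=> h /=; rewrite sub0r normrN lt_min => /andP[hd hth] hN0.
  have th0 : 0 < t + h by move: hth; rewrite ltr_norml; lra.
  have hn : 0 < `|h| by rewrite normr_gt0.
  have E : h *: (1 : R) + t = t + h by rewrite addrC /GRing.scale/= mulr1.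
  rewrite /shift E /orbit (gtr0_norm t0) (gtr0_norm th0).
  have H1' : `|ht (t + h) U y - ht t U y + h * ht t W y| <= e * `|h|.
    by apply: le_trans (Hd _ (ltW hd)); exact: (L2_pt (ht (t + h) U - ht t U +
      h *: ht t W) y).
  exact: (diff_quotient_bound hN0 H1').
by split; [apply/cvg_ex; eexists; exact: cv|exact: cvg_lim cv].
Qed.

Lemma laplace_heat al x y g : 0 < al -> green b (shiftq q al) x g ->
  (\int[lebesgue_measure]_(t in `[0%R, +oo[)
    (expR (- (al * t)) * orbit (mkL2 (l2_one x)) y t)%:E = (g y)%:E)%E.
Proof.
move=> al0 gg; have ca := coercive_shift gb h0 al0.
have [w Hw wE] := (green_resolvent_eq x g al0).1 gg.
have [gD _] := gg; have gl := D_l2 gb h0 al0 gD.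
have [_ wl _] := Hw.
pose U := mkL2 gl; pose W := mkL2 wl; pose I := mkL2 (l2_one x).
have UW : H1L2 b q U W by [].
have IE : I = W + al *: U.
  apply/val_inj/funext => z; have := wE z.
  by rewrite mulNr opprK => E; exact: esym E.
pose F t := - expR (- (al * t)) * orbit U y t.
have oI t : orbit I y t = orbit W y t + al * orbit U y t.
  rewrite /orbit /heat IE (sgrp_D cpl lin acc rng dns)// (sgrp_Z cpl lin acc
    rng dns)//.
have dF t : 0 < t -> is_derive t (1 : R) F (expR (- (al * t)) * orbit I y t).
  move=> t0; have d1 := orbit_deriv y UW t0.
  have d2 : is_derive t (1 : R) (fun s => - expR (- (al * s))) (al * expR (-
    (al * t))).
    have d3 : is_derive t (1 : R) (fun s => - (al * s)) (- al).
      have := is_deriveZ (- al) (is_derive_id t (1 : R)).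
      rewrite /GRing.scale/= mulr1; congr (is_derive _ _ _ _).
      by apply/funext => s /=; rewrite /GRing.scale/= mulNr.
    have := is_deriveN (@is_derive1_comp _ expR (fun s => - (al * s)) t _ _
      (is_derive_expR _) d3).
    by rewrite mulrN opprK mulrC.
  have := is_deriveM d2 d1; congr (is_derive _ _ _ _).
  by rewrite oI /GRing.scale/=; ring.
have cexp t : {for t, continuous (fun s : R => expR (- (al * s)))}.
  apply: continuous_comp; last exact: continuous_expR.
  by apply: continuousN; apply: cvgM; [exact: cvg_cst|exact: cvg_id].
have cF t : {for t, continuous F}.
  by apply: cvgM; [apply: cvgN; exact: cexp|exact: orbit_cont].
(* [F] starts at [- g y] and tends to 0 at infinity. *)
rewrite (ge0_continuous_FTC2y (F := F) (l := 0)).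
- by rewrite sub0e /F mulr0 oppr0 expR0 /orbit normr0 /heat sgrp0 mulN1r EFinN
  oppeK.
- move=> t t0; rewrite mulr_ge0 ?expR_ge0//.
  apply: (heat_ge0 gb h0 Kex) => // z; exact: indic1_ge0.
- apply: continuous_subspaceT => t.
  by apply: cvgM; [exact: cexp|exact: orbit_cont].
(* The bound [|U| * expR (- (al * t))] is at most [e] once [t >= |U| / (e * al)], because
   [expR (al * t) >= 1 + al * t]. *)
- apply/cvgrPdist_le => e e0; near=> t.
  have t0 : 0 < t by near: t; exact: nbhs_pinfty_gt.
  rewrite sub0r normrN /F normrM normrN (gtr0_norm (expR_gt0 _)).
  have oU : `|orbit U y t| <= `|U|.
    apply: le_trans (L2_pt (ht `|t| U) y) _.
    by have [_] := sgrp_contraction cpl lin acc rng dns (normr_ge0 t); exact.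
  apply: le_trans (ler_wpM2l (expR_ge0 _) oU) _.
  rewrite expRN -ler_pdivlMl ?invr_gt0 ?expR_gt0// invrK.
  have te : `|U| / e / al <= t by near: t; apply: nbhs_pinfty_ge;
    rewrite num_real.
  have E1 := expR_ge1Dx (al * t).
  move: te; rewrite !ler_pdivrMr// => te.
  apply: le_trans te _; rewrite [t * al]mulrC; apply: ler_wpM2r;
    first exact: ltW.
  by apply: le_trans E1; rewrite lerDr.
- by move=> t t0; have [] := dF _ t0.
- apply: cvg_at_right_filter; exact: cF.
- by move=> t; rewrite in_itv/= andbT => t0; rewrite derive1E;
  have [_ ->] := dF _ t0.
Unshelve. all: by end_near.
Qed.

Lemma GreenE x y g : coercive b q -> green b q x g -> Green b q x y = g y.
Proof.
move=> cq gg; pose I := mkL2 (l2_one x).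
pose al n : R := n.+1%:R^-1.
have al0 n : 0 < al n by rewrite invr_gt0.
have gex n : exists gn, green b (shiftq q (al n)) x gn.
  have [gn [_ ggn]] := green_exists gb (coercive_shift gb h0 (al0 n)) x Kex.
  by exists gn.
have [gs Hgs] := choice gex.
have gcv : gs n y @[n --> \oo] --> g y.
  apply/cvgn_epsP => e e0; have [d d0 Hd] :=
    green_shift_cvg gb h0 y Kex cq gg e0.
  exists (Num.truncn d^-1) => n nn.
  have ald : al n <= d.
    rewrite /al invf_ple ?posrE//.
    by apply: le_trans (ltW (Num.Theory.truncnS_gt _)) _; rewrite ler_nat ltnS.
  have := Hd _ _ (al0 n) ald (Hgs n).
  have := green_shift_le0 gb h0 y Kex cq (al0 n) (Hgs n) gg.
  by rewrite ler_norml; lra.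
have cexp (a : R) : continuous (fun s : R => expR (- (a * s))).
  move=> t; apply: continuous_comp; last exact: continuous_expR.
  by apply: continuousN; apply: cvgM; [exact: cvg_cst|exact: cvg_id].
have oI0 t : 0 <= orbit I y t.
  apply: (heat_ge0 gb h0 Kex) => // z; exact: indic1_ge0.
have H : (\int[lebesgue_measure]_(t in `[0%R, +oo[) (orbit I y t)%:E =
  (g y)%:E)%E.
  pose D : set R := `[0%R, +oo[%classic.
  have mD : measurable D by exact: measurable_itv.
  pose F n t := (expR (- (al n * t)) * orbit I y t)%:E.
  have mF n : measurable_fun D (F n).
    apply/measurable_EFinP; apply: measurable_funTS.
    apply: continuous_measurable_fun => t.
    by apply: cvgM; [exact: cexp|exact: orbit_cont].
  have F0 (n : nat) t : D t -> (0 <= F n t)%E.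
    by move=> _; rewrite lee_fin mulr_ge0// expR_ge0.
  have Fnd t : D t -> {homo F ^~ t : n m / (n <= m)%N >-> (n <= m)%E}.
    rewrite /D /= in_itv/= andbT => t0 n m nm; rewrite lee_fin;
      apply: ler_wpM2r => //.
    rewrite ler_expR lerN2; apply: ler_wpM2r => //.
    by rewrite lef_pV2 ?posrE// ler_nat ltnS.
  have := monotone_convergence lebesgue_measure mD mF F0 Fnd.
  under [X in _ = limn X]eq_fun do rewrite (laplace_heat y (al0 _) (Hgs _)).
  have -> : limn (fun n => (gs n y)%:E) = (g y)%:E.
    by apply/cvg_lim => //; apply: cvg_EFin gcv; exact: nearW.
  move=> <-; apply: eq_integral => t _; apply/esym/cvg_lim => //.
  apply: cvg_EFin; first exact: nearW.
  rewrite -[X in _ --> X]mul1r; apply: cvgM; last exact: cvg_cst.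
  have c1 : - (al n * t) @[n --> \oo] --> - (0 * t).
    by apply: cvgN; apply: cvgM; [exact: cvg_harmonic|exact: cvg_cst].
  have c2 : expR (- (al n * t)) @[n --> \oo] --> expR (- (0 * t)).
    by apply: continuous_cvg; [exact: continuous_expR|exact: c1].
  by rewrite mul0r oppr0 expR0 in c2.
(* [Green] is [fine] of the extended integral, whose value [H] shows to be finite. *)
rewrite /Green /Rintegral -[RHS]/(fine (g y)%:E) -H; congr fine.
apply: eq_integral => t; rewrite inE /= in_itv/= andbT => t0.
have E : exp_semigroup (H1 b q) t \1_[set x] = heat b q t I.
  exact: (exp_semigroupE gb h0 Kex I t0).
by rewrite E /orbit (ger0_norm t0).
Qed.

End GreenIntegral.

(** * Characterizations of the Green function *)

Section PointedNorm.
Variables (R : realType) (X : choiceType) (b : X -> X -> R) (q : X -> R).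
Hypothesis gb : is_graph b.
Hypothesis co : coercive b q.
Variable o : X.
Implicit Types (f g : X -> R) (x y : X) (phi : nat -> X -> R).
Local Notation a := (form_ext b q).
Local Notation D := (form_dom b q).

Let asi : semi_inner D a. Proof. exact: form_ext_si. Qed.

(** Coercivity bounds [phi o ^+ 2] by a multiple of [h(phi)], so the term at the base point adds
    nothing to the Cauchy condition. *)
Lemma ho_approxE phi f : ho_approx b q o phi f <-> h_approx b q phi f.
Proof.
split=> -[fC hC fl]; split => // e e0.
  have s0 : 0 < Num.sqrt e by rewrite sqrtr_gt0.
  have [n0 Hn] := hC _ s0; exists n0 => m n mn0 nn0.
  have := Hn _ _ mn0 nn0; rewrite /ho_norm ltr_sqrt// => H.
  by apply: le_lt_trans H; rewrite lerDl sqr_ge0.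
have [C C0 HC] := co.2 o.
have d0 : 0 < e ^+ 2 / (C + 1) by rewrite divr_gt0 ?exprn_gt0// addr_gt0.
have [n0 Hn] := hC _ d0; exists n0 => m n mn0 nn0.
have := Hn _ _ mn0 nn0; rewrite ltr_pdivlMr ?addr_gt0// => H1.
have H2 := HC _ (CcB (fC m) (fC n)).
rewrite /ho_norm -[ltRHS](ger0_norm (ltW e0)) -sqrtr_sqr ltr_sqrt ?exprn_gt0//.
by apply: le_lt_trans H1; rewrite mulrDr mulr1 addrC lerD2r mulrC.
Qed.

Lemma DhoE f : Dho b q o f <-> D f.
Proof. by split=> -[phi Hf]; exists phi; exact/ho_approxE. Qed.

Lemma hbar_quadE f : D f -> hbar_quad b q o f = a f f.
Proof.
move=> [phi Hf]; apply: (quad_extE gb co); first by move=> psi /ho_approxE.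
by exists phi; exact/ho_approxE.
Qed.

Lemma hbarE f g : D f -> D g -> hbar b q o f g = a f g.
Proof. by apply: (polarizeE gb co) => k; exact: hbar_quadE. Qed.

Lemma h_approx_Dho_norm phi f : h_approx b q phi f ->
  Dho_norm b q o (phi n - f) @[n --> \oo] --> (0 : R).
Proof.
move=> Hf; have [fC _ fl] := Hf; have fD : D f by exists phi.
have E n : Dho_norm b q o (phi n - f) =
    Num.sqrt (a (phi n - f) (phi n - f) + (phi n o - f o) ^+ 2).
  rewrite /Dho_norm hbar_quadE//; apply: (siDB asi) => //; exact: form_dom_Cc.
under eq_fun do rewrite E.
have c1 : a (phi n - f) (phi n - f) + (phi n o - f o) ^+ 2 @[n --> \oo] -->
    (0 + (f o - f o) ^+ 2 : R).
  apply: cvgD; first exact: (h_approx_form_ext gb co Hf).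
  by apply: cvgM; apply: cvgB; [exact: fl|exact: cvg_cst|exact: fl|exact:
    cvg_cst].
have : Num.sqrt (a (phi n - f) (phi n - f) + (phi n o - f o) ^+ 2) @[n --> \oo]
    --> Num.sqrt (0 + (f o - f o) ^+ 2).
  by apply: continuous_cvg; [exact: sqrt_continuous|exact: c1].
by rewrite subrr expr0n addr0 sqrtr0.
Qed.

Variable K : nat -> set X.
Hypothesis Kex : exhaustion K.

(** The capacity of [x]. Cauchy-Schwarz against the kernel gives [1 = f x ^+ 2 <= g x * h(f)]; the
    bound is approached by the normalised solutions on finite sets, as [g / g x] itself need not
    have finite support. *)
Lemma inf_capacity x g : green b q x g ->
  inf [set hquad b q f | f in [set f | Cc f /\ f x = 1]] = (g x)^-1.
Proof.
move=> gg; have [gD _] := gg; have gx := green_self gb co gg.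
have agg : a g g = g x by exact: (green_D0 gb co gg gD).
have lb f : Cc f -> f x = 1 -> (g x)^-1 <= hquad b q f.
  move=> fC fx; have fD : D f by exact: form_dom_Cc.
  have := siCS asi gD fD; rewrite (green_D0 gb co gg fD) fx expr1n agg.
  by rewrite (form_ext_Cc gb co fC fC) -ler_pdivrMl// mulr1.
pose u n := HKinv b q (K n) \1_[set x].
have Hg : h_approx b q u g by exact: (green_cvg gb co Kex gg).
have [uC _ ul] := Hg; set A := [set _ | _ in _].
have lbA : has_lbound A by exists (g x)^-1 => _ [f [fC fx] <-]; exact: lb.
(* [u n x] is 0 while [x] is outside [K n], so normalising is possible only from some index on. *)
have [n0 Hn] : exists n0 : nat, forall n, (n0 <= n)%N -> 0 < u n x.
  have /cvgn_epsP/(_ (g x / 2))[] := ul x; first by rewrite divr_gt0.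
  by move=> n0 Hn; exists n0 => n /Hn; rewrite ler_norml; lra.
have inA n : (n0 <= n)%N -> A ((u n x)^-1 ^+ 2 * hquad b q (u n)).
  move=> /Hn un0; exists ((u n x)^-1 *: u n).
    by split; [exact: CcZ|rewrite scalefctE mulVf// gt_eqF].
  exact: (siQZ (hform_si gb co.1)).
apply/eqP; rewrite eq_le; apply/andP; split; last first.
  apply: lb_le_inf; last by move=> _ [f [fC fx] <-]; exact: lb.
  by eexists; exact: inA (leqnn n0).
have cv : (u n x)^-1 ^+ 2 * hquad b q (u n) @[n --> \oo] --> (g x)^-1 ^+ 2 * g
  x.
  have iv : (u n x)^-1 @[n --> \oo] --> (g x)^-1 by apply: cvgV => //;
    rewrite gt_eqF.
  by apply: cvgM; [exact: cvgM|rewrite -agg; exact: (form_extP gb co Hg Hg)].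
have -> : (g x)^-1 = (g x)^-1 ^+ 2 * g x by field; rewrite gt_eqF.
apply: (cvgr_to_ge cv); exists n0 => // n /= nn0.
by apply: ge_inf => //; exact: inA.
Qed.

Lemma normalized_quad x c g : green b q x g -> c != 0 ->
  hbar_quad b q o (fun y => c * g y / (c * g x)) = (g x)^-1.
Proof.
move=> gg c0; have [gD _] := gg; have gx := green_self gb co gg.
have -> : (fun y => c * g y / (c * g x)) = (g x)^-1 *: g.
  apply/funext => y; rewrite scalefctE; field.
  by rewrite c0 gt_eqF.
rewrite hbar_quadE; last exact: (siDZ asi).
rewrite (siQZ asi _ gD) (green_D0 gb co gg gD).
by field; rewrite gt_eqF.
Qed.

(** The normalised minimiser is unique: its squared distance to [g / g x] expands to
    [1 / g x - 2 / g x + 1 / g x]. The normalisation forgets the scale, so [g'] is found up to a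
    factor. *)
Lemma minimizer_green x g g' : green b q x g -> D g' ->
  hbar_quad b q o (fun y => g' y / g' x) = (g x)^-1 ->
  g' x != 0 /\ g' = (g' x / g x) *: g.
Proof.
move=> gg gD'; have [gD _] := gg; have gx := green_self gb co gg.
have -> : (fun y => g' y / g' x) = (g' x)^-1 *: g'.
  by apply/funext => y; rewrite scalefctE mulrC.
pose v := (g' x)^-1 *: g'; have vD : D v by exact: (siDZ asi).
rewrite hbar_quadE// -/v => E.
(* If [g' x = 0], division by zero makes [v] the zero function, of energy 0 instead of
   [(g x)^-1 > 0]. *)
have gx' : g' x != 0.
  apply/eqP => g'0; move: E; rewrite /v g'0 invr0 scale0r.
  rewrite (siB0 asi); last exact: (si0 asi).
  by move=> /esym/eqP; rewrite invr_eq0 gt_eqF.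
split => //; have vx : v x = 1 by rewrite /v scalefctE mulVf.
have wD : D ((g x)^-1 *: g) by exact: (siDZ asi).
have : v - (g x)^-1 *: g = 0.
  apply: (form_ext_eq0 gb co); first exact: (siDB asi).
  rewrite (siQB asi vD wD) (siBZr asi _ gD vD) (siQZ asi _ gD) E.
  rewrite (siS asi vD gD) (green_D0 gb co gg vD) (green_D0 gb co gg gD) vx.
  by rewrite le_eqVlt; apply/orP; left; apply/eqP; field; rewrite gt_eqF.
move/eqP; rewrite subr_eq0 => /eqP vE.
by rewrite -scalerA -vE /v scalerA mulfV// scale1r.
Qed.

End PointedNorm.

(** The quotient [g / g x] is unchanged when [g] is multiplied by a nonzero constant, so the
    variational condition alone cannot single out [G x]. In the cycle of equivalences it is joined
    with [g x = G x x], and a separate clause states that by itself it describes exactly the nonzero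
    multiples of [G x]. *)
Theorem theorem5p16 (R : realType) (X : choiceType)
  (X_infinite : infinite_set [set: X])
  (b : X -> X -> R) (b_graph : is_graph b) (b_connected : connected_graph b)
  (q : X -> R) (h_ge0 : form_ge0 b q) (h_subcritical : subcritical b q)
  (o : X) :
  let G : X -> X -> R := Green b q in
  (* (a) *)
  ([/\ forall x y : X,
         resolvent (H1 b q) l \1_[set x] y @[l --> 0^'-] --> G x y,
       forall (x y : X) (l m : R), l <= m -> m < 0 ->
         resolvent (H1 b q) l \1_[set x] y <=
         resolvent (H1 b q) m \1_[set x] y,
       forall x y : X, G x y = G y x,
       forall x : X, superharmonic b q (G x) /\
                     superharmonic b q (fun y => G y x)
     & forall x z : X, Hop b q (G x) z = \1_[set x] z /\
                       Hop b q (fun y => G y x) z = \1_[set x] z]) /\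
  (* (b) *)
  ([/\ forall (K : nat -> set X), exhaustion K -> forall x : X,
         [/\ forall y : X,
               HKinv b q (K n) \1_[set x] y @[n --> \oo] --> G x y,
             forall (y : X) (n m : nat), (n <= m)%N -> K n x ->
               HKinv b q (K n) \1_[set x] y <= HKinv b q (K m) \1_[set x] y
           & Dho_norm b q o (HKinv b q (K n) \1_[set x] - G x)
               @[n --> \oo] --> (0 : R)],
       forall x : X, Dho b q o (G x),
       forall (g : X -> R) (x : X), Dho b q o g ->
         [<-> g = G x ;
              g x = G x x /\
              hbar_quad b q o (fun y => g y / g x) =
                inf [set hquad b q f | f in [set f | Cc f /\ f x = 1]] ;
              Fdom b g /\ forall z : X, Hop b q g z = \1_[set x] z ;
              forall f : X -> R, Dho b q o f -> hbar b q o g f = f x]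
     & forall (g : X -> R) (x : X), Dho b q o g ->
         (hbar_quad b q o (fun y => g y / g x) =
            inf [set hquad b q f | f in [set f | Cc f /\ f x = 1]]
          <-> exists2 c : R, c != 0 & g = (fun y => c * G x y))]) /\
  (* (c) *)
  (forall x : X,
     [/\ positive (G x),
         Fdom b (G x),
         forall z : X, \1_[set x] z <= Hop b q (G x) z
       & forall g : X -> R, positive g -> Fdom b g ->
           (forall z : X, \1_[set x] z <= Hop b q g z) ->
           forall y : X, G x y <= g y]).
Proof.
move=> G.
have co := subcritical_coercive b_graph b_connected h_ge0 h_subcritical.
have [K0 K0ex] := exhaustion_exists o b_graph b_connected.
have asi := form_ext_si b_graph co.
have gG x : green b q x (G x).
  have [g [_ gg]] := green_exists b_graph co x K0ex.
  have -> // : G x = g.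
  by apply/funext => y; exact: (GreenE b_graph h_ge0 K0ex y co gg).
have GF x : Fdom b (G x) by have [GD _] := gG x;
  exact: (form_dom_Fdom b_graph co GD).
have GD x : form_dom b q (G x) by have [] := gG x.
have GH x z : Hop b q (G x) z = \1_[set x] z by have [_] := gG x; exact.
have Gsym x y : G x y = G y x by exact: (green_sym b_graph co (gG x) (gG y)).
have Gfl x : (fun y => G y x) = G x by apply/funext => y.
have res l x : l < 0 -> exists2 g, green b (shiftq q (- l)) x g &
    resolvent (H1 b q) l \1_[set x] = g.
  move=> l0; have al0 : 0 < - l by rewrite oppr_gt0.
  have ca := coercive_shift b_graph h_ge0 al0.
  have [g [_ gg]] := green_exists b_graph ca x K0ex; exists g => //.
  exact: (resolventE b_graph h_ge0 l0 gg).
split; [split|split; [split|]].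
- move=> x y; apply: cvg_at_left0 => e e0.
  have [d d0 Hd] := green_shift_cvg b_graph h_ge0 y K0ex co (gG x) e0.
  exists d => // t t0 td; have [|g gg ->] := res (- t) x;
    first by rewrite oppr_lt0.
  rewrite opprK in gg; have := Hd _ _ t0 td gg.
  have := green_shift_le0 b_graph h_ge0 y K0ex co t0 gg (gG x).
  by rewrite ler_norml; lra.
- move=> x y l m lm m0; have l0 := le_lt_trans lm m0.
  have [g gg ->] := res l x l0; have [g' gg' ->] := res m x m0.
  apply: (green_shift_le b_graph h_ge0 y K0ex _ _ gg gg').
    by rewrite oppr_gt0.
  by rewrite lerN2.
- exact: Gsym.
- move=> x; rewrite Gfl; suff : superharmonic b q (G x) by [].
  by split=> [|z]; [exact: GF|rewrite GH indic1_ge0].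
- by move=> x z; rewrite Gfl.
- move=> K Kex x; have Hg := green_cvg b_graph co Kex (gG x).
  have [_ _ ul] := Hg; have [Kf KS _] := Kex; split; first exact: ul.
    move=> y n m nm _; apply: (HKinv_mono b_graph co) => //.
    move=> z Kz; have := exhaustion_mono Kex nm => /fsubsetP/(_ z).
    by rewrite !in_fset_set// !inE; exact.
  exact: (h_approx_Dho_norm b_graph co o Hg).
- by move=> x; apply/(DhoE co o _).
- move=> g x /(DhoE co o _) gD.
  rewrite (inf_capacity b_graph co K0ex (gG x)); tfae.
  + move=> ->; split => //.
    have := normalized_quad b_graph co o (gG x) (oner_neq0 R).
    by under eq_fun do rewrite !mul1r.
  + move=> [gx /(minimizer_green b_graph co (gG x) gD)[gx0 ->]].
    rewrite gx divff ?scale1r; last by rewrite -gx.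
    by split; [exact: GF|exact: GH].
  + move=> [gF gH] f /(DhoE co o _) fD; rewrite (hbarE b_graph co o gD fD).
    by apply: (green_D0 b_graph co _ fD); split.
  + move=> gf; apply: (green_unique b_graph co _ (gG x)).
    apply: (reproducing_green b_graph co gD) => f fC.
    have fD : form_dom b q f by exact: form_dom_Cc.
    by rewrite -(hbarE b_graph co o gD fD); apply: gf; exact/(DhoE co o _).
- move=> g x /(DhoE co o _) gD.
  rewrite (inf_capacity b_graph co K0ex (gG x)); split=> [|[c c0 ->]].
    move=> /(minimizer_green b_graph co (gG x) gD)[gx0 gE].
    exists (g x / G x x); last exact: gE.
    by rewrite mulf_neq0// invr_neq0// gt_eqF//;
      exact: (green_self b_graph co (gG x)).
  exact: (normalized_quad b_graph co o (gG x) c0).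
- move=> x; split.
  + split=> [y|]; first exact: (green_ge0 b_graph co y K0ex (gG x)).
    by exists x; rewrite gt_eqF//; exact: (green_self b_graph co (gG x)).
  + exact: GF.
  + by move=> z; rewrite GH.
  + move=> g [g0 _] gF gH y; exact: (green_le b_graph co y K0ex (gG x) g0 gF
    gH).
Qed.
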